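(* Let $\mathcal{H}$ be a homogeneous foliation of degree $d\geq3$ on $\mathbb{P}^2_{\mathbb{C}}$ defined by the $1$-form $$\omega=A(x,y)\,\mathrm{d}x+B(x,y)\,\mathrm{d}y,\quad A,B\in\mathbb{C}[x,y]_d,\quad \gcd(A,B)=1.$$ Let $(p,q)$ be the affine chart of the dual plane $\check{\mathbb{P}}^2_{\mathbb{C}}$ associated to the line $\{y=px-q\}\subset\mathbb{P}^2_{\mathbb{C}}$ and let $D=\{p=p_0\}$ ($p_0\in\mathbb{C}$) be an irreducible component of $\Delta(\mathrm{Leg}\,\mathcal{H})\setminus\check{O}$. Write $\underline{\mathcal{G}}_{\mathcal{H}}^{-1}([p_0:1])=\{[a_1:b_1],\ldots,[a_n:b_n]\}$ and denote by $\nu_i$ the ramification index of $\underline{\mathcal{G}}_{\mathcal{H}}$ at the point $[a_i:b_i]\in\mathbb{P}^1_{\mathbb{C}}$. For $i\in\{1,\ldots,n\}$, define the polynomials $P_i\in\mathbb{C}[x,y]_{d-\nu_i}$ and $Q_i\in\mathbb{C}[x,y]_{2d-\nu_i-1}$ by $$P_i(x,y;a_i,b_i):=\frac{A(x,y)B(b_i,a_i)-A(b_i,a_i)B(x,y)}{(b_iy-a_ix)^{\nu_i}}$$ and $$Q_i(x,y;a_i,b_i):=(\nu_i-2)\left(\frac{\partial B}{\partial x}-\frac{\partial A}{\partial y}\right)P_i(x,y;a_i,b_i)+2(\nu_i+1)\left(\frac{\partial P_i}{\partial x}\,B(x,y)-\frac{\partial P_i}{\partial y}\,A(x,y)\right).$$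 Then the curvature of $\mathrm{Leg}\,\mathcal{H}$ is holomorphic on $D$ if and only if $$\sum_{i=1}^{n}\left(1-\frac{1}{\nu_{i}}\right)\frac{(p_0b_i-a_i)\,Q_i(b_i,a_i;a_i,b_i)}{P_i(b_i,a_i;a_i,b_i)\,B(b_i,a_i)}=0.$$
   Context: $\mathbb{C}[x,y]_k$ denotes the space of homogeneous polynomials of degree $k$. A homogeneous foliation $\mathcal{H}$ of degree $d$ on $\mathbb{P}^2_{\mathbb{C}}$ is one given, in suitable affine coordinates $(x,y)$, by a $1$-form $\omega=A\,\mathrm{d}x+B\,\mathrm{d}y$ with $A,B\in\mathbb{C}[x,y]_d$, $\gcd(A,B)=1$. Its associated rational map is $$\underline{\mathcal{G}}_{\mathcal{H}}:\mathbb{P}^1_{\mathbb{C}}\to\mathbb{P}^1_{\mathbb{C}},\qquad \underline{\mathcal{G}}_{\mathcal{H}}([y:x])=[-A(x,y):B(x,y)].$$ The Legendre transform (dual web) $\mathrm{Leg}\,\mathcal{H}$ is the $d$-web on the dual projective plane $\check{\mathbb{P}}^2_{\mathbb{C}}$ whose leaves are the tangent lines to the leaves of $\mathcal{H}$. In the affine chart $(p,q)$ of $\check{\mathbb{P}}^2_{\mathbb{C}}$ corresponding to the line $\{y=px-q\}$, it is given by the implicit differential equation $A(x,px-q)+pB(x,px-q)=0$ with $x=\frac{\mathrm{d}q}{\mathrm{d}p}$. The line $\check{O}\subset\check{\mathbb{P}}^2_{\mathbb{C}}$ is the dual line of the origin of the affine chart $(x,y)$ (i.e. $\check O=\{q=0\}$).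 **Webs, discriminant and curvature.** A $d$-web $\mathcal{W}$ on a complex surface is given locally by a $d$-symmetric $1$-form $\sum_{i=0}^d c_i(u,v)(\mathrm{d}u)^i(\mathrm{d}v)^{d-i}$ with isolated zeros (well defined up to nowhere vanishing holomorphic factors) which at generic points is a product of $d$ pairwise linearly independent $1$-forms; equivalently by the implicit differential equation $\sum_i c_i(u,v)\,(\mathrm{d}v/\mathrm{d}u)^{d-i}=0$. Its discriminant $\Delta(\mathcal{W})$ is the divisor where the discriminant of this form vanishes. For $d\ge 3$, near a point outside $\Delta(\mathcal{W})$, $\mathcal{W}$ is a superposition of $d$ pairwise transverse foliations defined by non-vanishing $1$-forms $\omega_1,\dots,\omega_d$; define $\delta_{ij}$ by $\omega_i\wedge\omega_j=\delta_{ij}\,\mathrm{d}u\wedge\mathrm{d}v$, let $\eta_{rst}$ ($r<s<t$) be the unique meromorphic $1$-form with $\mathrm{d}(\delta_{st}\omega_r)=\eta_{rst}\wedge\delta_{st}\omega_r$, $\mathrm{d}(\delta_{tr}\omega_s)=\eta_{rst}\wedge\delta_{tr}\omega_s$, $\mathrm{d}(\delta_{rs}\omega_t)=\eta_{rst}\wedge\delta_{rs}\omega_t$, and set $\eta(\mathcal{W})=\sum_{r<s<t}\eta_{rst}$, which is well defined up to adding $\mathrm{d}g/g$ with $g$ nowhere vanishing holomorphic. The curvature $K(\mathcal{W})=\mathrm{d}\,\eta(\mathcal{W})$ does not depend on choices and extends to a global meromorphic $2$-form with poles along $\Delta(\mathcal{W})$. **Convention.** ''Holomorphic on $D$'' means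 holomorphic in a neighborhood of every generic point of $D$. *)

(* Defs.v *)
(* The complex field is R[i], for R : realType. *)
From HB Require Import structures.
From mathcomp Require Import all_boot all_order all_algebra.
(* the notations of multinomials clash with those of MathComp-Analysis *)
From mathcomp Require Export -(notations) mpoly.
From mathcomp Require Import all_classical all_reals all_analysis.
From mathcomp Require Import complex.

Set Implicit Arguments.
Unset Strict Implicit.
Unset Printing Implicit Defensive.

Import Order.TTheory GRing.Theory Num.Theory.
Import numFieldNormedType.Exports.

Local Open Scope classical_set_scope.
Local Open Scope ring_scope.

(* R[i]^o is R[i] with its normed-module structure over itself. *)
Notation C2 R := (R[i]^o * R[i]^o)%type.

(* The two variables have indices [ord0] and [ord_max]: they are (x, y) on the
   plane and (p, q) on the dual plane. *)
Notation bipoly R := (mpoly 2 R[i]).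

Definition var (R : realType) (k : 'I_2) : bipoly R := mpolyX R[i] (mnm1 k).

Definition ev (R : realType) (P : bipoly R) (x y : R[i]) : R[i] :=
  meval (tnth [tuple x; y]) P.

Definition mdvd (R : realType) (D P : bipoly R) : Prop := exists S, P = D * S.

Definition mcoprime (R : realType) (A B : bipoly R) : Prop :=
  forall D, mdvd D A -> mdvd D B -> D \is a GRing.unit.

(* [a : b] and [a' : b'] denote the same point, for nonzero pairs. *)
Definition same_point (R : realType) (a b a' b' : R[i]) : Prop :=
  a * b' = a' * b.

Definition in_fiber (R : realType) (A B : bipoly R) (p0 a b : R[i]) : Prop :=
  same_point (- ev A b a) (ev B b a) p0 1.

(* The (a i, b i) are homogeneous coordinates of the pairwise distinct points
   of the fiber over [p0 : 1]. *)
Definition enumerates_fiber (R : realType) (A B : bipoly R) (p0 : R[i])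
    (n : nat) (a b : 'I_n -> R[i]) : Prop :=
  [/\ forall i, (a i, b i) != (0, 0) /\ in_fiber A B p0 (a i) (b i),
      forall i j, same_point (a i) (b i) (a j) (b j) -> i = j
    & forall a' b', (a', b') != (0, 0) -> in_fiber A B p0 a' b' ->
        exists i, same_point a' b' (a i) (b i)].

(* Coordinates (x, y) of the point of parameter t = 'X in an affine chart of
   the projective line centered at [y : x] = [a : b]. *)
Definition P1_chart (R : realType) (a b : R[i]) : 2.-tuple {poly R[i]} :=
  if b != 0 then [tuple b%:P; a%:P + 'X] else [tuple 'X; a%:P].

(* Local degree of [G0 : G1] = [-A : B] at [a : b]. Up to a function which does
   not vanish at G(a,b), the coordinate [u : v] |-> u G1(a,b) - G0(a,b) v is a
   local parameter of the target at G(a,b); the index is the order of vanishing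
   of its pullback, written in the chart above. *)
Definition ramification_index (R : realType) (A B : bipoly R)
    (a b : R[i]) : nat :=
  let loc P := mmap (@polyC R[i]) (tnth (P1_chart a b)) P in
  mup 0 (loc (- A) * (ev B b a)%:P - (ev (- A) b a)%:P * loc B).

(* In coordinates (u, v), an element F of C[u,v][z] and an integer d >= deg_z F
   stand for the equation F(u, v, dv/du) = 0, i.e. for the d-symmetric form
   \sum_i F_i(u,v) (du)^(d-i) (dv)^i. *)
Notation implicit_eq R := {poly (mpoly 2 R[i])}.

Definition sym_form (R : realType) (d : nat) (F : implicit_eq R)
    (z t : C2 R) : R[i] :=
  \sum_(i < d.+1) ev F`_i z.1 z.2 * t.1 ^+ (d - i) * t.2 ^+ i.

(* Discriminant of \sum_i F_i s^(d-i) t^i as a binary form of degree d, up to a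
   nonzero constant: Sylvester determinant of its partial derivatives, both seen
   as forms of degree d - 1 (and dehomogenized at s = 1 below). [resultant F
   F^`()] is not suitable, as it has the leading coefficient F_d, which depends
   on (u, v), as an extra factor. *)
Definition web_disc (R : realType) (d : nat) (F : implicit_eq R) : bipoly R :=
  let n := d.-1 in
  let Ft := F^`() in
  let Fs := F *+ d - 'X * F^`() in
  \det (col_mx (\matrix_(i < n, j < (n + n)%N) (Ft * 'X^i)`_j)
               (\matrix_(i < n, j < (n + n)%N) (Fs * 'X^i)`_j)).

(* The line {u = u0} is a component of the divisor of the discriminant. *)
Definition line_in_disc (R : realType) (d : nat) (F : implicit_eq R)
    (u0 : R[i]) : Prop :=
  mdvd (var R ord0 - mpolyC 2 u0) (web_disc d F).

Definition holomorphic_on (R : realType) (W : normedModType R[i])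
    (U : set (C2 R)) (f : C2 R -> W) : Prop :=
  forall z, U z -> differentiable f z.

(* 1-forms a du + b dv are maps z |-> (a z, b z), 2-forms k du /\ dv are given
   by k. *)
Definition wedge (R : realType) (al be : C2 R) : R[i] :=
  al.1 * be.2 - al.2 * be.1.

Definition ext_d (R : realType) (al : C2 R -> C2 R) (z : C2 R) : R[i] :=
  'D_((1, 0) : C2 R) (fun x => (al x).2 : R[i]^o) z
  - 'D_((0, 1) : C2 R) (fun x => (al x).1 : R[i]^o) z.

(* On the open set U, the web is the superposition of the pairwise transverse
   foliations defined by the nonvanishing 1-forms w i. *)
Definition superposition (R : realType) (d : nat) (F : implicit_eq R)
    (U : set (C2 R)) (w : 'I_d -> C2 R -> C2 R) : Prop :=
  [/\ forall i, holomorphic_on U (w i),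
      forall i z, U z -> w i z != 0,
      forall i j z, U z -> i != j -> wedge (w i z) (w j z) != 0
    & exists g : C2 R -> R[i]^o,
        [/\ holomorphic_on U g, forall z, U z -> g z != 0
          & forall z t, U z -> sym_form d F z t =
              g z * \prod_(i < d) ((w i z).1 * t.1 + (w i z).2 * t.2)]].

(* d(delta_st w_r) = eta /\ delta_st w_r on U, where delta_st = w_s /\ w_t. *)
Definition normalizes (R : realType) (U : set (C2 R))
    (eta wr ws wt : C2 R -> C2 R) : Prop :=
  let al z := (wedge (ws z) (wt z) : R[i]) *: wr z in
  forall z, U z -> ext_d al z = wedge (eta z) (al z).

(* The curvature at z is k du /\ dv. The forms eta_rst are holomorphic here, as
   the delta_ij do not vanish on U. *)
Definition curvature_at (R : realType) (d : nat) (F : implicit_eq R)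
    (z : C2 R) (k : R[i]) : Prop :=
  exists (U : set (C2 R)) (w : 'I_d -> C2 R -> C2 R)
         (eta : 'I_d -> 'I_d -> 'I_d -> C2 R -> C2 R),
    [/\ open U /\ U z,
        superposition F U w,
        forall r s t : 'I_d, (r < s)%N -> (s < t)%N ->
          [/\ holomorphic_on U (eta r s t),
              normalizes U (eta r s t) (w r) (w s) (w t),
              normalizes U (eta r s t) (w s) (w t) (w r)
            & normalizes U (eta r s t) (w t) (w r) (w s)]
      & k = ext_d (fun x => \sum_(r < d) \sum_(s < d | (r < s)%N)
                     \sum_(t < d | (s < t)%N) eta r s t x) z].

(* The curvature, a 2-form on the complement of the discriminant, extends
   holomorphically near every generic point of the curve D, i.e. near every
   point of D outside a finite set. *)
Definition curvature_holomorphic_on (R : realType) (d : nat)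
    (F : implicit_eq R) (D : set (C2 R)) : Prop :=
  exists E : set (C2 R), finite_set E /\
    forall z0, D z0 -> ~ E z0 ->
      exists (U : set (C2 R)) (k : C2 R -> R[i]^o),
        [/\ open U /\ U z0,
            holomorphic_on U k
          & forall z, U z -> ev (web_disc d F) z.1 z.2 != 0 ->
              curvature_at d F z (k z)].

(* A(x, px - q) + p B(x, px - q) with x = dq/dp, in coordinates (p, q). When A
   and B are coprime of degree d >= 2, its coefficients have no common factor,
   so that the associated d-symmetric form has isolated zeros. *)
Definition Leg (R : realType) (A B : bipoly R) : implicit_eq R :=
  let p := (var R ord0)%:P : implicit_eq R in
  let q := (var R ord_max)%:P : implicit_eq R in
  let on_line P :=
    mmap (fun c : R[i] => (mpolyC 2 c)%:P) (tnth [tuple 'X; p * 'X - q]) P in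
  on_line A + p * on_line B.

Definition Qpoly (R : realType) (A B P : bipoly R) (nu : nat) : bipoly R :=
  mpolyC 2 (nu%:R - 2) * (mderiv ord0 B - mderiv ord_max A) * P
  + mpolyC 2 (2 * (nu%:R + 1)) * (mderiv ord0 P * B - mderiv ord_max P * A).

(* Main.v *)
(* Choose a basis e0 = (x0, y0), e1 = (x1, y1) of the plane with B(e1) = 0, and
   let a, b be the restrictions of A, B to the line e0 + s e1. Write
   l(s) = p (x0 + x1 s) - (y0 + y1 s). By homogeneity, the leaves of Leg H
   through (p, q) are given by the d roots s_r of a + p b: they are defined by
   l(s_r) dq - q (x0 + x1 s_r) dp, and s_r is a function of p alone. Hence, up to
   closed forms, eta_rst = E1 dp + (E2 / q) dq with E1, E2 depending only on p,
   and K = beta'(p) / q dp /\ dq where beta is the sum of the E2.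

   Now 6 beta is the sum over the roots of a rational function of p and s_r, so
   it is rational in p. Substituting p = - a(s) / b(s) shows that its pole at p0
   is at most simple, and the values at the roots of a + p0 b, which are the
   points of the fiber, counted nu_i times, show that its residue is the opposite
   of the sum in the statement. Finally beta' is holomorphic at p0 exactly when
   this residue vanishes. *)

Require Import Defs.
From HB Require Import structures.
From mathcomp Require Import all_boot all_order all_fingroup all_algebra.
From mathcomp Require Import all_classical all_reals all_analysis.
From mathcomp Require Import complex ring zify.

Set Implicit Arguments.
Unset Strict Implicit.
Unset Printing Implicit Defensive.

Import Order.TTheory GRing.Theory Num.Theory.
Import numFieldNormedType.Exports.

Local Open Scope classical_set_scope.
Local Open Scope ring_scope.

(** * Traces over the roots of a pencil of polynomials *)

(** The condition B(e1) = 0 makes A(e1) the leading coefficient of a + p b for every p: no root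
    escapes to infinity, and symmetric functions of the roots are polynomials in p. The obstacle is
    the collision of roots at p0, where the derivatives of a + p b in the denominators vanish. With
    F0 = a + p0 b, a root s satisfies p - p0 = - F0(s) / b(s). After this substitution the repeated
    factors of F0 cancel in p - p0 times each summand, except for simple poles at the points of the
    fiber that come from the third derivative. Their traces stay finite: where nu_i > 1, both F0 and
    F0' vanish, so the logarithmic derivative of a + p b at the point is that of b, whatever p !=
    p0. As the curvature is specified through a choice of local 1-forms, two facts are proved: any
    choice leads to the formula for K, and a choice exists where q != 0 and the roots are simple. *)

Section SymmetricFunctionsOfRoots.
Context (F : fieldType) (d : nat).
Implicit Types (a b h k : {poly F}) (s : 'I_d -> F).

(** The elementary symmetric functions of the roots are, up to sign and the constant factor c, the
    coefficients of a + p b, hence affine in p. *)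
Lemma symmetric_horner (q : mpoly d F) a b (c : F) : c != 0 ->
  q \is (@mpoly.symmetric d F) ->
  exists n : {poly F}, forall p s,
    a + p *: b = c *: \prod_r ('X - (s r)%:P) -> n.[p] = meval s q.
Proof.
move=> c0 /sym_fundamental[t [tq _]].
pose E (i : 'I_d) : {poly F} :=
  ((-1) ^+ i.+1 / c) *: ((a`_(d - i.+1))%:P + (b`_(d - i.+1)) *: 'X).
exists (mmap (@polyC F) E t) => p s sP.
have Ei (i : 'I_d) : (E i).[p] = meval s (mesym d F i.+1).
  pose k : 'I_d.+1 := lift ord0 i.
  have := mroots_coeff [tuple s r | r < d] k.
  rewrite big_tuple (eq_bigr (fun r => 'X - (s r)%:P)); last first.
    by move=> r _; rewrite tnth_mktuple.
  have -> : \prod_(r < d) ('X - (s r)%:P) = c^-1 *: (a + p *: b).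
    by rewrite sP scalerA mulVf// scale1r.
  rewrite (@meval_eq _ _ (tnth [tuple s r | r < d]) s); last first.
    by move=> r; rewrite tnth_mktuple.
  rewrite !coefZ coefD coefZ /= /bump leq0n add1n => h.
  have {}h : meval s (mesym d F i.+1) =
     (-1) ^+ i.+1 * (c^-1 * (a`_(d - i.+1) + p * b`_(d - i.+1))).
    by rewrite h mulrA -expr2 sqrr_sign mul1r.
  rewrite h /E hornerZ hornerD hornerC hornerZ hornerX; ring.
rewrite -tq comp_mpoly_meval.
have -> : meval (fun i => meval s (tnth [tuple mesym d F i.+1 | i < d] i)) t
  = meval (fun i => (E i).[p]) t.
  by apply: meval_eq => i; rewrite tnth_mktuple Ei.
elim/mpolyind: t {tq} => [|e m t _ _ IH]; first by rewrite !raddf0 horner0.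
rewrite !raddfD /= hornerD IH; congr (_ + _).
rewrite mevalZ mmapZ mmapX mevalX hornerM hornerC; congr (_ * _).
rewrite horner_prod; apply: eq_bigr => i _; by rewrite horner_exp.
Qed.

Definition lift_at h (r : 'I_d) : mpoly d F :=
  (map_poly (@mpolyC d F) h).[mpolyX F (mnm1 r)].

Lemma meval_lift_at h r s : meval s (lift_at h r) = h.[s r].
Proof.
rewrite /lift_at -horner_map /= mevalXU -map_poly_comp; congr (_.[_]).
by rewrite map_poly_id// => c _ /=; rewrite mevalC.
Qed.

Lemma msym_lift_at h r (sg : {perm 'I_d}) :
  msym sg (lift_at h r) = lift_at h (sg r).
Proof.
rewrite /lift_at -horner_map /= msymX; congr (_.[_]); last first.
  congr mpolyX; apply/mnmP => j; rewrite !mnmE.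
  by congr nat_of_bool; apply/eqP/eqP => [->|<-]; rewrite ?permKV ?permK.
rewrite -map_poly_comp; apply: eq_map_poly => c /=.
by rewrite -[mpolyC d c]mulr1 mul_mpolyC msymZ msym1.
Qed.

(* The trace of h / k over the roots is numerator over denominator, both being
   polynomials in p. *)
Lemma trace_fraction a b h k (c : F) : c != 0 ->
  exists n t : {poly F}, forall p s,
    a + p *: b = c *: \prod_r ('X - (s r)%:P) ->
    t.[p] = \prod_r k.[s r] /\
    n.[p] = \sum_r h.[s r] * \prod_(j | j != r) k.[s j].
Proof.
move=> c0.
have [|n nP] := @symmetric_horner
  (\sum_r lift_at h r * \prod_(j | j != r) lift_at k j) a b c c0.
  apply/issymP => sg; rewrite raddf_sum /= [RHS](reindex_inj (@perm_inj _ sg)).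
  apply: eq_bigr => r _; rewrite rmorphM rmorph_prod /= msym_lift_at.
  congr (_ * _); rewrite [RHS](reindex_inj (@perm_inj _ sg)) /=.
  by apply: eq_big => [j|j _]; rewrite ?(inj_eq perm_inj)// msym_lift_at.
have [|t tP] := @symmetric_horner (\prod_r lift_at k r) a b c c0.
  apply/issymP => sg; rewrite rmorph_prod /= [RHS](reindex_inj (@perm_inj _ sg)).
  by apply: eq_bigr => r _; rewrite msym_lift_at.
exists n, t => p s sP; rewrite (nP _ _ sP) (tP _ _ sP) raddf_sum rmorph_prod /=.
split; first by apply: eq_bigr => r _; rewrite meval_lift_at.
apply: eq_bigr => r _; rewrite rmorphM rmorph_prod /= meval_lift_at.
by congr (_ * _); apply: eq_bigr => j _; rewrite meval_lift_at.
Qed.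

End SymmetricFunctionsOfRoots.

Section ProductsOfLinearFactors.
Context (F : fieldType).

Lemma deriv_prod_XsubC (I : Type) (q : seq I) (Q : pred I) (s : I -> F) x :
  (forall i, Q i -> x != s i) ->
  (\prod_(i <- q | Q i) ('X - (s i)%:P))^`().[x] =
  (\prod_(i <- q | Q i) ('X - (s i)%:P)).[x] * \sum_(i <- q | Q i) (x - s i)^-1.
Proof.
move=> xs; elim: q => [|i q IH]; first by rewrite !big_nil derivC hornerC mulr0.
rewrite !big_cons; case: ifP => // /xs xi; rewrite derivM derivXsubC.
rewrite !(hornerXsubC, hornerD, hornerM) hornerC IH.
by field; rewrite subr_eq0.
Qed.

Lemma deriv2_prod_XsubC (I : Type) (q : seq I) (Q : pred I) (s : I -> F) x :
  (forall i, Q i -> x != s i) ->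
  (\prod_(i <- q | Q i) ('X - (s i)%:P))^`()^`().[x] =
  (\prod_(i <- q | Q i) ('X - (s i)%:P)).[x] *
  ((\sum_(i <- q | Q i) (x - s i)^-1) ^+ 2
   - \sum_(i <- q | Q i) (x - s i)^-1 ^+ 2).
Proof.
move=> xs; elim: q => [|i q IH].
  by rewrite !big_nil derivC deriv0 horner0 hornerC expr0n subrr mulr0.
rewrite !big_cons; case: ifP => // Qi; have xi := xs _ Qi.
rewrite derivM derivXsubC mul1r derivD derivM derivXsubC mul1r.
rewrite !(hornerXsubC, hornerD, hornerM) IH deriv_prod_XsubC//.
by field; rewrite subr_eq0.
Qed.

(** With f = (X - s_r) h, the k-th derivative of f at s_r is k times the (k-1)-th derivative of h
    there, and h is differentiated logarithmically. *)
Lemma horner_derivs_at_root (d : nat) (c : F) (s : 'I_d -> F) (r : 'I_d) :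
  (forall i, i != r -> s r != s i) ->
  let f := c *: \prod_i ('X - (s i)%:P) in
  let v i := (s r - s i)^-1 in
  let f' := c * \prod_(i | i != r) (s r - s i) in
  [/\ f^`().[s r] = f',
      f^`()^`().[s r] = 2 * f' * \sum_(i | i != r) v i
    & f^`()^`()^`().[s r] =
      3 * f' * ((\sum_(i | i != r) v i) ^+ 2 - \sum_(i | i != r) v i ^+ 2)].
Proof.
move=> sr f v f'.
pose h := \prod_(i | i != r) ('X - (s i)%:P).
have fE : f = c *: (('X - (s r)%:P) * h) by rewrite /f (bigD1 r).
have h0 : h.[s r] = \prod_(i | i != r) (s r - s i).
  by rewrite horner_prod; apply: eq_bigr => i _; rewrite hornerXsubC.
have h1 : h^`().[s r] = h.[s r] * \sum_(i | i != r) v i.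
  exact: deriv_prod_XsubC.
have h2 : h^`()^`().[s r] = h.[s r] *
    ((\sum_(i | i != r) v i) ^+ 2 - \sum_(i | i != r) v i ^+ 2).
  exact: deriv2_prod_XsubC.
have d1 : (1 : {poly F})^`() = 0 by rewrite -polyC1 derivC.
rewrite /f' -h0 fE; split.
- rewrite derivZ derivM derivXsubC mul1r.
  by rewrite !(hornerXsubC, hornerZ, hornerD, hornerM) subrr; ring.
- rewrite !(derivXsubC, d1, deriv0, mul0r, add0r, mul1r, derivZ, derivM, derivD).
  rewrite !(hornerXsubC, hornerZ, hornerD, hornerM) subrr h1; ring.
- rewrite !(derivXsubC, d1, deriv0, mul0r, add0r, mul1r, derivZ, derivM, derivD).
  rewrite !(hornerXsubC, hornerZ, hornerD, hornerM) subrr ?horner0 h2; ring.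
Qed.

End ProductsOfLinearFactors.

Section RegularTraces.
Context (F : fieldType) (d : nat) (a b : {poly F}) (c p0 : F).
Hypothesis c0 : c != 0.

Definition splits p (s : 'I_d -> F) :=
  a + p *: b = c *: \prod_r ('X - (s r)%:P).

Lemma splits_root p s r : splits p s -> (a + p *: b).[s r] = 0.
Proof.
by move=> ->; rewrite hornerZ horner_prod (bigD1 r)//= hornerXsubC subrr mul0r mulr0.
Qed.

(* The value at p0 of this rational function of p is then given by the roots at
   p0, counted with multiplicity. *)
Definition regular_at (f : F -> ('I_d -> F) -> F) :=
  exists n t : {poly F}, t.[p0] != 0 /\
    forall p s, splits p s -> t.[p] != 0 -> f p s = n.[p] / t.[p].

Lemma regular_ext f g : (forall p s, f p s = g p s) ->
  regular_at f -> regular_at g.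
Proof.
by move=> fg [n [t [t0 ft]]]; exists n, t; split=> // p s ps tp; rewrite -fg ft.
Qed.

Lemma regular_horner (h : {poly F}) : regular_at (fun p _ => h.[p]).
Proof.
by exists h, 1; rewrite !hornerC oner_neq0; split=> // p s _ _; rewrite hornerC divr1.
Qed.

Lemma regularD f g : regular_at f -> regular_at g ->
  regular_at (fun p s => f p s + g p s).
Proof.
move=> [n [t [t0 ft]]] [m [u [u0 gu]]]; exists (n * u + m * t), (t * u).
rewrite hornerM mulf_neq0//; split=> // p s ps.
rewrite !(hornerM, hornerD) mulf_eq0 negb_or => /andP[tp up].
by rewrite ft// gu//; field; rewrite tp up.
Qed.

Lemma regularM f g : regular_at f -> regular_at g ->
  regular_at (fun p s => f p s * g p s).
Proof.
move=> [n [t [t0 ft]]] [m [u [u0 gu]]]; exists (n * m), (t * u).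
rewrite hornerM mulf_neq0//; split=> // p s ps.
rewrite !(hornerM, hornerD) mulf_eq0 negb_or => /andP[tp up].
by rewrite ft// gu//; field; rewrite tp up.
Qed.

Lemma regular_sum (I : Type) (q : seq I) (f : I -> F -> ('I_d -> F) -> F) :
  (forall i, regular_at (f i)) -> regular_at (fun p s => \sum_(i <- q) f i p s).
Proof.
move=> fr; elim: q => [|i q IH].
  apply: (@regular_ext (fun p _ => (0 : {poly F}).[p])) => [p s|].
    by rewrite big_nil horner0.
  exact: regular_horner.
apply: (regular_ext _ (regularD (fr i) IH)) => p s; by rewrite big_cons.
Qed.

(** The denominator given by [trace_fraction] is the product of the values of k, so only the roots
    at p0 have to avoid the zeros of k. *)
Lemma regular_trace (h k : {poly F}) (s0 : 'I_d -> F) :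
  splits p0 s0 -> (forall r, k.[s0 r] != 0) ->
  regular_at (fun p s => \sum_r h.[s r] / k.[s r]).
Proof.
move=> s0P ks0; have [n [t nt]] := trace_fraction d a b h k c0.
exists n, t; have [-> _] := nt _ _ s0P; split; first exact/prodf_neq0.
move=> p s sP; have [-> ->] := nt _ _ sP => /prodf_neq0 ks.
rewrite mulr_suml; apply: eq_bigr => r _.
have -> : \prod_r k.[s r] = k.[s r] * \prod_(j | j != r) k.[s j].
  by rewrite (bigD1 r).
have := ks r isT; have : \prod_(j | j != r) k.[s j] != 0.
  by apply/prodf_neq0 => j _; exact: ks.
by move=> u0 v0; field; rewrite u0 v0.
Qed.

Lemma regular_const (x : F) : regular_at (fun _ _ => x).
Proof.
apply: (regular_ext _ (regular_horner x%:P)) => p s; exact: hornerC.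
Qed.

Lemma regular_id : regular_at (fun p _ => p).
Proof. apply: (regular_ext _ (regular_horner 'X)) => p s; exact: hornerX. Qed.

Lemma regularN f : regular_at f -> regular_at (fun p s => - f p s).
Proof.
move=> fr; apply: (regular_ext _ (regularM (regular_const (-1)) fr)) => p s.
exact: mulN1r.
Qed.

Lemma regularX f k : regular_at f -> regular_at (fun p s => f p s ^+ k).
Proof.
move=> fr; elim: k => [|k IH]; first exact: regular_const.
by apply: (regular_ext _ (regularM fr IH)) => p s; rewrite exprS.
Qed.

End RegularTraces.

Lemma sum_flatten_nseq (V : nmodType) (T : Type) (I : finType) (nu : I -> nat)
    (sg : I -> T) (f : T -> V) :
  \sum_(x <- flatten [seq nseq (nu i) (sg i) | i <- index_enum I]) f x =
  \sum_i f (sg i) *+ nu i.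
Proof.
by rewrite big_flatten big_map; apply: eq_bigr => i _; rewrite big_nseq iter_addr_0.
Qed.

(** This is one summand of p - p0 times [web_trace], at a root s: e is p - p0, and G, m, w are the
    values of G1, M, W0. Since F0 + e b vanishes at s, e = - G m / B and the derivative of the
    pencil is G w / B, so that all powers of G cancel. Only C / m is still singular on the fiber. *)
Lemma web_trace_term (F : fieldType) (e B B1 B2 B3 F1 F2 F3 G m w k2 k3 M1 N C : F)
    (u v t l1 l : F) : B != 0 -> G != 0 -> m != 0 -> w != 0 ->
  e * B = - (G * m) -> F1 = G * M1 -> w = M1 * B - m * B1 ->
  m * F2 = G * k2 -> m ^+ 2 * F3 = G * k3 -> B ^+ 2 * k3 = m * N + w ^+ 2 * C ->
  F1 + e * B1 != 0 /\
  e * (B / (F1 + e * B1) * (u * v * l1 ^+ 2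
    - t * l1 * l * (F2 + e * B2) / (F1 + e * B1)
    + l ^+ 2 * (F3 + e * B3) / (F1 + e * B1))) =
  - (u * v) * l1 ^+ 2 * (m * B / w)
  + t * l1 * (l * ((B * (k2 * B - m ^+ 2 * B2)) / w ^+ 2))
  - l ^+ 2 * ((N - B * B3 * m ^+ 2) / w ^+ 2) - l ^+ 2 * (C / m).
Proof.
move=> B0 G0 m0 w0 eB F1E wE F2E F3E k3E.
have eE : e = - (G * m) / B by rewrite -eB mulfK.
have psi : F1 + e * B1 = G * w / B by rewrite F1E eE wE; field.
have -> : F2 = G * k2 / m by rewrite -F2E mulrAC mulfV// mul1r.
have -> : F3 = G * k3 / m ^+ 2.
  by rewrite -F3E mulrAC mulfV ?mul1r// expf_neq0.
have -> : k3 = (m * N + w ^+ 2 * C) / B ^+ 2.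
  by rewrite -k3E mulrAC mulfV ?mul1r// expf_neq0.
rewrite psi; split; first by rewrite !mulf_neq0// invr_eq0.
rewrite eE; field.
by rewrite B0 G0 m0 w0.
Qed.

Lemma deriv_prod (F : fieldType) (I : finType) (g : I -> {poly F}) :
  (\prod_i g i)^`() = \sum_i (g i)^`() * \prod_(k | k != i) g k.
Proof.
have: uniq (index_enum I) by exact: index_enum_uniq.
elim: (index_enum I) => [_|j q IH /= /andP[jq uq]].
  by rewrite !big_nil -polyC1 derivC.
rewrite !big_cons derivM IH// eqxx; congr (_ * _ + _).
  rewrite big_seq [RHS]big_seq_cond; apply: eq_bigl => i.
  by case: eqVneq => [->|]; rewrite ?(negbTE jq) ?andbF ?andbT.
rewrite mulr_sumr big_seq [RHS]big_seq; apply: eq_bigr => i iq.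
rewrite big_cons; have -> : j != i by apply: contraNneq jq => ->.
ring.
Qed.

Section CofactorSums.
Context (F : fieldType) (n : nat) (sg : 'I_n -> F).
Hypothesis sg_inj : injective sg.

Definition cofactor (k : 'I_n) : {poly F} := \prod_(j | j != k) ('X - (sg j)%:P).

Lemma prod_cofactor k :
  \prod_j ('X - (sg j)%:P) = ('X - (sg k)%:P) * cofactor k.
Proof. by rewrite (bigD1 k). Qed.

Lemma cofactor_neq0 i : (cofactor i).[sg i] != 0.
Proof.
rewrite horner_prod; apply/prodf_neq0 => j ji; rewrite hornerXsubC subr_eq0.
by apply: contra_neq ji => /sg_inj.
Qed.

Lemma horner_cofactor i k : k != i -> (cofactor k).[sg i] = 0.
Proof.
move=> ki; rewrite /cofactor (bigD1 i) 1?eq_sym//=.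
by rewrite hornerM hornerXsubC subrr mul0r.
Qed.

(** Differentiate (X - sg k) cofactor k = (X - sg i) cofactor i at sg i. *)
Lemma horner_deriv_cofactor i k : k != i ->
  (cofactor k)^`().[sg i] = (cofactor i).[sg i] / (sg i - sg k).
Proof.
move=> ki; have ik : sg i - sg k != 0.
  by rewrite subr_eq0; apply: contra_neq ki => /sg_inj.
have := congr1 (fun f => f^`().[sg i])
  (etrans (esym (prod_cofactor k)) (prod_cofactor i)).
rewrite !derivM !derivXsubC !mul1r !hornerD !hornerM !hornerXsubC subrr mul0r addr0.
by rewrite horner_cofactor// add0r => <-; field.
Qed.

Lemma horner_sum_cofactor (e : 'I_n -> F) i :
  (\sum_k e k *: cofactor k).[sg i] = e i * (cofactor i).[sg i].
Proof.
rewrite horner_sum (bigD1 i)//= big1 ?addr0 ?hornerZ// => k ki.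
by rewrite hornerZ horner_cofactor// mulr0.
Qed.

Lemma horner_deriv_sum_cofactor (e : 'I_n -> F) i :
  (\sum_k e k *: cofactor k)^`().[sg i] =
  e i * (cofactor i)^`().[sg i]
  + (cofactor i).[sg i] * \sum_(k | k != i) e k / (sg i - sg k).
Proof.
rewrite raddf_sum horner_sum (bigD1 i)//= derivZ hornerZ; congr (_ + _).
rewrite mulr_sumr; apply: eq_bigr => k ki.
by rewrite derivZ hornerZ horner_deriv_cofactor//; ring.
Qed.

End CofactorSums.

(** G carries the repeated roots of f. From f = G M and f' = G M1 follows G' M = G M2, so each
    further derivative costs one factor M and no derivative of G remains. *)
Lemma mul_higher_derivs (F : fieldType) (f G M M1 M2 K2 K3 : {poly F}) :
  f = G * M -> f^`() = G * M1 ->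
  M2 = M1 - M^`() -> K2 = M2 * M1 + M * M1^`() ->
  K3 = (M2 - M^`()) * K2 + M * K2^`() ->
  M * f^`()^`() = G * K2 /\ M ^+ 2 * f^`()^`()^`() = G * K3.
Proof.
move=> fE dfE M2E K2E K3E.
have dG : G^`() * M = G * M2.
  have := dfE; rewrite fE derivM M2E mulrBr => <-; ring.
have E2 : M * f^`()^`() = G * K2.
  rewrite dfE derivM mulrDr K2E mulrDr.
  have -> : M * (G^`() * M1) = G^`() * M * M1 by ring.
  rewrite dG; ring.
split=> //; have := congr1 (fun f => M * f^`()) E2; rewrite /= !derivM !mulrDr.
have -> : M * (M^`() * f^`()^`()) = M^`() * (M * f^`()^`()) by ring.
have -> : M * (G^`() * K2) = G^`() * M * K2 by ring.
rewrite E2 dG => h; rewrite expr2 -mulrA.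
have -> : M * (M * f^`()^`()^`()) =
  G * M2 * K2 + M * (G * K2^`()) - M^`() * (G * K2) by rewrite -h; ring.
rewrite K3E; ring.
Qed.

(** * Local expansions at a point of the fiber *)

Section PolarValues.
Context (F : fieldType) (b M M1 M2 K2 K3 W0 : {poly F}) (x nu m m' pi : F).
Hypotheses (W0E : W0 = M1 * b - M * b^`()) (M2E : M2 = M1 - M^`()).
Hypotheses (K2E : K2 = M2 * M1 + M * M1^`())
  (K3E : K3 = (M2 - M^`()) * K2 + M * K2^`()).
Hypotheses (M_0 : M.[x] = 0) (M_1 : M^`().[x] = m) (M_2 : M^`()^`().[x] = 2 * m').
Hypotheses (M1_0 : M1.[x] = nu * m) (M1_1 : M1^`().[x] = nu * m' + m * pi).

(** Near a point of multiplicity nu, F0 behaves like (X - x)^nu; the products of nu, nu - 1, nu - 2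
    are those of its successive derivatives. *)
Lemma polar_values :
  [/\ W0.[x] = nu * m * b.[x],
      K2.[x] = nu * (nu - 1) * m ^+ 2
    & K3.[x] = nu * (nu - 1) * (nu - 2) * m ^+ 3].
Proof using W0E M2E K2E K3E M_0 M_1 M1_0.
have K2_0 : K2.[x] = nu * (nu - 1) * m ^+ 2.
  by rewrite K2E M2E !(hornerD, hornerN, hornerM) M_0 M_1 M1_0; ring.
split=> //.
  by rewrite W0E !(hornerD, hornerN, hornerM) M_0 M1_0; ring.
by rewrite K3E !(hornerD, hornerN, hornerM) K2_0 M2E hornerD hornerN M_0 M_1 M1_0; ring.
Qed.

(** M vanishes at x with derivative m, so the derivative at x of the identity defining N is m N(x)
    plus known terms. The quotient is what remains of b^2 K3 / (M W0^2) at x once the simple poles C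
    / M are subtracted; [ka] is the value at x of the subtracted poles located at the other
    points. *)
Lemma polar_constant_term (N C : {poly F}) (cc ka : F) :
  b ^+ 2 * K3 = M * N + W0 ^+ 2 * C ->
  C.[x] = cc * m -> C^`().[x] = cc * m' + m * ka ->
  nu != 0 -> m != 0 -> b.[x] != 0 -> cc = (nu - 1) * (nu - 2) / nu ->
  N.[x] / W0.[x] ^+ 2 =
  (nu - 1) / nu * ((2 * nu - 1) * pi
    - 2 * (nu - 2) * ((nu + 1) * pi - b^`().[x] / b.[x]) / nu) - ka.
Proof.
move=> NE C_0 C_1 nu0 m0 b0 ccE; have [W0_0 K2_0 K3_0] := polar_values.
have W0_1 : W0^`().[x] = (nu * m' + m * pi) * b.[x] + (nu - 1) * m * b^`().[x].
  by rewrite W0E derivB !derivM !(hornerD, hornerN, hornerM) M_0 M_1 M1_0 M1_1; ring.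
have M2_0 : M2.[x] = (nu - 1) * m.
  by rewrite M2E hornerD hornerN M_1 M1_0; ring.
have M2_1 : M2^`().[x] = (nu - 2) * m' + m * pi.
  by rewrite M2E derivB hornerD hornerN M_2 M1_1; ring.
have K2_1 : K2^`().[x] = nu * m * ((nu - 2) * m' + m * pi) + nu * m * (nu * m' + m * pi).
  rewrite K2E derivD !derivM !(hornerD, hornerM) M_0 M_1 M1_0 M1_1 M2_0 M2_1; ring.
have K3_1 : K3^`().[x] = ((nu - 4) * m' + m * pi) * (nu * (nu - 1) * m ^+ 2)
    + ((nu - 1) * m) * K2^`().[x].
  rewrite K3E derivD !derivM derivB !(hornerD, hornerN, hornerM).
  by rewrite M_0 M_1 M_2 M2_0 M2_1 K2_0; ring.
have := congr1 (fun f => f^`().[x]) NE.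
rewrite /= derivD !expr2 !derivM !(hornerD, hornerM) M_0 M_1.
rewrite W0_0 W0_1 C_0 C_1 K3_0 K3_1 K2_1 => h.
have {h} -> : N.[x] = (b.[x] ^+ 2 * K3^`().[x] + 2 * b.[x] * b^`().[x] * K3.[x]
   - 2 * (nu * m * b.[x]) * W0^`().[x] * (cc * m)
   - (nu * m * b.[x]) ^+ 2 * (cc * m' + m * ka)) / m.
  apply: (mulfI m0); rewrite mulrCA mulfV// mulr1.
  move/eqP: h; rewrite -subr_eq0 W0_1 K3_0 K3_1 K2_1 => /eqP h.
  by apply/esym/eqP; rewrite -subr_eq0; apply/eqP; rewrite -[in RHS]h; ring.
rewrite W0_1 K3_0 K3_1 K2_1 ccE; field.
by rewrite b0 m0 nu0.
Qed.

End PolarValues.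

(** * The polar part of the trace at p0 *)

Section PolarPart.
Context (F : numFieldType) (d n : nat) (a b : {poly F}) (c p0 : F).
Context (sg : 'I_n -> F) (nu : 'I_n -> nat).
Context (x0 x1 y0 y1 : F).
Hypotheses (c0 : c != 0) (sg_inj : injective sg) (nu_gt0 : forall i, (0 < nu i)%N).
Hypothesis fiber : a + p0 *: b = c *: \prod_i ('X - (sg i)%:P) ^+ nu i.
Hypothesis sum_nu : (\sum_i nu i)%N = d.
Hypothesis coprime_ab : forall x, b.[x] = 0 -> a.[x] != 0.

Let l1 p := p * x1 - y1.
Let l p s := p * (x0 + x1 * s) - (y0 + y1 * s).
Let Psi p := a + p *: b.

(** This is 6 beta, by [sum_eta_coef]; the derivatives of the pencil encode the symmetric sums of
    the inverses of s_r - s_i. *)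
Definition web_trace p (s : 'I_d -> F) := \sum_r b.[s r] / (Psi p)^`().[s r] *
  (3 * (d%:R - 1) * (d%:R - 2) * l1 p ^+ 2
   - 3 * (d%:R - 2) * l1 p * l p (s r) * (Psi p)^`()^`().[s r] / (Psi p)^`().[s r]
   + l p (s r) ^+ 2 * (Psi p)^`()^`()^`().[s r] / (Psi p)^`().[s r]).

(** [be] and [pi] are the logarithmic derivatives at sg i of b and of F0 / (X - sg i)^nu_i. *)
Let be i := b^`().[sg i] / b.[sg i].
Let pi i := \sum_(k | k != i) (nu k)%:R / (sg i - sg k).

(** The opposite of the residue of [web_trace] at p0, in the affine parameters of the fiber;
    [target_sum] identifies it with the sum over the points [a_i : b_i]. *)
Definition web_residue := \sum_i (1 - (nu i)%:R^-1) * l p0 (sg i) *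
  (l p0 (sg i) * (2 * ((nu i)%:R + 1) * pi i + ((nu i)%:R - 2) * be i)
   - (nu i)%:R * l1 p0 * (3 * d%:R - 2 * (nu i)%:R - 2)).

Let F0 := a + p0 *: b.
(** M is the squarefree part of F0, and G1 = F0 / M divides F0' as well, with quotient M1. *)
Let M : {poly F} := \prod_j ('X - (sg j)%:P).
Let G1 := c *: \prod_i ('X - (sg i)%:P) ^+ (nu i).-1.
Let M1 := \sum_k (nu k)%:R *: cofactor sg k.

Let F0E : F0 = G1 * M.
Proof.
rewrite /F0 fiber -scalerAl -big_split /=; congr (_ *: _).
by apply: eq_bigr => i _; rewrite -exprSr prednK.
Qed.

Let dF0E : F0^`() = G1 * M1.
Proof.
rewrite /F0 fiber derivZ deriv_prod -scalerAl mulr_sumr; congr (_ *: _).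
apply: eq_bigr => i _; rewrite deriv_exp derivXsubC mul1r.
rewrite [\prod_i0 _](bigD1 i)//= -scaler_nat -!scalerAl -scalerAr; congr (_ *: _).
rewrite -mulrA; congr (_ * _); rewrite /cofactor -big_split /=.
by apply: eq_bigr => k _; rewrite -exprSr prednK.
Qed.

Let M2 := M1 - M^`().
Let K2 := M2 * M1 + M * M1^`().
Let K3 := (M2 - M^`()) * K2 + M * K2^`().
(** G1 W0 is the Wronskian F0' b - F0 b', so the zeros of W0 are the critical points of a / b, as a
    map to the projective line, outside the fiber. *)
Let W0 := M1 * b - M * b^`().

Let MF2 : M * F0^`()^`() = G1 * K2.
Proof. by case: (mul_higher_derivs F0E dF0E (erefl M2) (erefl K2) (erefl K3)). Qed.

Let MMF3 : M ^+ 2 * F0^`()^`()^`() = G1 * K3.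
Proof. by case: (mul_higher_derivs F0E dF0E (erefl M2) (erefl K2) (erefl K3)). Qed.

Let be_neq0 i : b.[sg i] != 0.
Proof.
apply/eqP => bi; have := coprime_ab bi; have := congr1 (horner^~ (sg i)) F0E.
rewrite hornerD hornerZ bi mulr0 addr0 => -> /negP; apply; apply/eqP.
by rewrite hornerM /M (prod_cofactor sg i) [X in _ * X]hornerM hornerXsubC
  subrr mul0r mulr0.
Qed.

Let m i := (cofactor sg i).[sg i].
Let m' i := (cofactor sg i)^`().[sg i].

Let M_0 i : M.[sg i] = 0.
Proof. by rewrite /M (prod_cofactor sg i) hornerM hornerXsubC subrr mul0r. Qed.

Let M_1 i : M^`().[sg i] = m i.
Proof.
rewrite /M (prod_cofactor sg i) derivM derivXsubC mul1r.
by rewrite hornerD hornerM hornerXsubC subrr mul0r addr0.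
Qed.

Let M_2 i : M^`()^`().[sg i] = 2 * m' i.
Proof.
rewrite /M (prod_cofactor sg i) derivM derivXsubC mul1r derivD derivM derivXsubC mul1r.
rewrite !(hornerXsubC, hornerD, hornerM) subrr mul0r /m'; ring.
Qed.

Let M1_0 i : M1.[sg i] = (nu i)%:R * m i.
Proof. exact: horner_sum_cofactor. Qed.

Let M1_1 i : M1^`().[sg i] = (nu i)%:R * m' i + m i * pi i.
Proof. exact: horner_deriv_sum_cofactor. Qed.

Let nuR i : (nu i)%:R != 0 :> F.
Proof. by rewrite pnatr_eq0 -lt0n. Qed.

Let W0_0 i : W0.[sg i] = (nu i)%:R * m i * b.[sg i].
Proof.
by have [-> _ _] := polar_values (erefl W0) (erefl M2) (erefl K2) (erefl K3) (M_0 i)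
  (M_1 i) (M1_0 i).
Qed.

Let W0_neq0 i : W0.[sg i] != 0.
Proof. by rewrite W0_0 !mulf_neq0// cofactor_neq0. Qed.

(* The only poles at the points of the fiber are simple: in the notation of
   the proof, b^2 F0 F0''' / W^2 = N3 / W0^2 + sum_k cc k / ('X - sg k). *)
Let cc i := ((nu i)%:R - 1) * ((nu i)%:R - 2) / (nu i)%:R : F.
Let C := \sum_k cc k *: cofactor sg k.

Let K2_0 i : K2.[sg i] = (nu i)%:R * ((nu i)%:R - 1) * m i ^+ 2.
Proof.
by have [_ -> _] := polar_values (erefl W0) (erefl M2) (erefl K2) (erefl K3) (M_0 i)
  (M_1 i) (M1_0 i).
Qed.

Let K3_0 i : K3.[sg i] = (nu i)%:R * ((nu i)%:R - 1) * ((nu i)%:R - 2) * m i ^+ 3.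
Proof.
by have [_ _ ->] := polar_values (erefl W0) (erefl M2) (erefl K2) (erefl K3) (M_0 i)
  (M_1 i) (M1_0 i).
Qed.

(** [cc] is the weight for which b^2 K3 and W0^2 C agree at every sg i; as M has only simple roots,
    it divides their difference. *)
Let N3_exists : exists N3, b ^+ 2 * K3 = M * N3 + W0 ^+ 2 * C.
Proof.
suff /dvdpP[N3 N3E] : M %| b ^+ 2 * K3 - W0 ^+ 2 * C.
  by exists N3; rewrite [M * N3]mulrC -N3E; ring.
rewrite /M -(big_map sg xpredT (fun x => 'X - x%:P)); apply: uniq_roots_dvdp.
  apply/allP => x /mapP[i _ ->]; rewrite rootE hornerD hornerN (hornerM _ K3) (hornerM _ C) !horner_exp.
  rewrite K3_0 W0_0 [C.[_]]horner_sum_cofactor -/(m i) /cc.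
  by apply/eqP; field.
by rewrite uniq_rootsE map_inj_uniq// index_enum_uniq.
Qed.

Let ka i := \sum_(k | k != i) cc k / (sg i - sg k).

Let N3_value N3 i : b ^+ 2 * K3 = M * N3 + W0 ^+ 2 * C ->
  N3.[sg i] / W0.[sg i] ^+ 2 =
  ((nu i)%:R - 1) / (nu i)%:R * ((2 * (nu i)%:R - 1) * pi i
  - 2 * ((nu i)%:R - 2) * (((nu i)%:R + 1) * pi i - be i) / (nu i)%:R) - ka i.
Proof.
move=> N3E.
rewrite (polar_constant_term (erefl W0) (erefl M2) (erefl K2) (erefl K3)
  (M_0 i) (M_1 i) (M_2 i) (M1_0 i) (M1_1 i) N3E
  (horner_sum_cofactor sg cc i) (horner_deriv_sum_cofactor sg_inj cc i)
  (nuR i) (cofactor_neq0 sg_inj i) (be_neq0 i)) //.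
Qed.

Section WithConstantTerm.
Variable N3 : {poly F}.
Hypothesis N3E : b ^+ 2 * K3 = M * N3 + W0 ^+ 2 * C.

Let X2 := b * (K2 * b - M ^+ 2 * b^`()^`()).
Let X3 := N3 - b * b^`()^`()^`() * M ^+ 2.

(** This is p - p0 times [web_trace], with denominators that do not vanish on the fiber. In the last
    sum the trace of 1 / (s - sg k) has been replaced by - be k, its value according to
    [trace_simple_pole]. *)
Let phi p (s : 'I_d -> F) :=
  - (3 * (d%:R - 1) * (d%:R - 2)) * l1 p ^+ 2 * (\sum_r (M * b).[s r] / W0.[s r])
  + 3 * (d%:R - 2) * l1 p * (\sum_r l p (s r) * (X2.[s r] / (W0 ^+ 2).[s r]))
  - (\sum_r l p (s r) ^+ 2 * (X3.[s r] / (W0 ^+ 2).[s r]))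
  - \sum_k cc k * (l p (sg k) ^+ 2 * (- be k) + 2 * l p (sg k) * l1 p * d%:R
      + l1 p ^+ 2 * (\sum_r (s r - sg k))).

Let s0_ex : exists2 s0 : 'I_d -> F, splits a b c p0 s0 &
  forall f : F -> F, \sum_r f (s0 r) = \sum_i (nu i)%:R * f (sg i).
Proof.
pose q := flatten [seq nseq (nu i) (sg i) | i <- index_enum 'I_n].
have sq : size q = d.
  rewrite -sum_nu size_flatten /shape -map_comp sumnE big_map.
  by apply: eq_bigr => i _ /=; rewrite size_nseq.
have E (V : Type) (idx : V) (op : Monoid.law idx) (f : F -> V) :
    \big[op/idx]_(r < d) f q`_r = \big[op/idx]_(x <- q) f x.
  by rewrite (big_nth 0) sq big_mkord.
exists (fun r => q`_r).
  rewrite /splits fiber (E _ _ _ (fun x => 'X - x%:P)) /q big_flatten big_map.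
  by congr (_ *: _); apply: eq_bigr => i _; rewrite big_nseq iter_mulr_1.
move=> f; rewrite (E _ _ _ f) /q sum_flatten_nseq; apply: eq_bigr => i _.
by rewrite mulr_natl.
Qed.

Let splits_fiber (s0 : 'I_d -> F) : splits a b c p0 s0 ->
  forall r, exists i, s0 r = sg i.
Proof.
move=> s0P r.
have /eqP := splits_root r s0P; rewrite fiber hornerZ mulf_eq0 (negbTE c0)/=.
rewrite horner_prod prodf_seq_eq0 => /hasP[i _ /andP[_]].
by rewrite horner_exp expf_eq0 hornerXsubC subr_eq0 => /andP[_ /eqP ->]; exists i.
Qed.

Let phi_regular : regular_at a b c p0 phi.
Proof.
have [s0 s0P s0S] := s0_ex.
have s0sg := splits_fiber s0P.
have tr h k : (forall i, k.[sg i] != 0) ->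
    regular_at a b c p0 (fun p s => \sum_(r < d) h.[s r] / k.[s r]).
  move=> k0; apply: (@regular_trace _ _ _ _ _ _ c0 h k s0 s0P) => r; have [i ->] := s0sg r; exact: k0.
have l1R : regular_at a b c p0 (fun p (_ : 'I_d -> F) => l1 p).
  apply: regularD; last exact: regular_const.
  by apply: regularM; [exact: regular_id | exact: regular_const].
pose u p := p * x0 - y0.
have uR : regular_at a b c p0 (fun p (_ : 'I_d -> F) => u p).
  apply: regularD; last exact: regular_const.
  by apply: regularM; [exact: regular_id | exact: regular_const].
(* Splitting l as u + l1 s takes p out of the traces, whose numerators must be fixed polynomials in
   s. *)
have lE p s : l p s = u p + l1 p * s by rewrite /l /u /l1; ring.
have W2 i : (W0 ^+ 2).[sg i] != 0 by rewrite horner_exp expf_neq0// W0_neq0.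
have lk k : regular_at a b c p0 (fun p (_ : 'I_d -> F) => l p (sg k)).
  apply: regular_ext (fun p s => esym (lE p (sg k))) _.
  by apply: regularD => //; apply: regularM => //; exact: regular_const.
rewrite /phi; repeat apply: regularD.
- apply: regularM; last exact: tr.
  by apply: regularM; [exact: regular_const | exact: regularX].
- apply: regularM.
    by apply: regularM => //; exact: regular_const.
  apply: (@regular_ext _ _ _ _ _ _ (fun p s => u p * (\sum_r X2.[s r] / (W0 ^+ 2).[s r])
     + l1 p * (\sum_r ('X * X2).[s r] / (W0 ^+ 2).[s r]))).
    move=> p s; rewrite !mulr_sumr -big_split /=; apply: eq_bigr => r _.
    by rewrite lE (hornerM 'X X2) hornerX; ring.
  by apply: regularD; apply: regularM => //; exact: tr.
- apply: regularN.
  apply: (@regular_ext _ _ _ _ _ _ (fun p s =>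
     u p ^+ 2 * (\sum_r X3.[s r] / (W0 ^+ 2).[s r])
     + (u p * (l1 p + l1 p) * (\sum_r ('X * X3).[s r] / (W0 ^+ 2).[s r])
     + l1 p ^+ 2 * (\sum_r ('X * ('X * X3)).[s r] / (W0 ^+ 2).[s r])))).
    move=> p s; rewrite !mulr_sumr -!big_split /=; apply: eq_bigr => r _.
    by rewrite lE (hornerM 'X ('X * X3)) (hornerM 'X X3) hornerX; ring.
  apply: regularD; first by apply: regularM; [exact: regularX | exact: tr].
  apply: regularD; apply: regularM; try exact: tr; last exact: regularX.
  by apply: regularM => //; exact: regularD.
- apply: regularN; apply: regular_sum => k; apply: regularM; first exact: regular_const.
  apply: regularD; first apply: regularD.
  + by apply: regularM; [exact: regularX | exact: regular_const].
  + apply: regularM; last exact: regular_const.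
    by apply: regularM => //; apply: regularM => //; exact: regular_const.
  + apply: regularM; first exact: regularX.
    apply: (@regular_ext _ _ _ _ _ _ (fun p s =>
      \sum_r ('X - (sg k)%:P).[s r] / (1 : {poly F}).[s r])).
      by move=> p s; apply: eq_bigr => r _; rewrite hornerXsubC hornerC divr1.
    by apply: tr => i; rewrite hornerC oner_neq0.
Qed.

Let lineE p s k : s != sg k ->
  l p s ^+ 2 / (s - sg k) = l p (sg k) ^+ 2 / (s - sg k)
    + (2 * l p (sg k) * l1 p + l1 p ^+ 2 * (s - sg k)).
Proof. by rewrite -subr_eq0 => sk; rewrite /l /l1; field. Qed.

(** At a point with nu k > 1 both F0 and F0' vanish, so a + p b has there the value and the
    derivative of (p - p0) b. Its logarithmic derivative, which is the sum of the 1 / (sg k - s_r),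
    is thus that of b and has no pole at p0. *)
Let trace_simple_pole p s k : p != p0 -> splits a b c p s -> (1 < nu k)%N ->
  \sum_(r < d) (s r - sg k)^-1 = - be k.
Proof.
move=> pp0 sP nu1; have PsiE : a + p *: b = F0 + (p - p0) *: b.
  by rewrite /F0 scalerBl -addrA [p0 *: b + _]addrC subrK.
have F00 : F0.[sg k] = 0 by rewrite F0E hornerM M_0 mulr0.
have dF00 : F0^`().[sg k] = 0.
  rewrite dF0E hornerM /G1 hornerZ horner_prod (bigD1 k)//= horner_exp hornerXsubC.
  rewrite subrr expr0n; have -> : ((nu k).-1 == 0)%N = false by case: (nu k) nu1 => [|[]].
  by rewrite !(mul0r, mulr0).
have psi0 : (a + p *: b).[sg k] = (p - p0) * b.[sg k].
  by rewrite PsiE hornerD hornerZ F00 add0r.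
have psi1 : (a + p *: b)^`().[sg k] = (p - p0) * b^`().[sg k].
  by rewrite PsiE derivD derivZ hornerD hornerZ dF00 add0r.
have psi_neq0 : (a + p *: b).[sg k] != 0 by rewrite psi0 mulf_neq0 ?subr_eq0.
have sk r : sg k != s r.
  by apply: contra_neq psi_neq0 => ->; exact: splits_root sP.
have : (a + p *: b)^`().[sg k] = (a + p *: b).[sg k] * \sum_(r < d) (sg k - s r)^-1.
  by rewrite sP derivZ !hornerZ deriv_prod_XsubC// mulrA.
rewrite psi1 psi0 => h.
have -> : \sum_(r < d) (s r - sg k)^-1 = - \sum_(r < d) (sg k - s r)^-1.
  by rewrite -sumrN; apply: eq_bigr => r _; rewrite -opprB invrN.
congr (- _); rewrite /be; have pp : p - p0 != 0 by rewrite subr_eq0.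
apply: (mulfI (be_neq0 k)); rewrite [RHS]mulrCA mulfV// mulr1.
by apply: (mulfI pp); rewrite h; ring.
Qed.

Let phiE p (s : 'I_d -> F) : p != p0 -> splits a b c p s ->
  (forall r, W0.[s r] != 0) ->
  (forall r, (a + p *: b)^`().[s r] != 0) /\ (p - p0) * web_trace p s = phi p s.
Proof.
move=> pp0 sP W0s; have pp : p - p0 != 0 by rewrite subr_eq0.
have PsiE : a + p *: b = F0 + (p - p0) *: b.
  by rewrite /F0 scalerBl -addrA [p0 *: b + _]addrC subrK.
have bs r : b.[s r] != 0.
  apply/eqP => b0; have := splits_root r sP.
  by rewrite hornerD hornerZ b0 mulr0 addr0; apply/eqP/coprime_ab.
have eB r : (p - p0) * b.[s r] = - (G1.[s r] * M.[s r]).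
  have := splits_root r sP; rewrite PsiE hornerD hornerZ F0E (hornerM G1 M).
  by move/eqP; rewrite addrC addr_eq0 => /eqP.
have GM r : G1.[s r] * M.[s r] != 0 by rewrite -oppr_eq0 -eB mulf_neq0.
have Gs r : G1.[s r] != 0 by have := GM r; rewrite mulf_eq0 negb_or => /andP[].
have Ms r : M.[s r] != 0 by have := GM r; rewrite mulf_eq0 negb_or => /andP[].
have ssg r k : s r != sg k by apply: contra_neq (Ms r) => ->.
have F1E r : F0^`().[s r] = G1.[s r] * M1.[s r] by rewrite dF0E hornerM.
have wE r : W0.[s r] = M1.[s r] * b.[s r] - M.[s r] * b^`().[s r].
  by rewrite /W0 hornerD hornerN !hornerM.
have F2E r : M.[s r] * F0^`()^`().[s r] = G1.[s r] * K2.[s r].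
  by rewrite -(hornerM M) MF2 (hornerM G1).
have F3E r : M.[s r] ^+ 2 * F0^`()^`()^`().[s r] = G1.[s r] * K3.[s r].
  by rewrite -horner_exp -(hornerM (M ^+ 2)) MMF3 (hornerM G1).
have k3E r : b.[s r] ^+ 2 * K3.[s r] = M.[s r] * N3.[s r] + W0.[s r] ^+ 2 * C.[s r].
  by rewrite -!horner_exp -(hornerM _ K3) N3E hornerD (hornerM M) (hornerM _ C).
have term r := web_trace_term (b^`()^`().[s r]) (b^`()^`()^`().[s r])
  (3 * (d%:R - 1)) (d%:R - 2) (3 * (d%:R - 2)) (l1 p) (l p (s r))
  (bs r) (Gs r) (Ms r) (W0s r) (eB r)
  (F1E r) (wE r) (F2E r) (F3E r) (k3E r).
have d1 r : (a + p *: b)^`().[s r] = F0^`().[s r] + (p - p0) * b^`().[s r].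
  by rewrite PsiE derivD derivZ hornerD hornerZ.
have d2 r : (a + p *: b)^`()^`().[s r] = F0^`()^`().[s r] + (p - p0) * b^`()^`().[s r].
  by rewrite PsiE !(derivD, derivZ) hornerD hornerZ.
have d3 r : (a + p *: b)^`()^`()^`().[s r] =
    F0^`()^`()^`().[s r] + (p - p0) * b^`()^`()^`().[s r].
  by rewrite PsiE !(derivD, derivZ) hornerD hornerZ.
split=> [r|]; first by rewrite d1; case: (term r).
rewrite /web_trace mulr_sumr.
under eq_bigr => r _.
  rewrite /Psi d1 d2 d3; have [_ ->] := term r.
  over.
have CM r : C.[s r] / M.[s r] = \sum_k cc k / (s r - sg k).
  rewrite /C horner_sum mulr_suml; apply: eq_bigr => k _.
  have := Ms r; rewrite /M (prod_cofactor sg k) hornerM hornerXsubC hornerZ.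
  by rewrite mulf_eq0 negb_or => /andP[u v]; field; rewrite u v.
rewrite !(sumrB, big_split)/= -!mulr_sumr /phi.
congr (_ + _ - _ - _).
- by congr (_ * _); apply: eq_bigr => r _; rewrite (hornerM M).
- congr (_ * _); apply: eq_bigr => r _.
  rewrite horner_exp /X2 (hornerM b) (hornerD (K2 * b)) (hornerM K2) hornerN.
  by rewrite (hornerM (M ^+ 2)) horner_exp.
- apply: eq_bigr => r _.
  by rewrite horner_exp /X3 (hornerD N3) hornerN (hornerM _ (M ^+ 2)) (hornerM b) horner_exp.
under eq_bigr => r _ do rewrite CM mulr_sumr.
rewrite exchange_big /=; apply: eq_bigr => k _.
under eq_bigr => r _ do rewrite mulrCA lineE//.
rewrite -mulr_sumr [in LHS]big_split /= [X in _ * (_ + X) = _]big_split /= -!mulr_sumr.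
rewrite sumr_const card_ord -[_ *+ d]mulr_natr addrA.
(* At unramified points the weight cc k is 0; [trace_simple_pole] covers the others. *)
have [nu1|] := ltnP 1 (nu k); first by rewrite (trace_simple_pole pp0 sP nu1); ring.
move=> nu1; suff -> : cc k = 0 by rewrite !mul0r.
rewrite /cc; have -> : nu k = 1%N by apply/eqP; rewrite eqn_leq nu1 nu_gt0.
by rewrite subrr !mul0r.
Qed.

Let phi_value s0 : splits a b c p0 s0 ->
  (forall f : F -> F, \sum_r f (s0 r) = \sum_i (nu i)%:R * f (sg i)) ->
  phi p0 s0 = - web_residue.
Proof.
move=> s0P s0S; rewrite /phi (s0S (fun s => (M * b).[s] / W0.[s])).
rewrite [in X in X + _]big1 ?mulr0 ?add0r => [|i _]; last first.
  by rewrite (hornerM M) M_0 !mul0r mulr0.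
rewrite (s0S (fun s => l p0 s * (X2.[s] / (W0 ^+ 2).[s]))).
rewrite (s0S (fun s => l p0 s ^+ 2 * (X3.[s] / (W0 ^+ 2).[s]))).
have X2v i : X2.[sg i] / (W0 ^+ 2).[sg i] = ((nu i)%:R - 1) / (nu i)%:R.
  rewrite horner_exp /X2 (hornerM b) (hornerD (K2 * b)) (hornerM K2) hornerN.
  rewrite (hornerM (M ^+ 2)) horner_exp M_0 K2_0 W0_0.
  have := cofactor_neq0 sg_inj i; rewrite -/(m i) => mi.
  by field; rewrite nuR be_neq0 mi.
have X3v i : X3.[sg i] / (W0 ^+ 2).[sg i] = N3.[sg i] / W0.[sg i] ^+ 2.
  by rewrite horner_exp /X3 (hornerD N3) hornerN (hornerM _ (M ^+ 2)) horner_exp M_0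
    expr0n mulr0 subr0.
under eq_bigr => i _ do rewrite X2v.
under [X in _ - X - _]eq_bigr => i _ do rewrite X3v N3_value// /ka.
(* The quotient of l(sg i)^2 - l(sg k)^2 by sg i - sg k is 2 l(sg k) l1 + l1^2 (sg i - sg k), and d
   is the sum of the nu i. *)
under [X in _ - X]eq_bigr => k _.
  have -> : l p0 (sg k) ^+ 2 * - be k + 2 * l p0 (sg k) * l1 p0 * d%:R +
      l1 p0 ^+ 2 * (\sum_r (s0 r - sg k)) =
     - (l p0 (sg k) ^+ 2 * be k) + (nu k)%:R * (2 * l p0 (sg k) * l1 p0)
     + \sum_(i | i != k) (nu i)%:R * (l p0 (sg i) ^+ 2 - l p0 (sg k) ^+ 2) / (sg i - sg k).
    rewrite mulrN -!addrA; congr (_ + _).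
    rewrite (s0S (fun s => s - sg k)) -sum_nu natr_sum mulr_sumr mulr_sumr -big_split /=.
    rewrite (bigD1 k)//=; congr (_ + _); first by rewrite subrr; ring.
    apply: eq_bigr => i ik; have : sg i - sg k != 0.
      by rewrite subr_eq0; apply: contra_neq ik => /sg_inj.
    by rewrite /l /l1 => u; field.
  over.
(* The pairs i != k coming from [ka] and from the traces share the denominators sg i - sg k. Once
   the sums are exchanged, only cc k l(sg k)^2 survives next to nu i in the numerators, which
   rebuilds pi k. *)
have ex : \sum_i (nu i)%:R * (l p0 (sg i) ^+ 2 * \sum_(k | k != i) cc k / (sg i - sg k))
  - \sum_k cc k * (\sum_(i | i != k) (nu i)%:R * (l p0 (sg i) ^+ 2 - l p0 (sg k) ^+ 2)
      / (sg i - sg k)) = - \sum_k cc k * l p0 (sg k) ^+ 2 * pi k.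
  under eq_bigr => i _ do rewrite !mulr_sumr.
  rewrite (exchange_big_dep xpredT)//= -sumrB -sumrN; apply: eq_bigr => k _.
  rewrite (eq_bigl (fun i => i != k)) => [|i]; last by rewrite eq_sym.
  rewrite /pi !mulr_sumr -!sumrN -big_split /=; apply: eq_bigr => i ik.
  have u : sg i - sg k != 0 by rewrite subr_eq0; apply: contra_neq ik => /sg_inj.
  have v : sg k - sg i != 0 by rewrite -opprB oppr_eq0.
  by rewrite -[sg k - sg i]opprB invrN; field.
rewrite /web_residue.
rewrite [X in _ - X - _](eq_bigr _ (fun i _ => congr1 _ (mulrBr _ _ _))).
rewrite [X in _ - X - _](eq_bigr _ (fun i _ => mulrBr _ _ _)) sumrB.
rewrite [X in _ - X](eq_bigr _ (fun i _ => mulrDr _ _ _)) big_split /=.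
have alg (A B K D S E : F) : K - S = E -> A - (B - K) - (D + S) = A - B - D + E.
  by move=> <-; ring.
rewrite (alg _ _ _ _ _ _ ex).
rewrite mulr_sumr -!sumrN -!big_split /=; apply: eq_bigr => i _.
by rewrite /cc; field; exact: nuR.
Qed.

Lemma polar_part_exists : exists N D : {poly F},
  [/\ D.[p0] != 0, N.[p0] / D.[p0] = - web_residue &
    forall p (s : 'I_d -> F), p != p0 -> splits a b c p s -> D.[p] != 0 ->
      injective s /\ (p - p0) * web_trace p s = N.[p] / D.[p]].
Proof.
have [n' [t [tp0 phiP]]] := phi_regular; have [s0 s0P s0S] := s0_ex.
(* w(p) is the product of the values of W0 at the roots. As a factor of the denominator D, it
   provides the hypothesis of [phiE] wherever D does not vanish. *)
have [n1 [w wP]] := trace_fraction d a b 0 W0 c0.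
have ww (s : 'I_d -> F) p : splits a b c p s -> w.[p] = \prod_r W0.[s r] by move=> h; have [-> _] := wP _ _ h.
have wp0 : w.[p0] != 0.
  rewrite (ww s0)//; apply/prodf_neq0 => r _.
  by have [i ->] := splits_fiber s0P r.
exists (n' * w), (t * w); rewrite !hornerM; split; first exact: mulf_neq0.
  rewrite -mulf_div mulfV// mulr1 -(phiP p0 s0)//; exact: phi_value.
move=> p s pp0 sP; rewrite !hornerM mulf_eq0 negb_or => /andP[tp wp].
have W0s r : W0.[s r] != 0.
  by move: wp; rewrite (ww s p)// => /prodf_neq0; apply.
have [dpsi ->] := phiE pp0 sP W0s; split; last first.
  by rewrite -mulf_div mulfV// mulr1 phiP.
(* A repeated root would be a zero of the derivative. *)
move=> r k srk; apply/eqP; apply: contraT => rk.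
have := dpsi r; rewrite sP derivZ hornerZ deriv_prod horner_sum big1 ?mulr0 ?eqxx// => i _.
rewrite hornerM horner_prod.
have [ir|ir] := eqVneq i r.
  by rewrite (bigD1 k) ?ir ?[k == r]eq_sym//= hornerXsubC srk subrr mul0r mulr0.
by rewrite (bigD1 r) 1?eq_sym//= hornerXsubC subrr mul0r mulr0.
Qed.

End WithConstantTerm.

Theorem web_trace_polar_part : exists N D : {poly F},
  [/\ D.[p0] != 0, N.[p0] / D.[p0] = - web_residue &
    forall p (s : 'I_d -> F), p != p0 -> splits a b c p s -> D.[p] != 0 ->
      injective s /\ (p - p0) * web_trace p s = N.[p] / D.[p]].
Proof. by have [N3 /polar_part_exists] := N3_exists. Qed.

End PolarPart.

(** * From triples of leaves to a trace over the roots *)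

Section Triples.
Context (F : fieldType) (d : nat) (g : 'I_d -> 'I_d -> 'I_d -> F).

Let all3 (P : 'I_d -> 'I_d -> 'I_d -> bool) :=
  \sum_(r < d) \sum_(s < d) \sum_(t < d) (P r s t)%:R * g r s t.

Let natb (P : bool) (x : F) : (P)%:R * x = if P then x else 0.
Proof. by case: P; rewrite ?mul1r ?mul0r. Qed.

(** An increasing triple contributes its three cyclic orderings on the left; the symmetry in the
    last two arguments supplies the other three, whence the factor 2. *)
Lemma sum_triples : (forall r s t, g r s t = g r t s) ->
  2 * \sum_(r < d) \sum_(s < d | (r < s)%N) \sum_(t < d | (s < t)%N)
        (g r s t + g s t r + g t r s) =
  \sum_r \sum_(s | s != r) \sum_(t | (t != r) && (t != s)) g r s t.
Proof.
move=> gC.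
have E (h : 'I_d -> 'I_d -> 'I_d -> F) :
    \sum_(r < d) \sum_(s < d | (r < s)%N) \sum_(t < d | (s < t)%N) h r s t =
    \sum_(r < d) \sum_(s < d) \sum_(t < d) ((r < s) && (s < t))%N%:R * h r s t.
  apply: eq_bigr => r _; rewrite big_mkcond; apply: eq_bigr => s _.
  case: ifP => /= _; last by rewrite big1// => t _; rewrite mul0r.
  by rewrite big_mkcond; apply: eq_bigr => t _; rewrite natb.
have -> : \sum_r \sum_(s | s != r) \sum_(t | (t != r) && (t != s)) g r s t =
    all3 (fun r s t : 'I_d => [&& s != r, t != r & t != s]).
  apply: eq_bigr => r _; rewrite big_mkcond; apply: eq_bigr => s _.
  case: ifP => /= _; last by rewrite big1// => t _; rewrite mul0r.
  by rewrite big_mkcond; apply: eq_bigr => t _; rewrite natb.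
rewrite E; set L := \sum_r _.
have -> : L = all3 (fun r s t : 'I_d => (r < s) && (s < t))%N
    + all3 (fun r s t : 'I_d => (t < r) && (r < s))%N
    + all3 (fun r s t : 'I_d => (s < t) && (t < r))%N.
  have -> : all3 (fun r s t : 'I_d => (t < r) && (r < s))%N =
     \sum_(r < d) \sum_(s < d) \sum_(t < d) ((r < s) && (s < t))%N%:R * g s t r.
    rewrite /all3; under eq_bigr do rewrite exchange_big; exact: exchange_big.
  have -> : all3 (fun r s t : 'I_d => (s < t) && (t < r))%N =
     \sum_(r < d) \sum_(s < d) \sum_(t < d) ((r < s) && (s < t))%N%:R * g t r s.
    rewrite /all3 exchange_big; apply: eq_bigr => r _; exact: exchange_big.
  rewrite -!big_split /=; apply: eq_bigr => r _.
  rewrite -!big_split /=; apply: eq_bigr => s _.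
  by rewrite -!big_split /=; apply: eq_bigr => t _; ring.
have swap (P : 'I_d -> 'I_d -> 'I_d -> bool) : all3 P = all3 (fun r s t => P r t s).
  apply: eq_bigr => r _; rewrite exchange_big; apply: eq_bigr => s _.
  by apply: eq_bigr => t _; rewrite gC.
set P1 := fun r s t : 'I_d => (r < s < t)%N; set P2 := fun r s t : 'I_d => (t < r < s)%N.
set P3 := fun r s t : 'I_d => (s < t < r)%N.
have -> : 2 * (all3 P1 + all3 P2 + all3 P3) = all3 P1 + all3 P2 + all3 P3 +
    (all3 (fun r s t => P1 r t s) + all3 (fun r s t => P2 r t s) + all3 (fun r s t => P3 r t s)).
  by rewrite -(swap P1) -(swap P2) -(swap P3); ring.
rewrite /P1 /P2 /P3 -!big_split /=; apply: eq_bigr => r _.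
rewrite -!big_split /=; apply: eq_bigr => s _.
rewrite -!big_split /=; apply: eq_bigr => t _.
rewrite -!mulrDl; congr (_ * _); rewrite -!natrD; congr (_%:R).
rewrite -!val_eqE /=.
(* The six indicators add up to the indicator of pairwise distinct indices. *)
by case: (ltngtP r s); case: (ltngtP r t); case: (ltngtP s t) => //=; lia.
Qed.

End Triples.

(* The coefficient of dq / q in eta_rst, up to closed forms; s, v and l are the
   roots, their derivatives in p, and the values of p x - y at the roots. *)
Definition eta_coef (F : fieldType) (sr ss st vr vs vt lr ls lt : F) : F :=
  - (vr * ls * lt / ((sr - ss) * (sr - st)) + vs * lt * lr / ((ss - st) * (ss - sr))
     + vt * lr * ls / ((st - sr) * (st - ss))).

(** [eta_coef] is minus the sum of the cyclic images of g, so the triples become, for each r,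
    ordered pairs (i, k). There g is v_r u_i u_k with u_i = l(s_i) / (s_r - s_i), and a sum over i
    != k is the square of a sum minus a sum of squares. Of the 6, a factor 2 comes from
    [sum_triples] and the 3 is the one in the third derivative at a root. *)
Lemma sum_eta_coef (F : numFieldType) (d : nat) (a b : {poly F}) (c : F)
    (x0 x1 y0 y1 p : F) (s : 'I_d -> F) : c != 0 -> splits a b c p s -> injective s ->
  let v r := - b.[s r] / (a + p *: b)^`().[s r] in
  let l s := p * (x0 + x1 * s) - (y0 + y1 * s) in
  6 * \sum_(r < d) \sum_(i < d | (r < i)%N) \sum_(k < d | (i < k)%N)
    eta_coef (s r) (s i) (s k) (v r) (v i) (v k) (l (s r)) (l (s i)) (l (s k))
  = web_trace a b x0 x1 y0 y1 p s.
Proof.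
move=> c0 sP sinj v l.
pose g r i k := v r * l (s i) * l (s k) / ((s r - s i) * (s r - s k)).
have gC r i k : g r i k = g r k i.
  by rewrite /g [(s r - s i) * _]mulrC; congr (_ / _); ring.
have -> : 6 * (\sum_(r < d) \sum_(i < d | (r < i)%N) \sum_(k < d | (i < k)%N)
    eta_coef (s r) (s i) (s k) (v r) (v i) (v k) (l (s r)) (l (s i)) (l (s k))) =
  - (3 * \sum_r \sum_(i | i != r) \sum_(k | (k != r) && (k != i)) g r i k).
  rewrite -(sum_triples gC) mulrA -mulrN; congr (_ * _); first by ring.
  rewrite -sumrN; apply: eq_bigr => r _; rewrite -sumrN; apply: eq_bigr => i _.
  by rewrite -sumrN; apply: eq_bigr => k _.
rewrite /web_trace mulr_sumr -sumrN; apply: eq_bigr => r _.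
have sr i : i != r -> s r != s i by apply: contra_neq => /sinj.
have [] := horner_derivs_at_root c sr; rewrite -sP.
set f' := _ * \prod_(i | _) _ => f1 f2 f3.
have f'0 : f' != 0.
  rewrite mulf_neq0//; apply/prodf_neq0 => i ir; rewrite subr_eq0; exact: sr.
pose V1 := \sum_(i < d | i != r) (s r - s i)^-1.
pose V2 := \sum_(i < d | i != r) (s r - s i)^-1 ^+ 2.
rewrite f1 f2 f3 -/V1 -/V2.
pose l1 := p * x1 - y1; pose u i := l (s i) / (s r - s i).
have uE i : i != r -> u i = - l1 + l (s r) / (s r - s i).
  move=> /sr; rewrite -subr_eq0 => h; rewrite /u /l1 /l; field; exact: h.
have dpos : (0 < d)%N by exact: leq_ltn_trans (ltn_ord r).
have card1 (x : F) : \sum_(i < d | i != r) x = (d%:R - 1) * x.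
  by rewrite sumr_const cardC1 card_ord -subn1 mulrnBr// mulrBl mul1r mulr_natl.
have U1 : \sum_(i | i != r) u i = - (d%:R - 1) * l1 + l (s r) * V1.
  rewrite (eq_bigr _ uE) big_split /= card1 -mulr_sumr /V1; ring.
have U2 : \sum_(i | i != r) u i ^+ 2 =
    (d%:R - 1) * l1 ^+ 2 - 2 * l1 * l (s r) * V1 + l (s r) ^+ 2 * V2.
  rewrite (eq_bigr (fun i => l1 ^+ 2 + ((- 2 * l1 * l (s r)) * (s r - s i)^-1
    + l (s r) ^+ 2 * (s r - s i)^-1 ^+ 2))); last by move=> i /uE ->; ring.
  by rewrite !big_split /= card1 -!mulr_sumr /V1 /V2; ring.
have -> : \sum_(i | i != r) \sum_(k | (k != r) && (k != i)) g r i k =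
    v r * ((\sum_(i | i != r) u i) ^+ 2 - \sum_(i | i != r) u i ^+ 2).
  rewrite expr2 mulr_suml -sumrB mulr_sumr; apply: eq_bigr => i ir.
  rewrite [in RHS](bigD1 i)//= expr2 -mulrBr [u i + _ - u i]addrAC subrr add0r mulr_sumr mulr_sumr.
  apply: eq_bigr => k /andP[kr ki]; rewrite /g /u.
  have sr' j : j != r -> s r - s j != 0 by rewrite subr_eq0; exact: sr.
  move: (sr' _ ir) (sr' _ kr).
  move: (v r) (l (s i)) (l (s k)) (s r - s i) (s r - s k) => X1 X2 X3 X4 X5 h1 h2.
  by field; rewrite h1 h2.
rewrite U1 U2 /v f1 -/l1 -/(l (s r)).
move: (d%:R : F) l1 (l (s r)) V1 V2 b.[s r] f'0 {U1 U2 uE card1} => X1 X2 X3 X4 X5 X6 f'0.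
by field.
Qed.

(** * Differential calculus in two complex variables *)

Section Gradients.
Context (R : realType).
Notation C := R[i].
Implicit Types (f g : C2 R -> C^o) (z : C2 R).

Definition has_grad f z (u v : C) :=
  differentiable f z /\ forall h : C2 R, 'd f z h = u * h.1 + v * h.2 :> C.

Lemma has_grad_continuous f z u v : has_grad f z u v -> {for z, continuous f}.
Proof. by case=> /differentiable_continuous. Qed.

Lemma has_grad_derive f z u v : has_grad f z u v ->
  'D_((1, 0) : C2 R) f z = u /\ 'D_((0, 1) : C2 R) f z = v.
Proof.
by move=> [df E]; rewrite !deriveE// !E /= !(mulr1, mulr0, addr0, add0r).
Qed.

Lemma differentiable_has_grad f z : differentiable f z ->
  has_grad f z ('D_((1, 0) : C2 R) f z) ('D_((0, 1) : C2 R) f z).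
Proof.
move=> df; split=> // h; rewrite !deriveE//.
have -> : h = h.1 *: ((1, 0) : C2 R) + h.2 *: ((0, 1) : C2 R).
  case: h => h1 h2 /=; congr pair => /=; rewrite /GRing.scale /=.
    by rewrite mulr1 mulr0 addr0.
  by rewrite mulr1 mulr0 add0r.
rewrite linearD !linearZ /= /GRing.scale /=.
by rewrite !(mulr1, mulr0, addr0, add0r) mulrC [X in _ + X]mulrC.
Qed.

Lemma has_grad_cst (c : C) z : has_grad (fun=> c) z 0 0.
Proof.
split; first exact: differentiable_cst.
by move=> h; rewrite diff_cst /= !mul0r addr0.
Qed.

Let lin (u v : C) (h : C2 R) : C^o := u * h.1 + v * h.2.

Let lin_linear u v : linear (lin u v).
Proof.
move=> k x y; rewrite /lin /= /GRing.scale /=; ring.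
Qed.

Let cont_lin u v : continuous (lin u v).
Proof.
move=> x; apply: cvgD; apply: cvgM; first exact: cvg_cst.
- exact: cvg_fst.
- exact: cvg_cst.
- exact: cvg_snd.
Qed.

(** In the form of estimates, differentiability can be translated, swapped and restricted to real
    segments without handling linear maps. *)
Lemma has_gradP f z u v : has_grad f z u v <->
  forall e : C, 0 < e -> \forall h \near (0 : C2 R),
    `|f (h + z) - f z - (u * h.1 + v * h.2)| <= e * `|h|.
Proof.
split.
  move=> [df E] e e0; have /eqaddoP/(_ e e0) := diff_locally df.
  by apply: filterS => h; rewrite -[(_ - _) h]/(f (h + z) - (f z + 'd f z h)) E opprD addrA.
move=> fP.
pose L : {linear C2 R -> C^o} :=
  HB.pack (lin u v) (GRing.isLinear.Build _ _ _ _ _ (lin_linear u v)).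
have fL : f \o shift z = cst (f z) + L +o_ (0 : C2 R) id.
  apply/eqaddoP => e e0; have := fP e e0; apply: filterS => h.
  by rewrite -[(_ - _) h]/(f (h + z) - (f z + (u * h.1 + v * h.2))) [in X in _ -> X]opprD addrA.
have dL : 'd f z = L :> (C2 R -> C^o).
  by apply: diff_unique => //; exact: cont_lin.
split; last by move=> h; rewrite dL.
by apply/diff_locallyP; rewrite dL; split=> //; exact: cont_lin.
Qed.

Lemma has_grad_fst z : has_grad (fun x => x.1) z 1 0.
Proof.
apply/has_gradP => e e0; near=> h.
by rewrite /= addrK mul1r mul0r addr0 subrr normr0 mulr_ge0// ltW.
Unshelve. all: by end_near. Qed.

Lemma has_grad_snd z : has_grad (fun x => x.2) z 0 1.
Proof.
apply/has_gradP => e e0; near=> h.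
by rewrite /= addrK mul1r mul0r add0r subrr normr0 mulr_ge0// ltW.
Unshelve. all: by end_near. Qed.

Lemma has_grad_near f g z u v : (\forall x \near z, f x = g x) ->
  has_grad f z u v -> has_grad g z u v.
Proof.
move=> fg /has_gradP fP; apply/has_gradP => e e0.
have fgz : f z = g z by exact: (nbhs_singleton fg).
have {}fg : \forall h \near (0 : C2 R), f (h + z) = g (h + z).
  have : (shift z) @ (0 : C2 R) --> (z : C2 R).
    by rewrite -[X in _ --> X](add0r z); apply: cvgD; [exact: cvg_id|exact: cvg_cst].
  by move/(_ _ fg).
have := fP e e0; apply: filterS2 fg => h <-; by rewrite fgz.
Qed.

Lemma has_grad_ext f g z u v : (forall x, f x = g x) ->
  has_grad f z u v -> has_grad g z u v.
Proof. by move=> fg; have -> : g = f by apply/funext => x; rewrite fg. Qed.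

Lemma has_gradD f g z u v u' v' : has_grad f z u v -> has_grad g z u' v' ->
  has_grad (fun x => f x + g x) z (u + u') (v + v').
Proof.
move=> [df fE] [dg gE]; split; first exact: differentiableD.
move=> h.
apply: (etrans (congr1 (fun L : C2 R -> C^o => L h) (diffD df dg))).
by apply: (etrans (congr2 (fun a b : C => a + b) (fE h) (gE h))); ring.
Qed.

Lemma has_gradN f z u v : has_grad f z u v ->
  has_grad (fun x => - f x) z (- u) (- v).
Proof.
move=> [df fE]; split; first exact: differentiableN.
move=> h.
apply: (etrans (congr1 (fun L : C2 R -> C^o => L h) (diffN df))).
by apply: (etrans (congr1 (fun a : C => - a) (fE h))); ring.
Qed.

Lemma has_gradM f g z u v u' v' : has_grad f z u v -> has_grad g z u' v' ->
  has_grad (fun x => f x * g x) z (u * g z + f z * u') (v * g z + f z * v').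
Proof.
move=> [df fE] [dg gE]; split; first exact: differentiableM.
move=> h.
apply: (etrans (congr1 (fun L : C2 R -> C^o => L h) (diffM df dg))).
apply: (etrans (congr2 (fun a b : C => f z * b + g z * a) (fE h) (gE h))).
by ring.
Qed.

Lemma has_gradV f z u v : has_grad f z u v -> f z != 0 ->
  has_grad (fun x => (f x)^-1) z (- u / f z ^+ 2) (- v / f z ^+ 2).
Proof.
move=> [df fE] fz; split; first exact: differentiableV.
move=> h.
apply: (etrans (congr1 (fun L : C2 R -> C^o => L h) (diffV df fz))).
apply: (etrans (congr1 (fun a : C => - (f z) ^- 2 * a) (fE h))).
by ring.
Qed.

Lemma has_grad_eq f z u v u' v' : has_grad f z u v -> u = u' -> v = v' ->
  has_grad f z u' v'.
Proof. by move=> ? <- <-. Qed.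

Lemma has_grad_sum (I : Type) (r : seq I) (P : pred I) (F : I -> C2 R -> C^o) z
    (u v : I -> C) :
  (forall i, P i -> has_grad (F i) z (u i) (v i)) ->
  has_grad (fun x => \sum_(i <- r | P i) F i x) z
    (\sum_(i <- r | P i) u i) (\sum_(i <- r | P i) v i).
Proof.
move=> FP; elim: r => [|i r IH].
  rewrite !big_nil; by apply: has_grad_ext (has_grad_cst 0 z) => x; rewrite big_nil.
rewrite !big_cons; case: (boolP (P i)) => Pi.
  by apply: has_grad_ext (has_gradD (FP i Pi) IH) => x; rewrite big_cons Pi.
by apply: has_grad_ext IH => x; rewrite big_cons (negbTE Pi).
Qed.

Lemma has_grad_horner (h : {poly C}) f z u v : has_grad f z u v ->
  has_grad (fun x => h.[f x]) z (u * h^`().[f z]) (v * h^`().[f z]).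
Proof.
move=> fP; elim/poly_ind: h => [|h c IH].
  apply: (has_grad_eq (has_grad_ext _ (has_grad_cst 0 z))).
  - by move=> x; rewrite horner0.
  - by rewrite deriv0 horner0 mulr0.
  - by rewrite deriv0 horner0 mulr0.
apply: (has_grad_eq (has_grad_ext _ (has_gradD (has_gradM IH fP) (has_grad_cst c z)))).
- by move=> x; rewrite hornerMXaddC.
- by rewrite derivMXaddC !hornerE; ring.
- by rewrite derivMXaddC !hornerE; ring.
Qed.

End Gradients.

(** * Mean value inequality and symmetry of second derivatives *)

Section MeanValue.
Context (R : realType).
Notation C := R[i].
Local Open Scope complex_scope.
Implicit Types (f g : C2 R -> C^o) (z w x : C2 R).

Lemma norm_real_complex (h : R) : `|h%:C| = `|h|%:C.
Proof. by rewrite normc_def /= expr0n addr0 sqrtr_sqr. Qed.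

(** The mean value theorem is real while the variables are complex: on a real segment, the real part
    of k f is a real function of one real variable. *)
Lemma has_grad_along f x w (s0 : R) (u v k : C) :
  has_grad f (x + s0%:C *: w) u v ->
  is_derive s0 1 (fun s : R => complex.Re (k * f (x + s%:C *: w)))
    (complex.Re (k * (u * w.1 + v * w.2))).
Proof.
move=> /has_gradP fP; set phi := fun s : R => _; set d := complex.Re _.
suff dP : (fun h : R => h^-1 *: (phi (h *: 1 + s0) - phi s0)) @ 0^' --> d.
  by apply: DeriveDef; [apply/cvg_ex; exists d | exact: cvg_lim].
apply/cvgrPdist_le => e e0.
(* The added 1 keeps K positive when k or w is 0. *)
pose K : C := `|k| * `|w| + 1.
have K0 : 0 < K by rewrite ltr_wpDl// mulr_ge0.
have /nbhs_normP[dl /= dl0 dlP] := fP (e%:C / K) (divr_gt0 (etrans (ltcR 0 e) e0) K0).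
have [dr drE] : exists r, dl = r%:C by apply/complex_realP; exact: gtr0_real.
have [nw nwE] : exists r, `|w| = r%:C by apply/complex_realP; exact: normr_real.
have nw0 : 0 <= nw by rewrite -ler0c -nwE.
have dr0 : 0 < dr by move: dl0; rewrite drE ltcR.
near=> h.
have h0 : h != 0 by near: h; exact: nbhs_dnbhs_neq.
have hs : `|h| * (nw + 1) < dr.
  rewrite -ltr_pdivlMr ?ltr_wpDl//; near: h; apply: dnbhs0_lt.
  by rewrite divr_gt0// ltr_wpDl.
have := dlP (h%:C *: w); rewrite /ball_ /= sub0r normrN normrZ norm_real_complex nwE drE.
have -> : `|h|%:C * nw%:C = (`|h| * nw)%:C by rewrite rmorphM.
rewrite ltcR => /(_ _) /wrap[|{}dlP].
  by apply: le_lt_trans hs; rewrite ler_wpM2l// lerDl.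
rewrite -(ler_pM2l (_ : 0 < `|h|)) ?normr_gt0// -normrM -lecR.
have -> : h * (d - h^-1 *: (phi (h *: 1 + s0) - phi s0)) =
   - complex.Re (k * (f (h%:C *: w + (x + s0%:C *: w)) - f (x + s0%:C *: w)
     - (u * (h%:C *: w).1 + v * (h%:C *: w).2))).
  have -> : h%:C *: w + (x + s0%:C *: w) = x + (h *: 1 + s0)%:C *: w.
    by rewrite addrCA -scalerDl /GRing.scale /= mulr1 -rmorphD.
  rewrite /phi /d.
  rewrite [h^-1 *: _]/(h^-1 * _) mulrBr mulVKf//.
  have -> : (h%:C *: w).1 = h%:C * w.1 by [].
  have -> : (h%:C *: w).2 = h%:C * w.2 by [].
  have -> : k * (f (x + (h *: 1 + s0)%:C *: w) - f (x + s0%:C *: w)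
      - (u * (h%:C * w.1) + v * (h%:C * w.2)))
    = k * f (x + (h *: 1 + s0)%:C *: w) - k * f (x + s0%:C *: w)
      - h%:C * (k * (u * w.1 + v * w.2)) by ring.
  rewrite !raddfB /=; set A := k * (_ + _).
  have -> : complex.Re (h%:C * A) = h * complex.Re A.
    by case: A => A1 A2 /=; rewrite mul0r subr0.
  ring.
rewrite normrN; apply: le_trans (normc_ge_Re _) _.
rewrite normrM; apply: le_trans (ler_wpM2l (normr_ge0 _) dlP) _.
rewrite !rmorphM /= -nwE.
have -> : `|k| * (e%:C / K * (`|h|%:C * `|w|)) = `|h|%:C * e%:C * (`|k| * `|w| / K).
  by ring.
apply: ler_piMr; first by rewrite mulr_ge0// ler0c ?normr_ge0// ltW.
by rewrite ler_pdivrMr// mul1r lerDl.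
Unshelve. all: by end_near. Qed.

Lemma mean_value f x w (M : C) :
  (forall s : R, 0 <= s <= 1 -> exists uv : C * C,
    has_grad f (x + s%:C *: w) uv.1 uv.2 /\ `|uv.1 * w.1 + uv.2 * w.2| <= M) ->
  `|f (x + w) - f x| <= M.
Proof.
move=> fP; have M0 : 0 <= M.
  by have [uv [_]] := fP 0 (introT andP (conj (lexx _) ler01)); exact: le_trans.
have [D0|D0] := eqVneq (f (x + w) - f x) 0; first by rewrite D0 normr0.
set D := _ - _ in D0 *.
have /choice[uv uvP] : forall s : R, exists uv : C * C, 0 <= s <= 1 ->
    has_grad f (x + s%:C *: w) uv.1 uv.2 /\ `|uv.1 * w.1 + uv.2 * w.2| <= M.
  move=> s; have [/fP[uv h]|_] := boolP (0 <= s <= 1); first by exists uv.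
  by exists (0, 0).
(* Multiplication by k rotates the increment D onto the positive real axis. *)
pose k : C := D^*%C / `|D|.
have kD : k * D = `|D|.
  by rewrite /k mulrAC [_ * D]mulrC -sqr_normc expr2 mulfK// normr_eq0.
have k1 : `|k| = 1 by rewrite /k normf_div normcJ normr_id divff// normr_eq0.
pose phi (s : R) := complex.Re (k * f (x + s%:C *: w)).
have dphi (s : R) : s \in `[0, 1]%R ->
    is_derive s 1 phi (complex.Re (k * ((uv s).1 * w.1 + (uv s).2 * w.2))).
  by rewrite in_itv /= => /uvP[/has_grad_along h _]; exact: h.
pose psi (s : R) := complex.Re (k * ((uv s).1 * w.1 + (uv s).2 * w.2)).
have d1 (s : R) : s \in `]0, 1[%R -> is_derive s 1 phi (psi s).
  by move=> s01; apply: dphi; exact: subset_itv_oo_cc.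
have c1 : {within `[0, 1], continuous phi}.
  by apply: derivable_within_continuous => s /dphi h; exact: (@ex_derive _ _ _ _ _ _ _ h).
have [c c01] := MVT_segment ler01 d1 c1.
rewrite subr0 mulr1 /phi -raddfB /= -mulrBr.
rewrite (_ : 1%:C *: w = w); last by rewrite scale1r.
rewrite (_ : 0%:C *: w = 0); last by rewrite scale0r.
rewrite addr0 kD => E.
have -> : `|D| = (psi c)%:C by rewrite -E RRe_real// normr_real.
move: c01; rewrite in_itv /= => /uvP[_]; apply: le_trans.
rewrite -[leRHS]mul1r -k1 -normrM; apply: le_trans (normc_ge_Re _).
by rewrite lecR ler_norm.
Qed.

Lemma has_grad_shift f z y u v : has_grad f (z + y) u v ->
  has_grad (fun x => f (x + y)) z u v.
Proof.
move=> /has_gradP fP; apply/has_gradP => e /fP; apply: filterS => h.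
by rewrite addrA.
Qed.

Lemma norm_pair (x : C2 R) (e : C) : `|x.1| < e -> `|x.2| < e -> `|x| < e.
Proof. by move=> x1 x2; rewrite prod_normE num_gt_max x1 x2. Qed.

Lemma norm_pair_le (x : C2 R) (e : C) : `|x.1| <= e -> `|x.2| <= e -> `|x| <= e.
Proof. by move=> x1 x2; rewrite prod_normE num_ge_max x1 x2. Qed.

(** Apply the mean value inequality in the first direction to x |-> f (x + (0, t)) - f x - b t x.1:
    its first partial derivative is an increment of f1 minus b t, which is o(t) because f1 is
    differentiable at z. *)
Lemma second_difference f f1 f2 z (a b : C) :
  (\forall x \near z, has_grad f x (f1 x) (f2 x)) -> has_grad f1 z a b ->
  forall e : C, 0 < e -> \forall t \near (0 : R)^'+,
    `|f (z + (t%:C, t%:C)) - f (z + (t%:C, 0)) - f (z + (0, t%:C)) + f z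
      - b * t%:C ^+ 2| <= e * t%:C ^+ 2.
Proof.
move=> fP /has_gradP f1P e e0.
have e20 : 0 < e / 2 by rewrite divr_gt0.
have /nbhs_normP[d1 /= d10 d1P] := f1P _ e20.
have /nbhs_normP[d2 /= d20 d2P] := fP.
have [r1 r1E] : exists r, d1 = r%:C by apply/complex_realP; exact: gtr0_real.
have [r2 r2E] : exists r, d2 = r%:C by apply/complex_realP; exact: gtr0_real.
have r10 : 0 < r1 by move: d10; rewrite r1E ltcR.
have r20 : 0 < r2 by move: d20; rewrite r2E ltcR.
near=> t.
have t0 : 0 < t by near: t; exact: nbhs_right_gt.
have t1 : t < r1 by near: t; exact: nbhs_right_lt.
have t2 : t < r2 by near: t; exact: nbhs_right_lt.
have normT : `|t%:C| = t%:C :> C by rewrite norm_real_complex gtr0_norm.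
pose w : C2 R := (t%:C, 0); pose y : C2 R := (0, t%:C).
pose g (x : C2 R) : C^o := f (x + y) - f x - b * t%:C * x.1.
have -> : f (z + (t%:C, t%:C)) - f (z + w) - f (z + y) + f z - b * t%:C ^+ 2
    = g (z + w) - g z.
  have -> : z + (t%:C, t%:C) = z + w + y :> C2 R.
    by rewrite -addrA; congr (_ + _); congr pair; rewrite /= ?addr0 ?add0r.
  rewrite /g; have -> : (z + w).1 = z.1 + t%:C by [].
  ring.
apply: mean_value => s /andP[s0 s1].
have bnd (h : C) : `|h| <= t%:C -> `|(s%:C *: w + (0, h) : C2 R)| <= t%:C.
  move=> hle; apply: norm_pair_le => /=; last first.
    by rewrite /GRing.scale /= mulr0 add0r.
  rewrite addr0 /GRing.scale /= normrM norm_real_complex normT ger0_norm//.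
  rewrite -[leRHS]mul1r; apply: ler_wpM2r; first by rewrite ler0c ltW.
  by rewrite -[1]/(1%:C) lecR.
have Ez : z + s%:C *: w = s%:C *: w + (0, 0) + z.
  by rewrite addrC; congr (_ + _); rewrite -[LHS]addr0.
have Ezy : z + s%:C *: w + y = s%:C *: w + y + z by rewrite -addrA addrC.
exists (f1 (z + s%:C *: w + y) - f1 (z + s%:C *: w) - b * t%:C,
        f2 (z + s%:C *: w + y) - f2 (z + s%:C *: w)) => /=; split.
  have gP h : `|h| <= t%:C -> has_grad f (s%:C *: w + (0, h) + z)
      (f1 (s%:C *: w + (0, h) + z)) (f2 (s%:C *: w + (0, h) + z)).
    move=> hle; apply: d2P; rewrite /ball_ /= opprD addrCA subrr addr0 normrN.
    by apply: le_lt_trans (bnd _ hle) _; rewrite r2E ltcR.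
  have P1 := gP 0; rewrite normr0 ler0c -Ez in P1.
  have P2 := gP t%:C; rewrite normT -[(0, t%:C)]/y -Ezy in P2.
  apply: has_grad_eq.
  - apply: has_gradD; first apply: has_gradD.
    + by apply: has_grad_shift; apply: P2.
    + by apply: has_gradN; apply: P1; exact: ltW.
    + apply: has_gradN; apply: has_gradM; first exact: (has_grad_cst (b * t%:C)).
      exact: has_grad_fst.
  - by rewrite /=; ring.
  - by rewrite /=; ring.
rewrite mulr0 addr0.
have B1 := d1P (s%:C *: w + (0, t%:C)); have B0 := d1P (s%:C *: w + (0, 0)).
rewrite /ball_ /= !sub0r !normrN in B1 B0.
have n1 := bnd t%:C; rewrite normT in n1; have {}n1 := n1 (lexx _).
have n0 := bnd 0; rewrite normr0 ler0c in n0; have {}n0 := n0 (ltW t0).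
have T1 : t%:C < d1 by rewrite r1E ltcR.
have {}B1 := B1 (le_lt_trans n1 T1); have {}B0 := B0 (le_lt_trans n0 T1).
rewrite expr2 mulrA normrM normT; apply: ler_wpM2r; first by rewrite ler0c ltW.
rewrite Ezy Ez.
set A1 := f1 _ - _ - _ in B1; set A0 := f1 _ - _ - _ in B0.
have -> : f1 (s%:C *: w + y + z) - f1 (s%:C *: w + (0, 0) + z) - b * t%:C = A1 - A0.
  rewrite /A1 /A0 /y (_ : s%:C *: (0 : C^o) = 0) ?scaler0//.
  set X1 := f1 (_ + (0, t%:C) + z); set X2 := f1 (_ + (0, 0) + z).
  by set X3 := _ *: _; move: X1 X2 X3 (f1 z) => X1 X2 X3 X4; ring.
apply: le_trans (ler_normB _ _) _.
have -> : e * t%:C = e / 2 * t%:C + e / 2 * t%:C by field.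
apply: lerD; first by apply: le_trans B1 _; rewrite ler_wpM2l// ltW.
by apply: le_trans B0 _; rewrite ler_wpM2l// ltW.
Unshelve. all: by end_near. Qed.

Let sw (x : C2 R) : C2 R := (x.2, x.1).

Let norm_sw x : `|sw x| = `|x|.
Proof.
apply/le_anti/andP; split; apply: norm_pair_le; rewrite /sw /= prod_normE;
  by rewrite ?(num_le_max) ?lexx ?orbT.
Qed.

Let has_grad_swap f z u v : has_grad f (sw z) u v ->
  has_grad (fun x => f (sw x)) z v u.
Proof.
move=> /has_gradP fP; apply/has_gradP => e e0.
have /nbhs_normP[d d0 dP] := fP e e0.
apply/nbhs_normP; exists d => //= h; rewrite /ball_ /= sub0r normrN -norm_sw => hd.
have := dP (sw h); rewrite /ball_ /= sub0r normrN => /(_ hd).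
by rewrite norm_sw [v * _ + _]addrC.
Qed.

(* Young's form of the symmetry of second derivatives: the first derivatives
   are only assumed to be differentiable at z. *)
Lemma mixed_derivatives f f1 f2 z (a b c d : C) :
  (\forall x \near z, has_grad f x (f1 x) (f2 x)) ->
  has_grad f1 z a b -> has_grad f2 z c d -> b = c.
Proof.
move=> fP f1P f2P.
have fswP : \forall x \near (sw z), has_grad (fun y => f (sw y)) x (f2 (sw x)) (f1 (sw x)).
  have /nbhs_normP[e e0 eP] := fP.
  apply: (proj2 (nbhs_normP (sw z) _)).
  exists e => [//|x xe].
  apply: has_grad_swap; apply: eP.
  have E : sw (sw z - x) = z - sw x by case: (z) (x) => ? ? [? ?].
  by rewrite /ball_ /mkset -E norm_sw.
have f2sw : has_grad (fun y => f2 (sw y)) (sw z) d c.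
  by apply: has_grad_swap; case: (z) f2P.
apply/eqP; apply: contraT => bc.
(* Two estimates with this tolerance give |b - c| <= |b - c| / 2. *)
have e0 : 0 < `|b - c| / 4 :> C by rewrite divr_gt0// normr_gt0 subr_eq0.
have [t [t0 t1 t2]] : exists t : R, [/\ 0 < t,
    `|f (z + (t%:C, t%:C)) - f (z + (t%:C, 0)) - f (z + (0, t%:C)) + f z
      - b * t%:C ^+ 2| <= `|b - c| / 4 * t%:C ^+ 2 &
    `|f (sw (sw z + (t%:C, t%:C))) - f (sw (sw z + (t%:C, 0)))
      - f (sw (sw z + (0, t%:C))) + f (sw (sw z)) - c * t%:C ^+ 2|
      <= `|b - c| / 4 * t%:C ^+ 2].
  apply: (@filter_ex _ ((0 : R)^'+)).
  near=> t; split.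
  - by near: t; exact: nbhs_right_gt.
  - by near: t; exact: second_difference fP f1P _ e0.
  - by near: t; exact: second_difference fswP f2sw _ e0.
have sws (h k : C) : sw (sw z + (h, k)) = z + (k, h) by case: (z).
move: t2; rewrite !sws (_ : sw (sw z) = z); last by case: (z).
have T0 : 0 < t%:C ^+ 2 by rewrite exprn_gt0// ltcR.
set X := f _ in t1 *; set Y := f _ in t1 *; set W := f _ in t1 *; move=> t2.
have : `|(b - c) * t%:C ^+ 2| <= `|b - c| / 2 * t%:C ^+ 2.
  have -> : (b - c) * t%:C ^+ 2 = (X - W - Y + f z - c * t%:C ^+ 2)
      - (X - Y - W + f z - b * t%:C ^+ 2) by ring.
  apply: le_trans (ler_normB _ _) _.
  have -> : `|b - c| / 2 * t%:C ^+ 2 = `|b - c| / 4 * t%:C ^+ 2 + `|b - c| / 4 * t%:C ^+ 2.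
    by field.
  exact: lerD.
rewrite normrM (gtr0_norm T0) ler_pM2r// ler_pdivlMr// -subr_ge0.
have -> : `|b - c| - `|b - c| * 2 = - `|b - c| by ring.
by rewrite oppr_ge0 normr_le0 subr_eq0 (negbTE bc).
Unshelve. all: by end_near. Qed.

End MeanValue.

(** * Homogeneous foliations and their fibers *)

Section BivariatePolynomials.
Context (C : numFieldType).
Implicit Types (P : mpoly 2 C) (X Y : {poly C}) (d : nat).

Definition mvar (i : 'I_2) : mpoly 2 C := mpolyX C (mnm1 i).

Definition eval2 P (x y : C) : C := meval (tnth [tuple x; y]) P.

Lemma mmap_homog (S : comNzRingType) (f : {rmorphism C -> S}) (k : S) (h : 'I_2 -> S) P d :
  P \is ishomog1 d mdeg ->
  mmap f (fun i => k * h i) P = k ^+ d * mmap f h P.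
Proof.
move=> /dhomogP Pd; rewrite /mmap mulr_sumr [LHS]big_seq [RHS]big_seq.
apply: eq_bigr => m mP; rewrite mulrCA; congr (_ * _).
have -> : d = mdeg m by rewrite -(Pd m mP).
rewrite /mmap1 mdegE -prodrXr -big_split /=.
by apply: eq_bigr => i _; rewrite exprMn.
Qed.

(** Used with D = u y - v x, to divide A and B by the linear form that vanishes at a common zero. *)
Lemma mmap_congr (S : comNzRingType) (f : {rmorphism C -> S}) (D : S) (h h' : 'I_2 -> S) P :
  (forall i, exists u, h i - h' i = D * u) ->
  exists u, mmap f h P - mmap f h' P = D * u.
Proof.
move=> hh'; elim/mpolyind: P => [|c m P _ _ [u uE]].
  by exists 0; rewrite mulr0 [mmap f h 0]raddf0 [mmap f h' 0]raddf0 subr0.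
have [v vE] : exists v, mmap1 h m - mmap1 h' m = D * v.
  rewrite /mmap1; apply: (big_ind2 (fun x y => exists v, x - y = D * v)).
  - by exists 0; rewrite subrr mulr0.
  - move=> x1 y1 x2 y2 [v1 v1E] [v2 v2E]; exists (v1 * x2 + y1 * v2).
    by rewrite mulrDr mulrA -v1E mulrCA -v2E; ring.
  - move=> i _; have [v vE] := hh' i.
    exists (v * \sum_(j < m i) h i ^+ ((m i).-1 - j) * h' i ^+ j).
    by rewrite subrXX vE mulrA.
exists (f c * v + u); rewrite !raddfD /= !mmapZ !mmapX.
by rewrite mulrDr mulrCA -vE -uE; ring.
Qed.

Definition pull X Y P : {poly C} := mmap (@polyC C) (tnth [tuple X; Y]) P.

Lemma eval2_mmap x y P : eval2 P x y = mmap idfun (tnth [tuple x; y]) P.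
Proof. by []. Qed.

Lemma I2_case (Q : 'I_2 -> Prop) : Q ord0 -> Q ord_max -> forall i, Q i.
Proof.
move=> Q0 Q1 [[|[|n]] ni] //.
  by have -> : Ordinal ni = ord0 by apply/val_inj.
by have -> : Ordinal ni = ord_max by apply/val_inj.
Qed.

Lemma horner_pull X Y P s : (pull X Y P).[s] = eval2 P X.[s] Y.[s].
Proof.
rewrite /pull /eval2; elim/mpolyind: P => [|c m P _ _ IH].
  by rewrite !raddf0 horner0.
rewrite !raddfD /= hornerD IH; congr (_ + _).
rewrite mmapZ mevalZ mmapX mevalX hornerM hornerC; congr (_ * _).
rewrite horner_prod; apply: eq_bigr => i _; rewrite horner_exp; congr (_ ^+ _).
by move: i; apply: I2_case.
Qed.

Lemma deriv_pull X Y P : (pull X Y P)^`() =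
  pull X Y (mderiv ord0 P) * X^`() + pull X Y (mderiv ord_max P) * Y^`().
Proof.
have lin2 : lift ord0 ord0 = ord_max :> 'I_2 by apply/val_inj.
rewrite /pull; elim/mpolyind: P => [|c m P _ _ IH].
  by rewrite !mderiv0 !mmap0 deriv0 !mul0r addr0.
rewrite !mderivD !mmapD derivD IH 2!mulrDl addrACA; congr (_ + _).
rewrite !mderivZ !mmapZ !mderivX !mmapZ !mmapX deriv_mulC.
rewrite -!mulrA -mulrDr; congr (_ * _).
rewrite /mmap1 !big_ord_recl !big_ord0 !mulr1 lin2 derivM !deriv_exp !mnmE.
rewrite !rmorph_nat [(ord0 == ord0)]eqxx [(ord_max == ord_max)]eqxx /= !subn0 !subn1.
rewrite -[tnth _ ord0]/X -[tnth _ ord_max]/Y.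
by move: (X ^+ _) (Y ^+ _) (X ^+ _) (Y ^+ _) => *; ring.
Qed.

Lemma eval2_homog P d c x y : P \is ishomog1 d mdeg ->
  eval2 P (c * x) (c * y) = c ^+ d * eval2 P x y.
Proof.
move=> Pd; rewrite !eval2_mmap -mmap_homog//; apply: meval_eq => i.
by move: i; apply: I2_case.
Qed.

Lemma euler P d : P \is ishomog1 d mdeg ->
  mvar ord0 * mderiv ord0 P + mvar ord_max * mderiv ord_max P = d%:R *: P.
Proof.
move=> /dhomogP Pd; rewrite {1 2 3}(mpolyE P) !raddf_sum /= !mulr_sumr -big_split /=.
rewrite [LHS]big_seq [RHS]big_seq; apply: eq_bigr => m mP.
have E i : mvar i * mderiv i (mpolyX C m) = (m i)%:R *: mpolyX C m.
  rewrite mderivX -scalerAr /mvar -mpolyXD.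
  have [->|mi] := eqVneq (m i) 0%N; first by rewrite !scale0r.
  congr (_ *: mpolyX _ _); apply/mnmP => j; rewrite !mnmE.
  by case: eqVneq => [<-|]; [rewrite add1n subn1 prednK// lt0n | rewrite subn0].
rewrite !mderivZ -!scalerAr !E -scalerDr -scalerDl -natrD [LHS]scalerA mulrC -scalerA.
have -> : d = mdeg m by rewrite -(Pd m mP).
congr (_%:R *: _); rewrite mdegE !big_ord_recl big_ord0 addn0.
by congr (_ + m _)%N; apply/val_inj.
Qed.

Lemma poly_eq_on_nonzero (p q : {poly C}) :
  (forall x, x != 0 -> p.[x] = q.[x]) -> p = q.
Proof.
move=> pq; apply/eqP; rewrite -subr_eq0; apply: contraT => r0.
have := max_poly_roots (rs := [seq i.+1%:R | i <- iota 0 (size (p - q))]) r0.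
rewrite size_map size_iota ltnn; apply.
  by apply/allP => _ /mapP[i _ ->]; rewrite rootE hornerD hornerN pq ?subrr//.
by rewrite map_inj_uniq ?iota_uniq// => i j /eqP; rewrite eqr_nat => /eqP[].
Qed.

Lemma poly_eq (p q : {poly C}) : (forall x, p.[x] = q.[x]) -> p = q.
Proof. by move=> pq; apply: poly_eq_on_nonzero => x _. Qed.

Section Dehomogenization.
Variables (x0 x1 y0 y1 : C).

Definition line_poly P := pull (x0%:P + x1 *: 'X) (y0%:P + y1 *: 'X) P.

Lemma horner_line_poly P s : (line_poly P).[s] = eval2 P (x0 + x1 * s) (y0 + y1 * s).
Proof. by rewrite horner_pull !hornerE. Qed.

Lemma size_line_poly P d : P \is ishomog1 d mdeg -> (size (line_poly P) <= d.+1)%N.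
Proof.
move=> /dhomogP Pd; rewrite /line_poly /pull /mmap big_seq.
apply: (leq_trans (size_sum _ _ _)); apply/bigmax_leqP_seq => m mP _.
have -> : d = mdeg m by rewrite -(Pd m mP).
have sz (u v : C) k : (size ((u%:P + v *: 'X) ^+ k) <= k.+1)%N.
  apply: (leq_trans (size_poly_exp_leq _ _)); rewrite ltnS.
  rewrite -[leqRHS]mul1n leq_mul2r; apply/orP; right.
  have : (size (u%:P + v *: 'X)%R <= 2)%N.
    rewrite (leq_trans (size_polyD _ _))// geq_max (leq_trans (size_polyC_leq1 _))//.
    by rewrite (leq_trans (size_scale_leq _ _))// size_polyX.
  by case: (size _) => [|[|[|]]].
rewrite mul_polyC (leq_trans (size_scale_leq _ _))// /mmap1.
rewrite mdegE !big_ord_recl !big_ord0 mulr1 addn0.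
apply: (leq_trans (size_polyMleq _ _)); rewrite -subn1 leq_subLR add1n -addnS -addSn.
by apply: leq_add; exact: sz.
Qed.

(** For u != 0, homogeneity reduces the claim to the value at v / u. Both sides are polynomials in
    u, so it extends to u = 0, the point at infinity of the line. *)
Lemma line_poly_homog P d (u v : C) : P \is ishomog1 d mdeg ->
  \sum_(i < d.+1) (line_poly P)`_i * u ^+ (d - i) * v ^+ i =
  eval2 P (x0 * u + x1 * v) (y0 * u + y1 * v).
Proof.
move=> Pd; have sP := size_line_poly Pd.
pose L : {poly C} := \sum_(i < d.+1) ((line_poly P)`_i * v ^+ i) *: 'X^(d - i).
pose Q := pull (x0 *: 'X + (x1 * v)%:P) (y0 *: 'X + (y1 * v)%:P) P.
have LQ : L = Q.
  apply: poly_eq_on_nonzero => t t0; rewrite horner_pull !hornerE.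
  have -> : x0 * t + x1 * v = t * (x0 + x1 * (v / t)) by field.
  have -> : y0 * t + y1 * v = t * (y0 + y1 * (v / t)) by field.
  rewrite (eval2_homog _ _ _ Pd) -horner_line_poly (horner_coef_wide _ sP) mulr_sumr.
  rewrite horner_sum; apply: eq_bigr => i _; rewrite hornerZ hornerXn.
  rewrite expr_div_n -[in t ^+ d](subnK (ltn_ord i : (i <= d)%N)) exprD.
  have ti : t ^+ i != 0 by rewrite expf_neq0.
  by field.
have := congr1 (horner^~ u) LQ; rewrite /= horner_pull !hornerE => <-.
by rewrite horner_sum; apply: eq_bigr => i _; rewrite hornerZ hornerXn mulrAC.
Qed.

Lemma coef_line_poly P d : P \is ishomog1 d mdeg -> (line_poly P)`_d = eval2 P x1 y1.
Proof.
move=> Pd; have := line_poly_homog 0 1 Pd; rewrite !mulr0 !mulr1 !add0r => <-.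
rewrite big_ord_recr /= subnn expr0 expr1n !mulr1 big1 ?add0r// => i _.
by rewrite expr0n subn_eq0 leqNgt ltn_ord mulr0 mul0r.
Qed.

End Dehomogenization.

End BivariatePolynomials.

Section FoliationAlgebra.
Context (C : numClosedFieldType) (d : nat) (A B : mpoly 2 C).
Hypotheses (hA : A \is ishomog1 d mdeg) (hB : B \is ishomog1 d mdeg).

(* If A and B vanish at (u, v), then u^d A(x, y) = A(u x, u y) is congruent to
   A(u x, v x) = x^d A(u, v) = 0 modulo u y - v x, and similarly for B. *)
Lemma coprime_no_common_zero :
  (forall D : mpoly 2 C, (exists S, A = D * S) -> (exists S, B = D * S) ->
    D \is a GRing.unit) ->
  forall u v, eval2 A u v = 0 -> eval2 B u v = 0 -> u = 0 /\ v = 0.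
Proof.
move=> cop u v Auv Buv; apply: contrapT => uv0.
pose L : mpoly 2 C := u *: mvar C ord_max - v *: mvar C ord0.
pose h i := tnth [tuple u; v] i.
(* k is a nonzero coordinate of (u, v), and j the index of the variable to which it corresponds. *)
have Ldvd_of (P : mpoly 2 C) k j : k != 0 -> P \is ishomog1 d mdeg -> eval2 P u v = 0 ->
    (forall i, exists S, mpolyC 2 k * mvar C i - mvar C j * mpolyC 2 (h i) = L * S) ->
    exists S, P = L * S.
  move=> k0 hP Puv /(mmap_congr (@mpolyC 2 C) P)[S].
  have -> : mmap (@mpolyC 2 C) (fun i => mvar C j * mpolyC 2 (h i)) P = 0.
    rewrite (mmap_homog _ _ _ hP); suff -> : mmap (@mpolyC 2 C) (fun i => mpolyC 2 (h i)) P = 0.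
      by rewrite mulr0.
    rewrite -[RHS](mpolyC0 2 C) -Puv /eval2 /meval /mmap rmorph_sum /=.
    by apply: eq_bigr => m _; rewrite rmorphM /mmap1 rmorph_prod /=; congr (_ * _);
      apply: eq_bigr => i _; rewrite rmorphXn.
  rewrite subr0 (mmap_homog _ _ _ hP).
  have -> : mmap (@mpolyC 2 C) (mvar C) P = P.
    rewrite [RHS]mpolyE /mmap; apply: eq_bigr => m _.
    by rewrite mmap1_id mul_mpolyC.
  move=> E; exists (k ^- d *: S); rewrite -scalerAr -E -rmorphXn /= mul_mpolyC.
  by rewrite scalerA mulVf ?scale1r// expf_neq0.
have Ldvd (P : mpoly 2 C) : P \is ishomog1 d mdeg -> eval2 P u v = 0 ->
    exists S, P = L * S.
  move=> hP Puv; have [u0|u0] := eqVneq u 0.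
    have v0 : v != 0 by apply/eqP => v0; exact: uv0.
    apply: (Ldvd_of P v ord_max) => //; apply: I2_case; rewrite /h /L !mul_mpolyC.
      exists (-1); rewrite /= [mvar C ord_max * _]mulrC mul_mpolyC; ring.
    by exists 0; rewrite [mvar C ord_max * _]mulrC mul_mpolyC mulr0 subrr.
  apply: (Ldvd_of P u ord0) => //; apply: I2_case; rewrite /h /L !mul_mpolyC.
    by exists 0; rewrite [mvar C ord0 * _]mulrC mul_mpolyC mulr0 subrr.
  by exists 1; rewrite [mvar C ord0 * _]mulrC mul_mpolyC mulr1.
have LU := cop L (Ldvd A hA Auv) (Ldvd B hB Buv).
have : eval2 (L * L^-1) u v = 0.
  by rewrite /eval2 mevalM mevalB !mevalZ !mevalXU /tnth /= mulrC [v * u]mulrC subrr mulr0.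
by rewrite divrr// /eval2 meval1 => /eqP; rewrite oner_eq0.
Qed.

Hypothesis no_common_zero :
  forall u v, eval2 A u v = 0 -> eval2 B u v = 0 -> u = 0 /\ v = 0.
Hypothesis d_gt0 : (0 < d)%N.

(** A root s of B(1, s) gives e1 = (1, s). If there is none, B(1, s) is constant, and its
    coefficient of degree d > 0, which is B(0, 1), vanishes. *)
Lemma chart_exists : exists x0 x1 y0 y1 : C, x0 * y1 - x1 * y0 = 1 /\ eval2 B x1 y1 = 0.
Proof.
pose f := line_poly 1 0 0 1 B.
have [f1|/closed_rootP[s]] := eqVneq (size f) 1%N; last first.
  rewrite rootE horner_line_poly !(mul0r, addr0, add0r, mul1r) => /eqP Bs.
  by exists 0, 1, (-1), s; split=> //; ring.
exists 1, 0, 0, 1; split; first by ring.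
by rewrite -(coef_line_poly 1 0 0 1 hB) nth_default// -/f f1.
Qed.

Variables (x0 x1 y0 y1 : C).
Hypotheses (det1 : x0 * y1 - x1 * y0 = 1) (B_inf : eval2 B x1 y1 = 0).

Let a := line_poly x0 x1 y0 y1 A.
Let b := line_poly x0 x1 y0 y1 B.
Let c := eval2 A x1 y1.
Let x s := x0 + x1 * s.
Let y s := y0 + y1 * s.

Lemma lead_coef_neq0 : c != 0.
Proof.
apply/eqP => /no_common_zero/(_ B_inf)[x10 y10].
by move: det1; rewrite x10 y10 mulr0 mul0r subrr => /eqP; rewrite eq_sym oner_eq0.
Qed.

Lemma coords X Y : X = x0 * (X * y1 - Y * x1) + x1 * (x0 * Y - y0 * X) /\
  Y = y0 * (X * y1 - Y * x1) + y1 * (x0 * Y - y0 * X).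
Proof.
split.
  by rewrite -[LHS]mulr1 -det1; ring.
by rewrite -[LHS]mulr1 -det1; ring.
Qed.

Lemma coprime_line_poly s : b.[s] = 0 -> a.[s] != 0.
Proof.
rewrite !horner_line_poly => Bs; apply/eqP => /no_common_zero/(_ Bs)[xs ys].
have : (x0 + x1 * s) * y1 - x1 * (y0 + y1 * s) = 1 by rewrite -det1; ring.
by rewrite xs ys mulr0 mul0r subrr => /eqP; rewrite eq_sym oner_eq0.
Qed.

Lemma size_pencil p : size (a + p *: b) = d.+1 /\ lead_coef (a + p *: b) = c.
Proof.
have cd : (a + p *: b)`_d = c.
  by rewrite coefD coefZ (coef_line_poly _ _ _ _ hA) (coef_line_poly _ _ _ _ hB)
    B_inf mulr0 addr0.
have sz : size (a + p *: b) = d.+1.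
  apply/eqP; rewrite eqn_leq; apply/andP; split; last first.
    by rewrite ltnNge; apply/negP => /leq_sizeP/(_ d (leqnn _)); rewrite cd;
      apply/eqP; exact: lead_coef_neq0.
  rewrite (leq_trans (size_polyD _ _))// geq_max size_line_poly//=.
  by rewrite (leq_trans (size_scale_leq _ _))// size_line_poly.
by rewrite /lead_coef sz.
Qed.

Lemma splits_exists p : exists s : 'I_d -> C, splits a b c p s.
Proof.
have [sz lc] := size_pencil p.
have [r rE] := closed_field_poly_normal (a + p *: b); rewrite lc in rE.
have sr : size r = d.
  by move: sz; rewrite rE size_scale ?lead_coef_neq0// size_prod_XsubC => -[].
exists (fun i => r`_i); rewrite /splits rE; congr (_ *: _).
by rewrite (big_nth 0) big_mkord sr.
Qed.

(** Write (X, Y) = al e0 + ga e1. If al != 0, homogeneity reduces to the value of a + p b at ga /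
    al; if al = 0, both sides are ga^d A(e1), because B(e1) = 0. *)
Lemma form_factor p (s : 'I_d -> C) X Y : splits a b c p s ->
  eval2 A X Y + p * eval2 B X Y = c * \prod_r (Y * x (s r) - X * y (s r)).
Proof.
move=> sP; have [XE YE] := coords X Y.
set al := X * y1 - Y * x1 in XE YE; set ga := x0 * Y - y0 * X in XE YE.
have fE r : Y * x (s r) - X * y (s r) = ga - s r * al by rewrite /x /y /ga /al; ring.
under eq_bigr => r _ do rewrite fE.
have hAB : A + p *: B \is ishomog1 d mdeg by rewrite dhomogD// dhomogZ.
have -> : eval2 A X Y + p * eval2 B X Y = eval2 (A + p *: B) X Y.
  by rewrite /eval2 mevalD mevalZ.
rewrite XE YE; have [al0|al0] := eqVneq al 0.
  rewrite al0 !mulr0 !add0r ![_ * ga]mulrC (eval2_homog _ _ _ hAB).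
  rewrite /eval2 mevalD mevalZ -/(eval2 A x1 y1) -/(eval2 B x1 y1) B_inf mulr0 addr0.
  under eq_bigr => r _ do rewrite mulr0 subr0.
  by rewrite prodr_const card_ord mulrC.
have -> : x0 * al + x1 * ga = al * (x0 + x1 * (ga / al)) by field.
have -> : y0 * al + y1 * ga = al * (y0 + y1 * (ga / al)) by field.
rewrite (eval2_homog _ _ _ hAB) /eval2 mevalD mevalZ.
rewrite -/(eval2 A _ _) -/(eval2 B _ _) -!horner_line_poly -/a -/b.
rewrite -hornerZ -hornerD sP hornerZ horner_prod mulrCA; congr (_ * _).
have -> : al ^+ d = \prod_(r < d) al by rewrite prodr_const card_ord.
rewrite -big_split /=; apply: eq_bigr => r _.
by rewrite hornerXsubC; field.
Qed.

End FoliationAlgebra.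

Lemma deriv_prod_XsubC_exp (F : fieldType) (I : Type) (q : seq I) (Q : pred I)
    (s : I -> F) (m : I -> nat) x : (forall i, Q i -> x != s i) ->
  (\prod_(i <- q | Q i) ('X - (s i)%:P) ^+ m i)^`().[x] =
  (\prod_(i <- q | Q i) ('X - (s i)%:P) ^+ m i).[x]
  * \sum_(i <- q | Q i) (m i)%:R / (x - s i).
Proof.
move=> xs; elim: q => [|i q IH]; first by rewrite !big_nil derivC hornerC mulr0.
rewrite !big_cons; case: ifP => // /xs; rewrite -subr_eq0 => xi.
rewrite derivM deriv_exp derivXsubC mul1r !(hornerD, hornerM) hornerMn IH.
rewrite !horner_exp hornerXsubC -mulr_natl.
case: (m i) => [|k]; first by rewrite !mul0r !add0r !expr0; ring.
by rewrite exprS /=; field.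
Qed.

Lemma prod_count (T : eqType) (V : comPzSemiRingType) (n : nat) (r : seq T) (sg : 'I_n -> T)
    (f : T -> V) : injective sg -> {in r, forall z, exists i, z = sg i} ->
  \prod_(z <- r) f z = \prod_i f (sg i) ^+ count_mem (sg i) r.
Proof.
move=> sginj; elim: r => [|z r IH] rsg.
  by rewrite big_nil big1// => i _; rewrite expr0.
rewrite big_cons IH; last by move=> w wr; apply: rsg; rewrite inE wr orbT.
have [j ->] := rsg z (mem_head _ _).
rewrite (bigD1 j)//= [RHS](bigD1 j)//= eqxx add1n exprS mulrA; congr (_ * _).
apply: eq_bigr => i ij; have -> : (sg j == sg i) = false.
  by apply/negP => /eqP /sginj ji; rewrite ji eqxx in ij.
by [].
Qed.

Section Fiber.
Context (C : numClosedFieldType) (d n : nat) (A B : mpoly 2 C).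
Hypotheses (hA : A \is ishomog1 d mdeg) (hB : B \is ishomog1 d mdeg).
Hypothesis no_common_zero :
  forall u v, eval2 A u v = 0 -> eval2 B u v = 0 -> u = 0 /\ v = 0.
Variables (x0 x1 y0 y1 : C).
Hypotheses (det1 : x0 * y1 - x1 * y0 = 1) (B_inf : eval2 B x1 y1 = 0).
Variables (p0 : C) (av bv : 'I_n -> C).
Hypothesis ab_neq0 : forall i, (av i, bv i) != (0, 0).
Hypothesis ab_fiber : forall i, eval2 A (bv i) (av i) = - p0 * eval2 B (bv i) (av i).
Hypothesis ab_inj : forall i j, av i * bv j = av j * bv i -> i = j.
Hypothesis ab_all : forall a' b', (a', b') != (0, 0) ->
  eval2 A b' a' = - p0 * eval2 B b' a' -> exists i, a' * bv i = av i * b'.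

Let a := line_poly x0 x1 y0 y1 A.
Let b := line_poly x0 x1 y0 y1 B.
Let c := eval2 A x1 y1.
Let al i := bv i * y1 - av i * x1.

Definition fiber_param i := (x0 * av i - y0 * bv i) / al i.
Local Notation sg := fiber_param.

Let B_fiber i : eval2 B (bv i) (av i) != 0.
Proof.
apply/eqP => B0; have A0 := ab_fiber i; rewrite B0 mulr0 in A0.
have [b0 a0] := no_common_zero A0 B0.
by have := ab_neq0 i; rewrite a0 b0 eqxx.
Qed.

(** If al i = 0, then (b_i, a_i) is a multiple of e1 and B vanishes there; over a finite p0 this
    makes it a common zero of A and B. *)
Let al_neq0 i : al i != 0.
Proof.
apply/eqP => al0; have := B_fiber i.
have [xE yE] := coords det1 (bv i) (av i).
rewrite (congr2 (eval2 B) xE yE) -/(al i) al0 !mulr0 !add0r ![_ * (x0 * _ - _)]mulrC.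
by rewrite (eval2_homog _ _ _ hB) B_inf mulr0 eqxx.
Qed.

Let bvE i : bv i = al i * (x0 + x1 * sg i).
Proof.
have [xE _] := coords det1 (bv i) (av i).
by rewrite {1}xE /sg; have := al_neq0 i; rewrite /al => h; field.
Qed.

Let avE i : av i = al i * (y0 + y1 * sg i).
Proof.
have [_ yE] := coords det1 (bv i) (av i).
by rewrite {1}yE /sg; have := al_neq0 i; rewrite /al => h; field.
Qed.

Lemma fiber_param_inj : injective sg.
Proof.
by move=> i j ij; apply: ab_inj; rewrite (avE i) (avE j) (bvE i) (bvE j) ij; ring.
Qed.

Let sg_root i : (a + p0 *: b).[sg i] = 0.
Proof.
have := ab_fiber i; rewrite (bvE i) (avE i) (eval2_homog _ _ _ hA) (eval2_homog _ _ _ hB).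
rewrite [- p0 * _]mulrCA => h; have E := mulfI (expf_neq0 d (al_neq0 i)) h.
by rewrite hornerD hornerZ !horner_line_poly E; ring.
Qed.

Let root_sg s : (a + p0 *: b).[s] = 0 -> exists i, s = sg i.
Proof.
rewrite hornerD hornerZ !horner_line_poly => E.
have [||i iE] := @ab_all (y0 + y1 * s) (x0 + x1 * s).
- apply/eqP => -[ys xs].
  have : (x0 + x1 * s) * y1 - x1 * (y0 + y1 * s) = 1 by rewrite -det1; ring.
  by rewrite xs ys mulr0 mul0r subrr => /eqP; rewrite eq_sym oner_eq0.
- by move/eqP: E; rewrite addr_eq0 => /eqP ->; ring.
exists i; move: iE; rewrite (bvE i) (avE i) => /eqP; rewrite -subr_eq0.
have -> : (y0 + y1 * s) * (al i * (x0 + x1 * sg i)) - al i * (y0 + y1 * sg i) * (x0 + x1 * s)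
   = al i * ((x0 * y1 - x1 * y0) * (s - sg i)) by ring.
by rewrite det1 mul1r mulf_eq0 (negbTE (al_neq0 i)) subr_eq0 => /eqP.
Qed.

(* [XT i] and [YT i] are the coordinates of [P1_chart (av i) (bv i)]. *)
Let XT i : {poly C} := if bv i != 0 then (bv i)%:P else 'X.
Let YT i : {poly C} := if bv i != 0 then (av i)%:P + 'X else (av i)%:P.

Variable nu : 'I_n -> nat.
Hypothesis nuE : forall i, nu i = mup 0
  (pull (XT i) (YT i) (- A) * (eval2 B (bv i) (av i))%:P
   - (eval2 (- A) (bv i) (av i))%:P * pull (XT i) (YT i) B).

(** In the chart at the i-th point, the pullback that defines the index is a nonzero constant times
    the product of the [Lk k ^+ mu k], where [Lk k] is the linear form vanishing at the k-th point.
    [Lk i] is a multiple of the parameter and the others do not vanish at 0, so the order is the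
    multiplicity mu i of sg i as a root. *)
Lemma fiber_factorization : a + p0 *: b = c *: \prod_i ('X - (sg i)%:P) ^+ nu i /\
  (\sum_i nu i)%N = d /\ forall i, (0 < nu i)%N.
Proof.
have c0 := lead_coef_neq0 no_common_zero det1 B_inf.
have [s sP] := splits_exists hA hB no_common_zero det1 B_inf p0.
pose r := [seq s i | i <- index_enum 'I_d].
have rE : a + p0 *: b = c *: \prod_(z <- r) ('X - z%:P) by rewrite sP big_map.
have r_sg : {in r, forall z, exists i, z = sg i}.
  by move=> _ /mapP[k _ ->]; apply: root_sg; exact: splits_root sP.
pose mu i := count_mem (sg i) r.
have prodE (V : comPzSemiRingType) (f : C -> V) :
    \prod_(i < d) f (s i) = \prod_i f (sg i) ^+ mu i.
  by rewrite -(prod_count f fiber_param_inj r_sg) big_map.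
have muE : a + p0 *: b = c *: \prod_i ('X - (sg i)%:P) ^+ mu i.
  by rewrite sP (prodE _ (fun z => 'X - z%:P)).
suff numu i : nu i = mu i.
  split; first by rewrite muE; congr (_ *: _); apply: eq_bigr => i _; rewrite numu.
  split.
    (* The constant function turns the product formula into an equality of two powers of X, which
       counts the roots. *)
    have := prodE _ (fun _ => 'X : {poly C}).
    rewrite prodr_const card_ord prodrXr => /(congr1 (fun f : {poly C} => size f)).
    by rewrite !size_polyXn => -[->]; apply: eq_bigr => i _; exact: numu.
  move=> i; rewrite numu -has_count; apply/hasP; exists (sg i) => /=; last exact: eqxx.
  have /eqP := sg_root i; rewrite rE hornerZ mulf_eq0 (negbTE c0)/=.
  by rewrite -rootE root_prod_XsubC.
pose Lk k := YT i * (x0 + x1 * sg k)%:P - XT i * (y0 + y1 * sg k)%:P.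
have XT0 : (XT i).[0] = bv i.
  by rewrite /XT; case: eqP => [->|_] /=; rewrite ?hornerX ?hornerC.
have YT0 : (YT i).[0] = av i.
  by rewrite /YT; case: eqP => _ /=; rewrite ?hornerD ?hornerX hornerC ?addr0.
have Lk0 k : k != i -> ~~ root (Lk k) 0.
  move=> ki; rewrite rootE hornerD hornerN !hornerM !hornerC XT0 YT0 (bvE i) (avE i).
  have -> : al i * (y0 + y1 * sg i) * (x0 + x1 * sg k) - al i * (x0 + x1 * sg i) * (y0 + y1 * sg k)
     = al i * ((x0 * y1 - x1 * y0) * (sg i - sg k)) by ring.
  rewrite det1 mul1r mulf_neq0// subr_eq0; apply: contra_neq ki.
  by move/fiber_param_inj.
have [ka ka0 LiE] : exists2 ka, ka != 0 & Lk i = ka *: 'X.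
  rewrite /Lk /XT /YT; case: eqP => [b0|/eqP b0] /=.
    have xi : x0 + x1 * sg i = 0.
      by apply/eqP; have /eqP := bvE i; rewrite b0 eq_sym mulf_eq0 (negbTE (al_neq0 i)).
    exists (- (y0 + y1 * sg i)).
      rewrite oppr_eq0; apply/eqP => yi; have := ab_neq0 i.
      by rewrite (bvE i) (avE i) xi yi !mulr0 eqxx.
    by rewrite xi mulr0 sub0r mulrC scaleNr mul_polyC.
  exists (x0 + x1 * sg i).
    by apply: contraNneq b0 => xi; rewrite (bvE i) xi mulr0.
  have -> : ((av i)%:P + 'X) * (x0 + x1 * sg i)%:P - (bv i)%:P * (y0 + y1 * sg i)%:P
     = (av i * (x0 + x1 * sg i) - bv i * (y0 + y1 * sg i))%:P + (x0 + x1 * sg i)%:P * 'X.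
    by rewrite polyCB !polyCM; ring.
  rewrite mul_polyC {1}(bvE i) {1}(avE i).
  have -> : al i * (y0 + y1 * sg i) * (x0 + x1 * sg i)
     - al i * (x0 + x1 * sg i) * (y0 + y1 * sg i) = 0 by ring.
  by rewrite add0r.
rewrite nuE.
have -> : pull (XT i) (YT i) (- A) * (eval2 B (bv i) (av i))%:P
     - (eval2 (- A) (bv i) (av i))%:P * pull (XT i) (YT i) B
   = (- (eval2 B (bv i) (av i) * c * ka ^+ mu i))%:P
     * (('X - 0%:P) ^+ mu i * \prod_(k | k != i) Lk k ^+ mu k).
  apply: poly_eq => t; rewrite hornerD hornerN !hornerM !hornerC !horner_pull.
  have evN X Y : eval2 (- A) X Y = - eval2 A X Y by rewrite /eval2 mevalN.
  rewrite !evN ab_fiber.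
  have -> : - eval2 A (XT i).[t] (YT i).[t] * eval2 B (bv i) (av i)
      - - (- p0 * eval2 B (bv i) (av i)) * eval2 B (XT i).[t] (YT i).[t]
    = - eval2 B (bv i) (av i) * (eval2 A (XT i).[t] (YT i).[t]
        + p0 * eval2 B (XT i).[t] (YT i).[t]) by ring.
  rewrite (form_factor hA hB det1 B_inf _ _ sP).
  rewrite (prodE _ (fun z => (YT i).[t] * (x0 + x1 * z) - (XT i).[t] * (y0 + y1 * z))).
  have -> : \prod_k ((YT i).[t] * (x0 + x1 * sg k) - (XT i).[t] * (y0 + y1 * sg k)) ^+ mu k
      = \prod_k (Lk k).[t] ^+ mu k.
    apply: eq_bigr => k _.
    by rewrite /Lk hornerD hornerN !(hornerM (XT i)) !(hornerM (YT i)) !hornerC.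
  rewrite (bigD1 i)//= LiE hornerZ hornerX exprMn horner_exp hornerXsubC subr0 horner_prod.
  rewrite -/c.
  have -> : \prod_(k | k != i) (Lk k ^+ mu k).[t] = \prod_(k | k != i) (Lk k).[t] ^+ mu k.
    by apply: eq_bigr => k _; rewrite horner_exp.
  ring.
rewrite mupMr; last first.
  by rewrite rootC oppr_eq0 !mulf_neq0// expf_neq0.
rewrite mupMl ?mup_XsubCX ?eqxx// rootE horner_prod; apply/prodf_neq0 => k ki.
by rewrite horner_exp expf_neq0// -rootE Lk0.
Qed.

Variable P : 'I_n -> mpoly 2 C.
Hypothesis PE : forall i,
  P i * (mpolyC 2 (bv i) * mvar C ord_max - mpolyC 2 (av i) * mvar C ord0) ^+ nu i
  = A * mpolyC 2 (eval2 B (bv i) (av i)) - mpolyC 2 (eval2 A (bv i) (av i)) * B.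

Let at_fiber (h : mpoly 2 C) i := eval2 h (bv i) (av i).

Let eval2D (h k : mpoly 2 C) u v : eval2 (h + k) u v = eval2 h u v + eval2 k u v.
Proof. exact: mevalD. Qed.

Let eval2M (h k : mpoly 2 C) u v : eval2 (h * k) u v = eval2 h u v * eval2 k u v.
Proof. exact: mevalM. Qed.

Let eval2Z e (h : mpoly 2 C) u v : eval2 (e *: h) u v = e * eval2 h u v.
Proof. exact: mevalZ. Qed.

Let eval2X0 (u v : C) : eval2 (mvar C ord0) u v = u.
Proof. by rewrite /eval2 mevalXU. Qed.

Let eval2X1 (u v : C) : eval2 (mvar C ord_max) u v = v.
Proof. by rewrite /eval2 mevalXU. Qed.

Let euler_at (h : mpoly 2 C) (k : C) i :
  mvar C ord0 * mderiv ord0 h + mvar C ord_max * mderiv ord_max h = k *: h ->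
  bv i * at_fiber (mderiv ord0 h) i + av i * at_fiber (mderiv ord_max h) i
  = k * at_fiber h i.
Proof.
move/(congr1 (fun g : mpoly 2 C => eval2 g (bv i) (av i))).
by rewrite eval2D !eval2M eval2Z eval2X0 eval2X1.
Qed.

(** The homogeneity of P i is known only through its product with L^nu_i: Euler's relations for this
    product and for L^nu_i leave one for P i, in degree d - nu i, after division by L^nu_i. *)
Let euler_P i : mvar C ord0 * mderiv ord0 (P i) + mvar C ord_max * mderiv ord_max (P i)
  = (d%:R - (nu i)%:R) *: P i.
Proof.
pose L i : mpoly 2 C := mpolyC 2 (bv i) * mvar C ord_max - mpolyC 2 (av i) * mvar C ord0.
have hC e : mpolyC 2 e * B = e *: B :> mpoly 2 C by rewrite mul_mpolyC.
have hX j : mvar C j \is ishomog1 1 mdeg by rewrite dhomogX /= mdeg1.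
have hL : L i \is ishomog1 1 mdeg.
  rewrite /L !mul_mpolyC; apply: dhomogD; first exact/dhomogZ/hX.
  by rewrite dhomogN; exact/dhomogZ/hX.
have hLn : L i ^+ nu i \is ishomog1 (nu i) mdeg.
  by have := dhomogMn (nu i) hL; rewrite mul1n.
have hR : P i * L i ^+ nu i \is ishomog1 d mdeg.
  rewrite [P i * _]PE mulrC !mul_mpolyC; apply: dhomogD; first exact/dhomogZ.
  by rewrite dhomogN; exact/dhomogZ.
have L0 : L i != 0.
  apply/eqP => /(congr1 (fun g : mpoly 2 C => eval2 g x1 y1)).
  rewrite /L /eval2 mevalB !mevalM !mevalC !mevalXU /tnth /=.
  by apply/eqP; exact: al_neq0.
have Ln0 : L i ^+ nu i != 0 by rewrite expf_neq0.
apply: (mulIf Ln0).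
have E1 := euler hLn; have := euler hR; rewrite !mderivM.
move=> E2; rewrite -scalerAl scalerBl -E2 scalerAr -E1; ring.
Qed.

(** This is (1, p0) in the basis (b_i, a_i), e1. A derivative along it follows from Euler's relation
    for the first vector and from a derivative on the line for the second. *)
Let direction i : let l1 := p0 * x1 - y1 in let l := p0 * (x0 + x1 * sg i) - (y0 + y1 * sg i) in
  1 = - l1 / al i * bv i + l * x1 /\ p0 = - l1 / al i * av i + l * y1.
Proof.
rewrite /=; have := al_neq0 i => al0; rewrite {1}(bvE i) {1}(avE i).
split.
  have -> : - (p0 * x1 - y1) / al i * (al i * (x0 + x1 * sg i)) =
    - (p0 * x1 - y1) * (x0 + x1 * sg i) by field.
  by rewrite -det1; ring.
have -> : - (p0 * x1 - y1) / al i * (al i * (y0 + y1 * sg i)) =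
  - (p0 * x1 - y1) * (y0 + y1 * sg i) by field.
by rewrite -[LHS]mulr1 -det1; ring.
Qed.

Let line_at (h : mpoly 2 C) i := line_poly (bv i) x1 (av i) y1 h.

Let deriv_line_at h i : (line_at h i)^`().[0] =
  x1 * at_fiber (mderiv ord0 h) i + y1 * at_fiber (mderiv ord_max h) i.
Proof.
rewrite /line_at /line_poly deriv_pull hornerD !hornerM !horner_pull.
rewrite !derivD !derivC !derivZ !derivX !alg_polyC !add0r !hornerC.
rewrite !hornerD !hornerZ !hornerX !hornerC !mulr0 !addr0 /at_fiber; ring.
Qed.

Let horner_line_at h i : (line_at h i).[0] = at_fiber h i.
Proof. by rewrite horner_line_poly !mulr0 !addr0. Qed.

Let line_at_homog h i : h \is ishomog1 d mdeg -> line_at h i =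
  al i ^+ d *: (line_poly x0 x1 y0 y1 h \Po ((sg i)%:P + (al i)^-1 *: 'X)).
Proof.
move=> hh; apply: poly_eq => s; rewrite hornerZ horner_comp !horner_line_poly.
rewrite -(eval2_homog _ _ _ hh) hornerD hornerZ hornerX hornerC {1}(bvE i) {1}(avE i).
have al0 := al_neq0 i.
have -> : al i * (x0 + x1 * (sg i + (al i)^-1 * s)) = al i * (x0 + x1 * sg i) + x1 * s by field.
by have -> : al i * (y0 + y1 * (sg i + (al i)^-1 * s)) = al i * (y0 + y1 * sg i) + y1 * s by field.
Qed.

Let deriv_line_at_homog h i : h \is ishomog1 d mdeg -> (line_at h i)^`().[0] =
  al i ^+ d * ((line_poly x0 x1 y0 y1 h)^`().[sg i] / al i).
Proof.
move=> /line_at_homog ->; rewrite derivZ hornerZ deriv_comp hornerM horner_comp.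
by rewrite derivD derivC derivZ derivX add0r alg_polyC hornerC hornerD hornerZ hornerX
  !hornerC mulr0 addr0.
Qed.

Let horner_line_at_homog h i : h \is ishomog1 d mdeg -> (line_at h i).[0] =
  al i ^+ d * (line_poly x0 x1 y0 y1 h).[sg i].
Proof. by move=> /line_at_homog ->; rewrite hornerZ horner_comp hornerD hornerZ hornerX
  hornerC mulr0 addr0. Qed.

(** On this line the form b_i y - a_i x is al i times the parameter, so dividing by its power
    removes the i-th factor from the factorization of a + p0 b. *)
Let line_P i : line_at (P i) i =
  (at_fiber B i * c / al i ^+ nu i) *:
     \prod_(k | k != i) ('X - (al i * (sg k - sg i))%:P) ^+ nu k.
Proof.
have [fact [sum_nu _]] := fiber_factorization.
have X0 : 'X ^+ nu i != 0 :> {poly C} by rewrite expf_neq0// polyX_eq0.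
apply: (mulIf X0); apply: poly_eq => s.
rewrite hornerM horner_line_poly hornerXn.
have hAB : A + p0 *: B \is ishomog1 d mdeg by rewrite dhomogD// dhomogZ.
have := congr1 (fun g : mpoly 2 C => eval2 g (bv i + x1 * s) (av i + y1 * s)) (PE i).
have E : eval2 (A + p0 *: B) (bv i + x1 * s) (av i + y1 * s) =
    c * (s ^+ nu i * \prod_(k | k != i) (s - al i * (sg k - sg i)) ^+ nu k).
  rewrite -horner_line_poly -/(line_at _ i) line_at_homog// hornerZ horner_comp.
  have -> : line_poly x0 x1 y0 y1 (A + p0 *: B) = a + p0 *: b.
    apply: poly_eq => t; rewrite hornerD hornerZ !horner_line_poly.
    by rewrite eval2D eval2Z.
  rewrite fact hornerZ mulrCA; congr (_ * _).
  have -> : s ^+ nu i * \prod_(k | k != i) (s - al i * (sg k - sg i)) ^+ nu k =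
      \prod_k (s - al i * (sg k - sg i)) ^+ nu k.
    by rewrite [RHS](bigD1 i)//= subrr mulr0 subr0.
  rewrite horner_prod -sum_nu -prodrXr -big_split /=; apply: eq_bigr => k _.
  rewrite horner_exp -exprMn hornerXsubC hornerD hornerZ hornerX hornerC; congr (_ ^+ _).
  by have al0 := al_neq0 i; field.
rewrite [eval2 (_ * _ ^+ _) _ _]eval2M [eval2 (_ ^+ _) _ _]rmorphXn /=.
have -> : meval (tnth [tuple bv i + x1 * s; av i + y1 * s])
    (mpolyC 2 (bv i) * mvar C ord_max - mpolyC 2 (av i) * mvar C ord0) = s * al i.
  by rewrite mevalB !mevalM !mevalC !mevalXU /tnth /= /al; ring.
have -> : eval2 (A * mpolyC 2 (eval2 B (bv i) (av i)) - mpolyC 2 (eval2 A (bv i) (av i)) * B)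
    (bv i + x1 * s) (av i + y1 * s)
    = at_fiber B i * eval2 (A + p0 *: B) (bv i + x1 * s) (av i + y1 * s).
  rewrite eval2D eval2Z ab_fiber /at_fiber.
  rewrite {1}/eval2 mevalB !mevalM !mevalC -/(eval2 A _ _) -/(eval2 B _ _); ring.
rewrite E exprMn hornerM hornerZ horner_prod hornerXn => E2.
have al0 : al i ^+ nu i != 0 by rewrite expf_neq0.
have -> : eval2 (P i) (bv i + x1 * s) (av i + y1 * s) * s ^+ nu i =
   eval2 (P i) (bv i + x1 * s) (av i + y1 * s) * (s ^+ nu i * al i ^+ nu i) / al i ^+ nu i.
  by field.
rewrite E2.
under [in RHS]eq_bigr => k _ do rewrite horner_exp hornerXsubC.
by field.
Qed.

Let pi i := \sum_(k | k != i) (nu k)%:R / (sg i - sg k).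

(** Where nu i = 1 both terms are 0. Where nu i > 1, the gradient of A + p0 B vanishes at the point,
    so A_y = - p0 B_y there, besides A = - p0 B. Both brackets in Q_i thus become derivatives along
    (1, p0), of B and of P i, which [direction] expresses by be i and pi i. *)
Lemma target_sum :
  \sum_i (1 - (nu i)%:R^-1) * ((p0 * bv i - av i) *
     (((nu i)%:R - 2) * (at_fiber (mderiv ord0 B) i - at_fiber (mderiv ord_max A) i)
        * at_fiber (P i) i
      + 2 * ((nu i)%:R + 1) * (at_fiber (mderiv ord0 (P i)) i * at_fiber B i
          - at_fiber (mderiv ord_max (P i)) i * at_fiber A i))
     / (at_fiber (P i) i * at_fiber B i))
  = web_residue d b p0 sg nu x0 x1 y0 y1.
Proof.
have [fact [sum_nu nu_gt0]] := fiber_factorization.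
pose l i := p0 * (x0 + x1 * sg i) - (y0 + y1 * sg i).
apply: (@etrans _ _ (\sum_i (1 - (nu i)%:R^-1) * l i *
  (l i * (2 * ((nu i)%:R + 1) * pi i + ((nu i)%:R - 2) * (b^`().[sg i] / b.[sg i]))
   - (nu i)%:R * (p0 * x1 - y1) * (3 * d%:R - 2 * (nu i)%:R - 2)))); last by [].
apply: eq_bigr => i _.
have [nu1|nu1] := eqVneq (nu i) 1%N; first by rewrite nu1 invr1 subrr !mul0r.
have nuR k : (nu k)%:R != 0 :> C by rewrite pnatr_eq0 -lt0n.
have nu2 : (1 < nu i)%N by rewrite ltn_neqAle eq_sym nu1 nu_gt0.
have al0 := al_neq0 i; have B0 : at_fiber B i != 0 := B_fiber i.
have hAB : A + p0 *: B \is ishomog1 d mdeg by rewrite dhomogD// dhomogZ.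
have f0 : (a + p0 *: b)^`().[sg i] = 0.
  rewrite fact (bigD1 i)//= derivZ derivM deriv_exp derivXsubC mul1r.
  rewrite hornerZ hornerD !hornerM hornerMn !horner_exp hornerXsubC subrr !expr0n.
  have -> : ((nu i).-1 == 0)%N = false by case: (nu i) nu2 => [|[]].
  have -> : (nu i == 0)%N = false by case: (nu i) nu2 => [|[]].
  by rewrite mul0rn !mul0r addr0 mulr0.
have Ay : at_fiber (mderiv ord_max A) i = - p0 * at_fiber (mderiv ord_max B) i.
  have := deriv_line_at_homog i hAB; rewrite deriv_line_at.
  have -> : line_poly x0 x1 y0 y1 (A + p0 *: B) = a + p0 *: b.
    apply: poly_eq => t; rewrite hornerD hornerZ !horner_line_poly.
    by rewrite eval2D eval2Z.
  rewrite f0 mul0r mulr0 => E1.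
  have := euler_at i (euler hAB); have -> : at_fiber (A + p0 *: B) i = 0.
    by rewrite /at_fiber eval2D eval2Z ab_fiber; ring.
  rewrite mulr0 => E2.
  have : al i * at_fiber (mderiv ord_max (A + p0 *: B)) i = 0.
    rewrite -[RHS](subrr (0 : C)) -{2}[0](mulr0 x1) -{1}[0](mulr0 (bv i)).
    by rewrite -{1}E1 -E2 /al; ring.
  move/eqP; rewrite mulf_eq0 (negbTE al0)/= mderivD mderivZ /at_fiber eval2D eval2Z.
  by rewrite addr_eq0 mulNr => /eqP.
have EB := euler_at i (euler hB); have EP := euler_at i (euler_P i).
have DB : x1 * at_fiber (mderiv ord0 B) i + y1 * at_fiber (mderiv ord_max B) i
    = at_fiber B i * (b^`().[sg i] / b.[sg i]) / al i.
  rewrite -deriv_line_at (deriv_line_at_homog i hB) -horner_line_at.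
  rewrite (horner_line_at_homog i hB) -/b.
  have b0 : b.[sg i] != 0.
    by move: B0; rewrite -horner_line_at (horner_line_at_homog i hB) mulf_eq0
      negb_or => /andP[].
  by field; rewrite al0 b0.
have tk k : k != i -> (0 : C) != al i * (sg k - sg i).
  move=> ki; rewrite eq_sym mulf_neq0// subr_eq0; apply: contra_neq ki.
  exact: fiber_param_inj.
have DP : x1 * at_fiber (mderiv ord0 (P i)) i + y1 * at_fiber (mderiv ord_max (P i)) i
    = at_fiber (P i) i * pi i / al i.
  rewrite -deriv_line_at -(horner_line_at (P i) i) line_P derivZ !hornerZ.
  rewrite (deriv_prod_XsubC_exp _ _ tk) -!mulrA; do 4 congr (_ * _).
  rewrite /pi mulr_suml; apply: eq_bigr => k ki.
  have : sg i - sg k != 0 by rewrite subr_eq0; apply: contra_neq ki => /fiber_param_inj.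
  by move=> h; rewrite sub0r -mulrN opprB; field; rewrite h al0.
have P0 : at_fiber (P i) i != 0.
  rewrite -horner_line_at line_P hornerZ mulf_neq0//.
    have c0 := lead_coef_neq0 no_common_zero det1 B_inf.
    by rewrite mulf_neq0 ?invr_eq0 ?expf_neq0// mulf_neq0.
  rewrite horner_prod; apply/prodf_neq0 => k ki.
  by rewrite horner_exp expf_neq0// hornerXsubC subr_eq0 tk.
have [d0 d1] := direction i; rewrite /= in d0 d1.
set l1 := p0 * x1 - y1 in d0 d1 *.
rewrite -/(l i) in d0 d1.
have E1 : at_fiber (mderiv ord0 B) i + p0 * at_fiber (mderiv ord_max B) i =
   - l1 / al i * (d%:R * at_fiber B i)
   + l i * (at_fiber B i * (b^`().[sg i] / b.[sg i]) / al i).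
  by rewrite -EB -DB -[X in X + _ = _]mul1r {1}d0 {1}d1; ring.
have E2 : at_fiber (mderiv ord0 (P i)) i + p0 * at_fiber (mderiv ord_max (P i)) i =
   - l1 / al i * ((d%:R - (nu i)%:R) * at_fiber (P i) i)
   + l i * (at_fiber (P i) i * pi i / al i).
  by rewrite -EP -DP -[X in X + _ = _]mul1r {1}d0 {1}d1; ring.
have -> : p0 * bv i - av i = al i * l i by rewrite {1}(bvE i) {1}(avE i) /l; ring.
have -> : at_fiber A i = - p0 * at_fiber B i by exact: ab_fiber.
have -> : at_fiber (mderiv ord0 B) i - at_fiber (mderiv ord_max A) i =
    at_fiber (mderiv ord0 B) i + p0 * at_fiber (mderiv ord_max B) i by rewrite Ay; ring.
have -> : at_fiber (mderiv ord0 (P i)) i * at_fiber B i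
    - at_fiber (mderiv ord_max (P i)) i * (- p0 * at_fiber B i) =
  at_fiber B i * (at_fiber (mderiv ord0 (P i)) i + p0 * at_fiber (mderiv ord_max (P i)) i).
  by ring.
rewrite E1 E2.
move: (l i) (b^`().[sg i] / b.[sg i]) (pi i) (at_fiber B i) B0 (at_fiber (P i) i) P0
  (nuR i) => li be p1 v1 h1 v2 h2 h3.
by field; rewrite al0 h1 h2 h3.
Qed.

End Fiber.

(** * The discriminant of the Legendre transform *)

Section BinaryDiscriminant.
Context (C : numClosedFieldType).
Implicit Types (f : {poly C}) (d : nat).

Definition disc d f : C :=
  let n := d.-1 in
  let Ft := f^`() in
  let Fs := f *+ d - 'X * f^`() in
  \det (col_mx (\matrix_(i < n, j < (n + n)%N) (Ft * 'X^i)`_j)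
               (\matrix_(i < n, j < (n + n)%N) (Fs * 'X^i)`_j)).

Lemma size_deriv_le f d : (size f <= d.+1)%N -> (size f^`() <= d)%N.
Proof.
move=> sf; have [->|f0] := eqVneq f 0; first by rewrite deriv0 size_poly0.
by rewrite -ltnS (leq_trans (lt_size_deriv f0)).
Qed.

Lemma size_deriv_s_le f d : (size f <= d.+1)%N -> (size (f *+ d - 'X * f^`())%R <= d)%N.
Proof.
move=> sf; apply/leq_sizeP => j dj; rewrite coefB coefMn coefXM coef_deriv.
case: j dj => [|j] dj /=.
  by move: dj; rewrite leqn0 => /eqP ->; rewrite mulr0n subr0.
have [jd|jd] := ltnP j d; last by rewrite nth_default ?mul0rn ?subrr// (leq_trans sf).
have -> : d = j.+1 by apply/eqP; rewrite eqn_leq dj jd.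
by rewrite subrr.
Qed.

(** A kernel vector of the Sylvester matrix is a relation U f' + V (d f - X f') = 0, so f divides G
    = U - X V by coprimality, and G = k f with k constant for degree reasons. Comparing coefficients
    of degree d - 1 gives k f_{d-1} = 0. If k != 0, then f has degree d - 1 and this is its leading
    coefficient, a contradiction; so k, V and U vanish. Degree d - 1 is allowed: it means a simple
    root at infinity. *)
Lemma disc_neq0 f d : (1 < d)%N -> (d <= size f <= d.+1)%N ->
  coprimep f f^`() -> disc d f != 0.
Proof.
move=> d1 /andP[df sf] cop; rewrite /disc; set M := col_mx _ _.
have [n dE] : exists n, d = n.+2 by case: (d) d1 => [|[|n]] // _; exists n.
apply/negP => /det0P[u u0 uM].
pose U := \sum_(i < d.-1) u 0 (lshift d.-1 i) *: 'X^i : {poly C}.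
pose V := \sum_(i < d.-1) u 0 (rshift d.-1 i) *: 'X^i : {poly C}.
pose fs := f *+ d - 'X * f^`().
have sU : (size U <= d.-1)%N.
  apply: (leq_trans (size_sum _ _ _)); apply/bigmax_leqP => i _.
  by rewrite (leq_trans (size_scale_leq _ _))// size_polyXn.
have sV : (size V <= d.-1)%N.
  apply: (leq_trans (size_sum _ _ _)); apply/bigmax_leqP => i _.
  by rewrite (leq_trans (size_scale_leq _ _))// size_polyXn.
have UV : U * f^`() + V * fs = 0.
  apply/polyP => j; rewrite coef0.
  have [jn|jn] := ltnP j (d.-1 + d.-1); last first.
    have sz (g h : {poly C}) : (size g <= d.-1)%N -> (size h <= d)%N -> (g * h)`_j = 0.
      move=> sg sh; rewrite nth_default//; apply: leq_trans (size_polyMleq _ _) _.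
      apply: leq_trans jn; rewrite -ltnS -subn1.
      apply: (@leq_ltn_trans (size g + size h - 1)); first by [].
      have : (size g + size h <= d.-1 + d)%N by apply: leq_add.
      by move: d1; case: (d) => [|[|k]]//= _; lia.
    by rewrite coefD !sz ?addr0// ?size_deriv_le ?size_deriv_s_le.
  have := congr1 (fun v : 'rV_(d.-1 + d.-1) => v 0 (Ordinal jn)) uM.
  rewrite [X in X = _ -> _]mxE [X in _ = X -> _]mxE big_split_ord /= => E.
  rewrite -[RHS]E coefD /U /V !mulr_suml !coef_sum.
  congr (_ + _); apply: eq_bigr => i _.
    by rewrite /M col_mxEu mxE -scalerAl coefZ ['X^i * _]mulrC.
  by rewrite /M col_mxEd mxE -scalerAl coefZ ['X^i * _]mulrC.
pose G := U - 'X * V.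
have GE : G * f^`() = - (V * (f *+ d)).
  by apply/eqP; rewrite -addr_eq0 -UV /G /fs; apply/eqP; ring.
have f0 : f != 0 by rewrite -size_poly_gt0 (leq_trans _ df)// ltnW.
have dC : (d%:R : C) != 0 by rewrite pnatr_eq0 -lt0n ltnW.
have /dvdpP[h hE] : f %| G.
  rewrite -(Gauss_dvdpl _ cop) GE mulrnAr -mulrnAl -mulNr.
  exact: dvdp_mulIr.
have sG : (size G <= d)%N.
  rewrite /G (leq_trans (size_polyD _ _))// geq_max size_polyN.
  rewrite (leq_trans sU) ?leq_pred//= (leq_trans (size_polyMleq _ _))// size_polyX /=.
  by rewrite (leq_ltn_trans sV)// dE.
have [k hk] : exists k, h = k%:P.
  have [->|h0] := eqVneq h 0; first by exists 0; rewrite polyC0.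
  exists h`_0; apply: size1_polyC; move: sG; rewrite hE size_mul// => sG2.
  rewrite -(leq_add2r (size f)) add1n; apply: leq_trans (leqSpred _) _.
  by rewrite ltnS (leq_trans sG2).
have VE : V *+ d = - (k *: f^`()).
  apply: (mulIf f0); move: GE; rewrite hE hk mul_polyC => GE.
  by rewrite mulNr mulrnAl -mulrnAr -[LHS]opprK -GE -!scalerAl mulrC.
have Un : U`_d.-1 = 0 by rewrite nth_default.
have : d%:R * G`_d.-1 = k * f`_d.-1 *+ d.-1.
  rewrite /G coefB Un coefXM sub0r; have -> : (d.-1 == 0)%N = false by rewrite dE.
  have := congr1 (fun g : {poly C} => g`_d.-2) VE; rewrite coefMn coefN coefZ coef_deriv.
  have -> : d.-2.+1 = d.-1 by rewrite dE.
  by rewrite mulrN mulr_natl => ->; rewrite opprK mulrnAr.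
rewrite hE hk mul_polyC coefZ => kf.
have {kf} kf0 : k * f`_d.-1 = 0.
  by move: kf; rewrite mulr_natl dE /= mulrSr -[RHS]addr0 => /addrI.
have k0 : k = 0.
  apply/eqP; apply: contraT => k0; move/eqP: kf0; rewrite mulf_eq0 (negbTE k0)/= => fn.
  have sfd : size f = d.
    apply/eqP; rewrite eqn_leq df andbT; move: sG.
    by rewrite hE hk mul_polyC size_scale.
  have : lead_coef f == 0 by rewrite lead_coefE sfd.
  by rewrite lead_coef_eq0 (negbTE f0).
have V0 : V = 0.
  move: VE; rewrite k0 scale0r oppr0 -scaler_nat => /eqP.
  by rewrite scaler_eq0 (negbTE dC) => /eqP.
have U0 : U = 0.
  have : G = 0 by rewrite hE hk k0 mul_polyC scale0r.
  by rewrite /G V0 mulr0 subr0.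
move/eqP: u0; apply; apply/rowP => j; rewrite mxE.
have coefS (w : 'I_d.-1 -> C) i : (\sum_(i < d.-1) w i *: 'X^i : {poly C})`_(nat_of_ord i) = w i.
  rewrite coef_sum (bigD1 i)//= coefZ coefXn eqxx mulr1 big1 ?addr0// => l li.
  by rewrite coefZ coefXn; case: eqP => [/val_inj il|]; rewrite ?mulr0//; rewrite il eqxx in li.
case: (split_ordP j) => i ->.
  by have := congr1 (fun g : {poly C} => g`_i) U0; rewrite coefS coef0.
by have := congr1 (fun g : {poly C} => g`_i) V0; rewrite coefS coef0.
Qed.

End BinaryDiscriminant.

Section LegendreTransform.
Context (C : numClosedFieldType) (d : nat).
Variables (A B : mpoly 2 C).
Hypotheses (hA : A \is ishomog1 d mdeg) (hB : B \is ishomog1 d mdeg).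
Implicit Types (z t : C * C) (P : mpoly 2 C).

(* [Leg] and [web_disc] over an arbitrary closed field. *)
Definition legendre : {poly mpoly 2 C} :=
  let p := (mvar C ord0)%:P in
  let q := (mvar C ord_max)%:P in
  let on_line P :=
    mmap (fun c : C => (mpolyC 2 c)%:P) (tnth [tuple 'X; p * 'X - q]) P in
  on_line A + p * on_line B.

(** The line y = p x - q is parametrized by x, from (0, - q) with direction (1, p). *)
Definition Leg_at z : {poly C} :=
  line_poly 0 1 (- z.2) z.1 A + z.1 *: line_poly 0 1 (- z.2) z.1 B.

Let at_z z : mpoly 2 C -> C := meval (tnth [tuple z.1; z.2]).

Let map_on_line z P :
  map_poly (at_z z)
    (mmap (fun c : C => (mpolyC 2 c)%:P) (tnth [tuple 'X; (mvar C ord0)%:P * 'X - (mvar C ord_max)%:P]) P)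
  = line_poly 0 1 (- z.2) z.1 P.
Proof.
rewrite /line_poly /pull /mmap rmorph_sum; apply: eq_bigr => m _.
rewrite rmorphM /= map_polyC /= mevalC; congr (_ * _).
rewrite /mmap1 rmorph_prod; apply: eq_bigr => i _; rewrite rmorphXn; congr (_ ^+ _).
move: i; apply: I2_case; rewrite /tnth /=.
  by rewrite map_polyX polyC0 add0r scale1r.
rewrite rmorphB rmorphM /= !map_polyC map_polyX /= !mevalXU /tnth /=.
by rewrite mul_polyC polyCN addrC.
Qed.

Lemma map_Leg z : map_poly (at_z z) legendre = Leg_at z.
Proof.
rewrite [LHS]rmorphD [X in _ + X]rmorphM [X in X + _]map_on_line [X in _ * X]map_on_line.
by rewrite [X in X * _]map_polyC [X in X%:P]mevalXU /tnth /= mul_polyC.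
Qed.

Lemma sym_form_Leg z t : \sum_(i < d.+1) eval2 legendre`_i z.1 z.2 * t.1 ^+ (d - i) * t.2 ^+ i =
  eval2 A t.2 (z.1 * t.2 - z.2 * t.1) + z.1 * eval2 B t.2 (z.1 * t.2 - z.2 * t.1).
Proof.
have E (P : mpoly 2 C) : P \is ishomog1 d mdeg -> eval2 P t.2 (z.1 * t.2 - z.2 * t.1) =
    \sum_(i < d.+1) (line_poly 0 1 (- z.2) z.1 P)`_i * t.1 ^+ (d - i) * t.2 ^+ i.
  move=> hP; rewrite (line_poly_homog _ _ _ _ _ _ hP).
  by congr eval2; ring.
rewrite (E A hA) (E B hB) mulr_sumr -big_split /=; apply: eq_bigr => i _.
have -> : eval2 legendre`_i z.1 z.2 = (Leg_at z)`_i.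
  by rewrite -map_Leg coef_map.
by rewrite coefD coefZ; ring.
Qed.

Definition legendre_disc : mpoly 2 C :=
  let n := d.-1 in
  let Ft := legendre^`() in
  let Fs := legendre *+ d - 'X * legendre^`() in
  \det (col_mx (\matrix_(i < n, j < (n + n)%N) (Ft * 'X^i)`_j)
               (\matrix_(i < n, j < (n + n)%N) (Fs * 'X^i)`_j)).

Lemma eval2_legendre_disc z : eval2 legendre_disc z.1 z.2 = disc d (Leg_at z).
Proof.
rewrite /eval2 /legendre_disc /disc -(det_map_mx (meval (tnth [tuple z.1; z.2]))).
rewrite map_col_mx -map_Leg.
congr (\det (col_mx _ _)); apply/matrixP => i j; rewrite !mxE -coef_map rmorphM /=.
  by rewrite map_polyXn deriv_map.
by rewrite map_polyXn rmorphB rmorphM rmorphMn /= map_polyX deriv_map.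
Qed.

Variables (x0 x1 y0 y1 : C).
Hypotheses (det1 : x0 * y1 - x1 * y0 = 1) (B_inf : eval2 B x1 y1 = 0).
Hypothesis no_common_zero :
  forall u v : C, eval2 A u v = 0 -> eval2 B u v = 0 -> u = 0 /\ v = 0.

Let a := line_poly x0 x1 y0 y1 A.
Let b := line_poly x0 x1 y0 y1 B.
Let c := eval2 A x1 y1.
Let x s := x0 + x1 * s.
Let y s := y0 + y1 * s.

Lemma Leg_at_factor z (s : 'I_d -> C) : splits a b c z.1 s ->
  Leg_at z = c *: \prod_r ((z.1 * x (s r) - y (s r)) *: 'X - (z.2 * x (s r))%:P).
Proof.
move=> sP; apply: poly_eq => w.
rewrite hornerD !hornerZ !horner_line_poly (form_factor hA hB det1 B_inf _ _ sP).
rewrite horner_prod; congr (_ * _); apply: eq_bigr => r _.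
by rewrite hornerD hornerN hornerZ hornerX hornerC /x /y; ring.
Qed.

Let size_Leg_at z : (size (Leg_at z) <= d.+1)%N.
Proof.
rewrite (leq_trans (size_polyD _ _))// geq_max size_line_poly//=.
by rewrite (leq_trans (size_scale_leq _ _))// size_line_poly.
Qed.

(** The roots of the equation at (p, q) are the q x(s_r) / l_r, as points of the projective line.
    They are distinct because l_r x(s_k) - l_k x(s_r) = s_k - s_r and q != 0. *)
Lemma legendre_disc_neq0 z (s : 'I_d -> C) : (1 < d)%N -> z.2 != 0 ->
  splits a b c z.1 s -> injective s -> eval2 legendre_disc z.1 z.2 != 0.
Proof.
move=> d1 z20 sP sinj; rewrite eval2_legendre_disc.
have c0 : c != 0 := lead_coef_neq0 no_common_zero det1 B_inf.
pose l r := z.1 * x (s r) - y (s r).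
have lx r k : l r * x (s k) - l k * x (s r) = s k - s r.
  rewrite /l /x /y -[RHS]mulr1 -det1; ring.
have lxne r k : r != k -> l r * (z.2 * x (s k)) != l k * (z.2 * x (s r)).
  move=> rk; rewrite -subr_eq0.
  have -> : l r * (z.2 * x (s k)) - l k * (z.2 * x (s r)) = z.2 * (s k - s r).
    by rewrite -lx; ring.
  rewrite mulf_neq0// subr_eq0; apply: contra_neq rk => /sinj ->//.
have l0x r : l r = 0 -> x (s r) != 0.
  move=> l0; apply/eqP => xs; have ys : y (s r) = 0.
    by move: l0; rewrite /l xs mulr0 sub0r => /eqP; rewrite oppr_eq0 => /eqP.
  have : x (s r) * y1 - x1 * y (s r) = 1 by rewrite /x /y -det1; ring.
  by rewrite xs ys mul0r mulr0 subrr => /eqP; rewrite eq_sym oner_eq0.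
have fE := Leg_at_factor sP.
pose L r := l r *: 'X - (z.2 * x (s r))%:P.
have LE r w : (L r).[w] = l r * w - z.2 * x (s r).
  by rewrite hornerD hornerN hornerZ hornerX hornerC.
have L0 r : L r != 0.
  apply/eqP => Lr; have lr0 : l r = 0.
    have := congr1 (fun g : {poly C} => g`_1) Lr.
    by rewrite coefB coefZ coefX coefC coef0 /= mulr1 subr0.
  have := congr1 (horner^~ 0) Lr; rewrite /= LE horner0 mulr0 sub0r => /eqP.
  by rewrite oppr_eq0 mulf_eq0 (negbTE z20) (negbTE (l0x _ lr0)).
have f0 : Leg_at z != 0.
  by rewrite fE scaler_eq0 negb_or c0; apply/prodf_neq0 => r _; exact: L0.
have rootL r w : l r * w = z.2 * x (s r) -> root (Leg_at z) w.
  move=> rw; rewrite fE rootE hornerZ horner_prod (bigD1 r)//= -/(L r) LE rw.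
  by rewrite subrr mul0r mulr0.
apply: disc_neq0 => //.
  rewrite size_Leg_at andbT.
  (* At most one l_r is 0, which sends its root to infinity and lowers the degree by one. *)
  have [k lk] : exists k : 'I_d, forall r, r != k -> l r != 0.
    case: (pickP (fun k => l k == 0)) => [k /eqP lk|lk].
      exists k => r rk; apply/eqP => lr; have := lxne _ _ rk.
      by rewrite lr lk !mul0r eqxx.
    by exists (Ordinal (ltnW d1)) => r _; rewrite lk.
  pose q := [seq z.2 * x (s r) / l r | r <- enum (predC1 k)].
  have szq : size q = d.-1 by rewrite size_map -cardE cardC1 card_ord.
  rewrite -(prednK (ltnW d1)) -szq; apply: max_poly_roots => //.
    apply/allP => _ /mapP[r rk ->]; apply: (rootL r).
    by move: rk; rewrite mem_enum => /lk lr; rewrite mulrC divfK.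
  rewrite map_inj_in_uniq ?enum_uniq// => r1 r2; rewrite !mem_enum => /lk h1 /lk h2 E.
  apply/eqP; apply: contraT => /lxne /eqP; case.
  have -> : z.2 * x (s r2) = z.2 * x (s r1) / l r1 * l r2 by rewrite E divfK.
  by field.
rewrite /coprimep; apply/negPn/negP => /closed_rootP[w].
rewrite root_gcd => /andP[/rootP fw /rootP dfw].
move/eqP: fw; rewrite fE hornerZ mulf_eq0 (negbTE c0)/= horner_prod.
rewrite prodf_seq_eq0 => /hasP[r _ /= /eqP]; rewrite -/(L r) LE => rw.
have {}rw : l r * w = z.2 * x (s r) by apply/eqP; rewrite -subr_eq0 rw.
have lr : l r != 0.
  apply/eqP => lr; move/eqP: rw; rewrite lr mul0r eq_sym mulf_eq0 (negbTE z20)/=.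
  by rewrite (negbTE (l0x _ lr)).
move: dfw; rewrite fE (bigD1 r)//= -/(L r) derivZ derivM hornerZ hornerD !hornerM LE rw.
rewrite subrr mul0r addr0 /L derivB derivZ derivX derivC subr0 hornerZ hornerC mulr1.
move/eqP; rewrite !mulf_eq0 (negbTE c0) (negbTE lr)/= horner_prod.
rewrite prodf_seq_eq0 => /hasP[k _ /andP[kr /eqP]]; rewrite -/(L k) LE => kw.
have {}kw : l k * w = z.2 * x (s k) by apply/eqP; rewrite -subr_eq0 kw.
have := lxne _ _ kr; rewrite -rw -kw => /eqP; case; ring.
Qed.

End LegendreTransform.

Section Conversion.
Context (R : realType).
Notation C := R[i].
Variables (A B : bipoly R) (d : nat).

Lemma evE (P : bipoly R) (x y : C) : ev P x y = eval2 P x y.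
Proof. by []. Qed.

Lemma web_discE z : ev (web_disc d (Leg A B)) z.1 z.2 = eval2 (legendre_disc d A B) z.1 z.2.
Proof. by []. Qed.

Lemma sym_formE (hA : A \is ishomog1 d mdeg) (hB : B \is ishomog1 d mdeg) (z t : C2 R) :
  sym_form d (Leg A B) z t =
  eval2 A t.2 (z.1 * t.2 - z.2 * t.1) + z.1 * eval2 B t.2 (z.1 * t.2 - z.2 * t.1).
Proof. by rewrite -(sym_form_Leg hA hB z t). Qed.

End Conversion.

(** * The curvature of the Legendre transform *)

Section HorizontalGradients.
Context (R : realType).
Notation C := R[i].
Implicit Types (f g : C2 R -> C^o) (z : C2 R).

Definition pgrad f z := exists u : C, has_grad f z u 0.

Lemma pgrad_cst (k : C) z : pgrad (fun=> k) z.
Proof. by exists 0; exact: has_grad_cst. Qed.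

Lemma pgrad_fst z : pgrad (fun x => x.1) z.
Proof. by exists 1; exact: has_grad_fst. Qed.

Lemma pgradD f g z : pgrad f z -> pgrad g z -> pgrad (fun x => f x + g x) z.
Proof.
move=> [u fu] [v gv]; exists (u + v).
by apply: (has_grad_eq (has_gradD fu gv)) => //; rewrite addr0.
Qed.

Lemma pgradN f z : pgrad f z -> pgrad (fun x => - f x) z.
Proof.
move=> [u fu]; exists (- u).
by apply: (has_grad_eq (has_gradN fu)) => //; rewrite oppr0.
Qed.

Lemma pgradM f g z : pgrad f z -> pgrad g z -> pgrad (fun x => f x * g x) z.
Proof.
move=> [u fu] [v gv]; exists (u * g z + f z * v).
by apply: (has_grad_eq (has_gradM fu gv)) => //; rewrite mul0r mulr0 addr0.
Qed.

Lemma pgradV f z : pgrad f z -> f z != 0 -> pgrad (fun x => (f x)^-1) z.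
Proof.
move=> [u fu] fz; exists (- u / f z ^+ 2).
by apply: (has_grad_eq (has_gradV fu fz)) => //; rewrite oppr0 mul0r.
Qed.

Lemma pgrad_horner (h : {poly C}) f z : pgrad f z -> pgrad (fun x => h.[f x]) z.
Proof.
move=> [u fu]; exists (u * h^`().[f z]).
by apply: (has_grad_eq (has_grad_horner h fu)) => //; rewrite mul0r.
Qed.

(** Caratheodory's form of differentiability: a continuous slope g is enough. *)
Lemma has_grad_affine (k : C) g z : {for z, continuous g} ->
  has_grad (fun x => k + (x.1 - z.1) * g x) z (g z) 0.
Proof.
move=> gc; apply/has_gradP => e e0.
have : \forall x \near z, `|g z - g x| <= e.
  by have /cvgrPdist_le/(_ e e0) := gc.
rewrite (near_shift (0 : C2 R)) subr0 => h.
apply: filterS h => x xe.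
have -> : k + ((x + z).1 - z.1) * g (x + z) - (k + (z.1 - z.1) * g z) - (g z * x.1 + 0 * x.2)
  = - ((g z - g (x + z)) * x.1).
  have -> : (x + z).1 = x.1 + z.1 by [].
  by ring.
rewrite normrN normrM; apply: ler_pM => //.
by rewrite prod_normE num_le_max lexx.
Qed.

End HorizontalGradients.

(** * The linear system for the forms eta_rst *)

Section EtaSystem.
Context (F : fieldType) (p x0 x1 y0 y1 : F).
Hypothesis det1 : x0 * y1 - x1 * y0 = 1.
Let X s := x0 + x1 * s.
Let l s := p * (x0 + x1 * s) - (y0 + y1 * s).
Let l1 := p * x1 - y1.

(* The coefficient of dp in the normalized form eta_rst. *)
Definition eta_coef_p (sr ss st vr vs vt : F) : F :=
  - (X ss * ((vt - vs) / (st - ss) * l sr + vr * l1)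
     - X sr * ((vr - vt) / (sr - st) * l ss + vs * l1)) / (sr - ss).

Definition eta_coef_q (sr ss st vr vs vt : F) : F :=
  eta_coef sr ss st vr vs vt (l sr) (l ss) (l st).

Let rhs (sr ss st vr vs vt : F) := (vt - vs) / (st - ss) * l sr + vr * l1.

Let det_eq s t : X s * l t - X t * l s = s - t.
Proof. by rewrite /X /l -[RHS]mul1r -det1; ring. Qed.

Variables (sr ss st vr vs vt : F).
Hypotheses (rs : sr - ss != 0) (tr : st - sr != 0) (st_ : ss - st != 0).

Let eta_coef_qE : eta_coef_q sr ss st vr vs vt =
  (l ss * rhs sr ss st vr vs vt - l sr * rhs ss st sr vs vt vr) / (sr - ss).
Proof.
have h1 : st - ss != 0 by rewrite -opprB oppr_eq0.
have h2 : sr - st != 0 by rewrite -opprB oppr_eq0.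
have h3 : ss - sr != 0 by rewrite -opprB oppr_eq0.
rewrite /eta_coef_q /eta_coef /rhs /l /l1; field.
by rewrite ?rs ?tr ?st_ ?h1 ?h2 ?h3.
Qed.

(** There are two unknowns for three equations. Cramer's rule, with determinant sr - ss by [det_eq],
    solves the first two, and the third is then an algebraic identity. *)
Lemma eta_system : let e1 := eta_coef_p sr ss st vr vs vt in
  let e2 := eta_coef_q sr ss st vr vs vt in
  [/\ e1 * l sr + e2 * X sr = rhs sr ss st vr vs vt,
      e1 * l ss + e2 * X ss = rhs ss st sr vs vt vr
    & e1 * l st + e2 * X st = rhs st sr ss vt vr vs].
Proof.
have h1 : st - ss != 0 by rewrite -opprB oppr_eq0.
have h2 : sr - st != 0 by rewrite -opprB oppr_eq0.
move=> e1 e2.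
have E u : e1 * l u + e2 * X u =
   (rhs sr ss st vr vs vt * (X u * l ss - X ss * l u)
    + rhs ss st sr vs vt vr * (X sr * l u - X u * l sr)) / (sr - ss).
  rewrite /e1 /e2 eta_coef_qE /eta_coef_p -/(rhs sr ss st vr vs vt).
  by rewrite -/(rhs ss st sr vs vt vr); field.
split; rewrite E !det_eq.
- by rewrite subrr mulr0 addr0 mulfK.
- by rewrite subrr mulr0 add0r mulfK.
have h3 : ss - sr != 0 by rewrite -opprB oppr_eq0.
by rewrite /rhs /l /l1; field; rewrite ?rs ?tr ?st_ ?h1 ?h2 ?h3.
Qed.

Lemma eta_system_unique e1 e2 :
  e1 * l sr + e2 * X sr = rhs sr ss st vr vs vt ->
  e1 * l ss + e2 * X ss = rhs ss st sr vs vt vr ->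
  e1 = eta_coef_p sr ss st vr vs vt /\ e2 = eta_coef_q sr ss st vr vs vt.
Proof.
move=> E1 E2; rewrite eta_coef_qE /eta_coef_p -/(rhs sr ss st vr vs vt).
rewrite -/(rhs ss st sr vs vt vr) -E1 -E2.
have dE : sr - ss = X sr * l ss - X ss * l sr by rewrite det_eq.
have d0 : X sr * l ss - X ss * l sr != 0 by rewrite det_eq.
by rewrite dE; split; field.
Qed.

End EtaSystem.

(** * Differentiability of the roots of the pencil *)

Section Branches.
Context (R : realType).
Notation C := R[i].
Variables (a b : {poly C}).
Implicit Types (z : C2 R) (s : C2 R -> C^o).

Lemma continuous_horner_comp (h : {poly C}) s z : {for z, continuous s} ->
  {for z, continuous (fun x => h.[s x] : C^o)}.
Proof.
move=> sc; elim/poly_ind: h => [|h c IH].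
  rewrite (_ : (fun x => _) = (fun=> 0)); first exact: cvg_cst.
  by apply/funext => x; rewrite horner0.
rewrite (_ : (fun x => _) = (fun x => h.[s x] * s x + c)); last first.
  by apply/funext => x; rewrite hornerMXaddC.
apply: cvgD; last exact: cvg_cst.
by apply: cvgM; [exact: IH | exact: sc].
Qed.

Lemma implicit_root s z : {for z, continuous s} ->
  (\forall x \near z, (a + x.1 *: b).[s x] = 0) ->
  (a + z.1 *: b)^`().[s z] != 0 ->
  has_grad s z (- b.[s z] / (a + z.1 *: b)^`().[s z]) 0.
Proof.
move=> sc sroot simple; set f := a + z.1 *: b in simple *.
have /factor_theorem[h hE] : root f (s z) by apply/rootP; exact: (nbhs_singleton sroot).
have hd : h.[s z] = f^`().[s z].
  by rewrite hE derivM derivXsubC mulr1 hornerD hornerM hornerXsubC subrr mulr0 add0r.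
have hc := continuous_horner_comp (h := h) sc; have bc := continuous_horner_comp (h := b) sc.
pose g x : C^o := - b.[s x] / h.[s x].
have gc : {for z, continuous g}.
  apply: cvgM; first by apply: cvgN; exact: bc.
  by apply: cvgV; [rewrite hd | exact: hc].
rewrite -hd; apply: has_grad_near (has_grad_affine (s z) gc).
have h0 : \forall x \near z, h.[s x] != 0.
  by apply: cvgr_neq0 hc _; rewrite hd.
apply: filterS2 h0 sroot => x hx sx.
have E : h.[s x] * (s x - s z) = - (x.1 - z.1) * b.[s x].
  have := congr1 (horner^~ (s x)) hE; rewrite /= hornerM hornerXsubC => <-.
  move/eqP: sx; rewrite /f !hornerD !hornerZ => /eqP sx.
  rewrite -[LHS]subr0 -sx; ring.
rewrite /g mulrA mulrN -mulNr -E mulrC mulKf//; ring.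
Qed.

End Branches.

Lemma eq_iff_proportional (F : fieldType) (k u v u' v' : F) : k != 0 ->
  u - v = k * (u' - v') -> u = v <-> u' = v'.
Proof.
move=> k0 E; split=> [uv|uv]; apply/eqP; rewrite -subr_eq0.
  by move/eqP: E; rewrite uv subrr eq_sym mulf_eq0 (negbTE k0).
by rewrite E uv subrr mulr0.
Qed.

(** * Normal form of the defining 1-forms *)

Section NormalForm.
Context (R : realType).
Notation C := R[i].
Variables (x0 x1 y0 y1 : C).
Hypothesis det1 : x0 * y1 - x1 * y0 = 1.
Implicit Types (x z : C2 R) (s h f : C2 R -> C^o) (w : C2 R -> C2 R).

Let X (s : C) := x0 + x1 * s.
Let l (x : C2 R) (s : C) := x.1 * (x0 + x1 * s) - (y0 + y1 * s).

(* At a point (x, y) of the line y = p x - q in the direction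
   (x0 + x1 s, y0 + y1 s), the leaf dual to this line satisfies
   dq / dp = x = q (x0 + x1 s) / l; f is an arbitrary factor. *)
Definition branch_form f s x : C2 R :=
  (- (f x * x.2 * (x0 + x1 * s x)),
   f x * (x.1 * (x0 + x1 * s x) - (y0 + y1 * s x))).

Lemma wedge_branch_form f s f' s' x :
  wedge (branch_form f s x) (branch_form f' s' x) = f x * f' x * x.2 * (s' x - s x).
Proof. by rewrite /wedge /branch_form /= -[RHS]mulr1 -det1; ring. Qed.

Lemma branch_form_neq0 f s x : f x != 0 -> x.2 != 0 -> branch_form f s x != 0.
Proof.
move=> fx x20; apply/eqP => -[] /eqP; rewrite oppr_eq0 !mulf_eq0 (negbTE fx) (negbTE x20) /=.
move=> /eqP Xs /eqP; rewrite mulf_eq0 (negbTE fx) /= Xs mulr0 sub0r oppr_eq0 => /eqP Ys.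
have : (x0 + x1 * s x) * y1 - x1 * (y0 + y1 * s x) = 1 by rewrite -det1; ring.
by rewrite Xs Ys mulr0 mul0r subrr => /eqP; rewrite eq_sym oner_eq0.
Qed.

Lemma ext_d_grad (w : C2 R -> C2 R) (g k : C2 R -> C^o) x g1 g2 k1 k2 :
  (\forall y \near x, w y = (g y, k y)) -> has_grad g x g1 g2 -> has_grad k x k1 k2 ->
  ext_d w x = k1 - g2.
Proof.
move=> wE gP kP; rewrite /ext_d.
have w2 : has_grad (fun y => (w y).2) x k1 k2.
  by apply: has_grad_near kP; apply: filterS wE => y ->.
have w1 : has_grad (fun y => (w y).1) x g1 g2.
  by apply: has_grad_near gP; apply: filterS wE => y ->.
by rewrite (has_grad_derive w2).1 (has_grad_derive w1).2.
Qed.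

Lemma has_grad_X s x v : has_grad s x v 0 ->
  has_grad (fun y => x0 + x1 * s y) x (x1 * v) 0.
Proof.
move=> sP; apply: (has_grad_eq (has_gradD (has_grad_cst x0 x) (has_gradM (has_grad_cst x1 x) sP))).
  by rewrite mul0r !add0r.
by rewrite mul0r mulr0 !add0r.
Qed.

Lemma has_grad_Y s x v : has_grad s x v 0 ->
  has_grad (fun y => y0 + y1 * s y) x (y1 * v) 0.
Proof.
move=> sP; apply: (has_grad_eq (has_gradD (has_grad_cst y0 x) (has_gradM (has_grad_cst y1 x) sP))).
  by rewrite mul0r !add0r.
by rewrite mul0r mulr0 !add0r.
Qed.

(** h is the factor common to the three products delta w, see [delta_branch_form]. Dividing by h
    (s_t - s_s) leaves an equation in which eta enters through eta - dh / h only. In the constant 2,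
    one unit is the q-derivative of q X and the other is the term X in the p-derivative of l. *)
Lemma normalized_branch w (sr ss st h : C2 R -> C^o) x (vr vs vt h1 h2 : C) (e : C2 R) :
  has_grad sr x vr 0 -> has_grad ss x vs 0 -> has_grad st x vt 0 ->
  has_grad h x h1 h2 -> h x != 0 -> st x - ss x != 0 ->
  (\forall y \near x, w y = branch_form (fun y => h y * (st y - ss y)) sr y) ->
  ext_d w x = wedge e (w x) <->
  (e.1 - h1 / h x) * l x (sr x) + (x.2 * (e.2 - h2 / h x) - 2) * X (sr x)
    = (vt - vs) / (st x - ss x) * l x (sr x) + vr * (x.1 * x1 - y1).
Proof.
move=> srP ssP stP hP h0 st0 wE.
have fP := has_gradM hP (has_gradD stP (has_gradN ssP)).
rewrite /= in fP.
have XP := has_grad_X srP; have YP := has_grad_Y srP.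
have gP := has_gradN (has_gradM (has_gradM fP (has_grad_snd x)) XP).
have kP := has_gradM fP (has_gradD (has_gradM (has_grad_fst x) XP) (has_gradN YP)).
rewrite (ext_d_grad wE gP kP) (nbhs_singleton wE) /wedge /branch_form /=.
rewrite /l /X; move: st0 h0.
move: (st x) (ss x) (h x) (sr x) x.1 x.2 => st' ss' h' sr' p q st0 h0.
set D := st' - ss' in st0 *.
have hD : h' * D != 0 by rewrite mulf_neq0.
apply: (eq_iff_proportional (k := - (h' * D))); first by rewrite oppr_eq0.
move: hD; rewrite /D in st0 * => hD; field.
by rewrite h0 st0.
Qed.

(* By [normalized_branch], eta - dh / h has coefficients e1 and (e2 + 2) / q, and
   dh / h is closed by the symmetry of the second derivatives of h. *)
Lemma ext_d_normalized (eta : C2 R -> C2 R) h (h1 h2 e1 e2 : C2 R -> C^o) z (u : C) :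
  z.2 != 0 -> differentiable (fun x => (eta x).1 : C^o) z ->
  differentiable (fun x => (eta x).2 : C^o) z ->
  (\forall x \near z, [/\ has_grad h x (h1 x) (h2 x), h x != 0,
      (eta x).1 - h1 x / h x = e1 x & x.2 * ((eta x).2 - h2 x / h x) - 2 = e2 x]) ->
  pgrad e1 z -> has_grad e2 z u 0 ->
  ext_d eta z = u / z.2.
Proof.
move=> z20 /differentiable_has_grad d1 /differentiable_has_grad d2 near_z [v e1P] e2P.
rewrite /ext_d; set m11 := 'D_(1, 0) _ z in d1; set m12 := 'D_(0, 1) _ z in d1.
set m21 := 'D_(1, 0) _ z in d2; set m22 := 'D_(0, 1) _ z in d2.
have [hP h0 E1 E2] := nbhs_singleton near_z.
have hnear : \forall x \near z, has_grad h x (h1 x) (h2 x).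
  by apply: filterS near_z => x [].
have h1E : \forall x \near z, h x * ((eta x).1 - e1 x) = h1 x.
  by apply: filterS near_z => x [_ hx <- _]; field.
have x2 : \forall x \near z, x.2 != 0.
  by apply: cvgr_neq0 (has_grad_continuous (has_grad_snd z)) _.
have h2E : \forall x \near z, h x * ((eta x).2 - (e2 x + 2) * (x.2)^-1) = h2 x.
  by apply: filterS2 x2 near_z => x xne [_ hx _ <-]; field; rewrite xne hx.
have h1P := has_grad_near h1E (has_gradM hP (has_gradD d1 (has_gradN e1P))).
have h2P := has_grad_near h2E (has_gradM hP (has_gradD d2 (has_gradN
  (has_gradM (has_gradD e2P (has_grad_cst 2 z)) (has_gradV (has_grad_snd z) z20))))).
have := mixed_derivatives hnear h1P h2P; rewrite -E1 -E2 /=.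
suff K (m m' h' q k k' g g' : C) : h' != 0 -> q != 0 ->
    k' * (g - (g - k / h')) + h' * (m - 0) = k * (g' - (q * (g' - k' / h') - 2 + 2) / q) +
      h' * (m' - ((u + 0) / q + (q * (g' - k' / h') - 2 + 2) * (- 0 / q ^+ 2))) ->
    m' - m = u / q by exact: (K m12 m21 (h z) z.2 (h1 z) (h2 z) (eta z).1 (eta z).2 h0 z20).
move=> h'0 q0 /eqP; rewrite eq_sym -subr_eq0 => /eqP E.
apply: (mulfI h'0); apply/eqP; rewrite -subr_eq0; apply/eqP.
by rewrite -[RHS]E; field; rewrite h'0 q0.
Qed.

Lemma pgradB f g z : pgrad f z -> pgrad g z -> pgrad (fun x => f x - g x) z.
Proof. by move=> fP /pgradN; exact: pgradD. Qed.

Lemma pgrad_div f g z : pgrad f z -> pgrad g z -> g z != 0 ->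
  pgrad (fun x => f x / g x) z.
Proof. by move=> fP gP g0; exact: pgradM fP (pgradV gP g0). Qed.

Let pgrad_X s z : pgrad s z -> pgrad (fun x => x0 + x1 * s x) z.
Proof. by move=> sP; exact: pgradD (pgrad_cst x0 z) (pgradM (pgrad_cst x1 z) sP). Qed.

Let pgrad_l s z : pgrad s z ->
  pgrad (fun x => x.1 * (x0 + x1 * s x) - (y0 + y1 * s x)) z.
Proof.
move=> sP; apply: pgradB (pgradM (pgrad_fst z) (pgrad_X sP)) _.
exact: pgradD (pgrad_cst y0 z) (pgradM (pgrad_cst y1 z) sP).
Qed.

Lemma pgrad_eta_coef_p (sr ss st vr vs vt : C2 R -> C^o) z :
  pgrad sr z -> pgrad ss z -> pgrad st z -> pgrad vr z -> pgrad vs z -> pgrad vt z ->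
  sr z - ss z != 0 -> st z - sr z != 0 -> ss z - st z != 0 ->
  pgrad (fun x => eta_coef_p x.1 x0 x1 y0 y1 (sr x) (ss x) (st x) (vr x) (vs x) (vt x)) z.
Proof.
move=> srP ssP stP vrP vsP vtP rs tr st_.
have ts : st z - ss z != 0 by rewrite -opprB oppr_eq0.
have rt : sr z - st z != 0 by rewrite -opprB oppr_eq0.
have l1P : pgrad (fun x => x.1 * x1 - y1) z.
  exact: pgradB (pgradM (pgrad_fst z) (pgrad_cst x1 z)) (pgrad_cst y1 z).
have rhsP (s s' t v v' w : C2 R -> C^o) : pgrad s z -> pgrad s' z -> pgrad t z ->
    pgrad v z -> pgrad v' z -> pgrad w z -> t z - s' z != 0 ->
    pgrad (fun x => (w x - v' x) / (t x - s' x) *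
      (x.1 * (x0 + x1 * s x) - (y0 + y1 * s x)) + v x * (x.1 * x1 - y1)) z.
  move=> sP s'P tP vP v'P wP ne; apply: pgradD (pgradM _ (pgrad_l sP)) (pgradM vP l1P).
  exact: pgrad_div (pgradB wP v'P) (pgradB tP s'P) ne.
have P1 := pgradM (pgrad_X ssP) (rhsP _ _ _ _ _ _ srP ssP stP vrP vsP vtP ts).
have P2 := pgradM (pgrad_X srP) (rhsP _ _ _ _ _ _ ssP stP srP vsP vtP vrP rt).
exact: pgrad_div (pgradN (pgradB P1 P2)) (pgradB srP ssP) rs.
Qed.

Lemma pgrad_eta_coef_q (sr ss st vr vs vt : C2 R -> C^o) z :
  pgrad sr z -> pgrad ss z -> pgrad st z -> pgrad vr z -> pgrad vs z -> pgrad vt z ->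
  sr z - ss z != 0 -> st z - sr z != 0 -> ss z - st z != 0 ->
  pgrad (fun x => eta_coef_q x.1 x0 x1 y0 y1 (sr x) (ss x) (st x) (vr x) (vs x) (vt x)) z.
Proof.
move=> srP ssP stP vrP vsP vtP rs tr st_.
have termP (s s' t v : C2 R -> C^o) : pgrad s z -> pgrad s' z -> pgrad t z -> pgrad v z ->
    s z - s' z != 0 -> t z - s z != 0 ->
    pgrad (fun x => v x * (x.1 * (x0 + x1 * s' x) - (y0 + y1 * s' x)) *
      (x.1 * (x0 + x1 * t x) - (y0 + y1 * t x)) / ((s x - s' x) * (s x - t x))) z.
  move=> sP s'P tP vP ne ne'.
  apply: pgrad_div (pgradM (pgradM vP (pgrad_l s'P)) (pgrad_l tP)) _ _.
    exact: pgradM (pgradB sP s'P) (pgradB sP tP).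
  by rewrite mulf_neq0// -opprB oppr_eq0.
have P1 := termP _ _ _ _ srP ssP stP vrP rs tr.
have P2 := termP _ _ _ _ ssP stP srP vsP st_ rs.
have P3 := termP _ _ _ _ stP srP ssP vtP tr st_.
exact: pgradN (pgradD (pgradD P1 P2) P3).
Qed.

End NormalForm.

Section ExteriorDerivative.
Context (R : realType).
Notation C := R[i].
Implicit Types (w al be : C2 R -> C2 R) (z : C2 R).

Lemma differentiable_fst w z : differentiable w z ->
  differentiable (fun x => (w x).1 : C^o) z.
Proof. by move=> dw; exact: differentiable_comp dw (has_grad_fst _).1. Qed.

Lemma differentiable_snd w z : differentiable w z ->
  differentiable (fun x => (w x).2 : C^o) z.
Proof. by move=> dw; exact: differentiable_comp dw (has_grad_snd _).1. Qed.

Lemma ext_d_add al be z : differentiable al z -> differentiable be z ->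
  ext_d (fun x => al x + be x) z = ext_d al z + ext_d be z.
Proof.
move=> dal dbe; rewrite /ext_d.
have a1 := differentiable_has_grad (differentiable_fst dal).
have a2 := differentiable_has_grad (differentiable_snd dal).
have b1 := differentiable_has_grad (differentiable_fst dbe).
have b2 := differentiable_has_grad (differentiable_snd dbe).
rewrite (has_grad_derive (has_gradD a1 b1)).2 (has_grad_derive (has_gradD a2 b2)).1.
by rewrite opprD addrACA.
Qed.

Lemma ext_d_sum (I : Type) (r : seq I) (P : pred I) (F : I -> C2 R -> C2 R) z :
  (forall i, P i -> differentiable (F i) z) ->
  differentiable (fun x => \sum_(i <- r | P i) F i x) z /\
  ext_d (fun x => \sum_(i <- r | P i) F i x) z = \sum_(i <- r | P i) ext_d (F i) z.
Proof.
move=> FP; elim: r => [|i r [IH1 IH2]].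
  have -> : (fun x => \sum_(i <- [::] | P i) F i x) = fun=> 0.
    by apply/funext => x; rewrite big_nil.
  split; first exact: differentiable_cst.
  rewrite big_nil /ext_d (has_grad_derive (has_grad_cst 0 z)).1.
  by rewrite (has_grad_derive (has_grad_cst 0 z)).2 subrr.
rewrite big_cons; case: (boolP (P i)) => Pi.
  have -> : (fun x => \sum_(j <- i :: r | P j) F j x) =
      (fun x => F i x + \sum_(j <- r | P j) F j x).
    by apply/funext => x; rewrite big_cons Pi.
  split; first exact: differentiableD (FP i Pi) IH1.
  by rewrite ext_d_add ?IH2//; exact: FP.
have -> // : (fun x => \sum_(j <- i :: r | P j) F j x) =
    (fun x => \sum_(j <- r | P j) F j x).
by apply/funext => x; rewrite big_cons (negbTE Pi).
Qed.

End ExteriorDerivative.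

Section LocalBranches.
Context (R : realType).
Notation C := R[i].
Variables (d : nat) (a b : {poly C}) (c x0 x1 y0 y1 : C).
Hypothesis c0 : c != 0.
Implicit Types (z x : C2 R) (s : 'I_d -> C2 R -> C^o).

(** The derivative in p of a root of a + p b, by implicit differentiation. *)
Definition velocity (f : C2 R -> C^o) x : C^o := - b.[f x] / (a + x.1 *: b)^`().[f x].

(* Up to closed forms, eta(W) = e dp + (web_sum / q) dq, where e does not depend
   on q. *)
Definition web_sum s x : C^o :=
  \sum_(r < d) \sum_(i < d | (r < i)%N) \sum_(k < d | (i < k)%N)
    eta_coef_q x.1 x0 x1 y0 y1 (s r x) (s i x) (s k x)
      (velocity (s r) x) (velocity (s i) x) (velocity (s k) x).

(** Only continuity is asked of a labelling of the roots, but at every point near z; [implicit_root]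
    upgrades it to differentiability. *)
Definition branches s z := \forall x \near z,
  [/\ splits a b c x.1 (s^~ x), injective (s^~ x)
    & forall r, {for x, continuous (s r)}].

Lemma simple_root p (s : 'I_d -> C) r : splits a b c p s -> injective s ->
  (a + p *: b)^`().[s r] != 0.
Proof.
move=> sP sinj; have sr i : i != r -> s r != s i.
  by move=> ir; apply: contra_neq ir => /sinj.
rewrite sP; have [-> _ _] := horner_derivs_at_root c sr.
rewrite mulf_neq0//; apply/prodf_neq0 => i ir; rewrite subr_eq0; exact: sr.
Qed.

Lemma branches_grad s z : branches s z -> forall r,
  has_grad (s r) z (velocity (s r) z) 0.
Proof.
move=> sP r; have [sz sinj sc] := nbhs_singleton sP.
apply: implicit_root => //; last exact: (simple_root (s := s^~ z)).
by apply: filterS sP => x [sx _ _]; exact: splits_root sx.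
Qed.

Lemma pgrad_velocity (f : C2 R -> C^o) z : pgrad f z ->
  (a + z.1 *: b)^`().[f z] != 0 -> pgrad (velocity f) z.
Proof.
move=> fP simple.
have E x : (a + x.1 *: b)^`().[f x] = a^`().[f x] + x.1 * b^`().[f x].
  by rewrite derivD derivZ hornerD hornerZ.
rewrite (_ : velocity f = fun x => - b.[f x] / (a^`().[f x] + x.1 * b^`().[f x])).
  apply: pgrad_div; first exact: (pgradN (pgrad_horner b fP)).
    exact: pgradD (pgrad_horner _ fP) (pgradM (pgrad_fst z) (pgrad_horner _ fP)).
  by rewrite -E.
by apply/funext => x; rewrite /velocity E.
Qed.

Lemma branches_eta_grad s z : branches s z -> forall r i k : 'I_d,
  (r < i)%N -> (i < k)%N ->
  pgrad (fun x => eta_coef_p x.1 x0 x1 y0 y1 (s r x) (s i x) (s k x)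
    (velocity (s r) x) (velocity (s i) x) (velocity (s k) x)) z /\
  pgrad (fun x => eta_coef_q x.1 x0 x1 y0 y1 (s r x) (s i x) (s k x)
    (velocity (s r) x) (velocity (s i) x) (velocity (s k) x)) z.
Proof.
move=> sP r i k ri ik.
have sgr j : pgrad (s j) z by exists (velocity (s j) z); exact: branches_grad.
have [sz sinj _] := nbhs_singleton sP.
have vgr j : pgrad (velocity (s j)) z by apply: pgrad_velocity => //; exact: (simple_root (s := s^~ z)).
have ne (j l : 'I_d) : (j < l)%N -> s j z - s l z != 0 /\ s l z - s j z != 0.
  move=> jl; have jl' : s j z != s l z.
    by apply/eqP => /sinj jlE; rewrite jlE ltnn in jl.
  by split; rewrite subr_eq0 // eq_sym.
have [n1 _] := ne _ _ ri; have [n2 _] := ne _ _ ik.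
have [_ n3] := ne _ _ (ltn_trans ri ik).
by split; [exact: pgrad_eta_coef_p | exact: pgrad_eta_coef_q].
Qed.

Lemma branches_web_sum s z : branches s z ->
  has_grad (web_sum s) z (\sum_(r < d) \sum_(i < d | (r < i)%N) \sum_(k < d | (i < k)%N)
    'D_((1, 0) : C2 R) (fun x => eta_coef_q x.1 x0 x1 y0 y1 (s r x) (s i x) (s k x)
      (velocity (s r) x) (velocity (s i) x) (velocity (s k) x) : C^o) z) 0.
Proof.
move=> sP; apply: has_grad_eq.
- apply: has_grad_sum => r _; apply: has_grad_sum => i ri; apply: has_grad_sum => k ik.
  have [_ [v vP]] := branches_eta_grad sP ri ik.
  by have := vP; rewrite -(has_grad_derive vP).1; exact.
- by [].
- by rewrite /= big1// => r _; rewrite big1// => i _; rewrite big1.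
Qed.

End LocalBranches.

Lemma separation (C : numFieldType) (I : finType) (sg : I -> C) : injective sg ->
  exists2 e : C, 0 < e & forall i j, i != j -> e + e <= `|sg i - sg j|.
Proof.
(* S exceeds the inverse of every distance, so 1 / S replaces a minimum of distances; the 1 keeps S
   positive when there are no pairs. *)
move=> sginj; pose S : C := 1 + \sum_(ij : I * I | ij.1 != ij.2) `|sg ij.1 - sg ij.2|^-1.
have S0 : 0 < S.
  by rewrite ltr_pwDl ?ltr01// sumr_ge0// => ij _; rewrite invr_ge0.
exists (S^-1 / 2); first by rewrite divr_gt0// invr_gt0.
move=> i j ij; have d0 : 0 < `|sg i - sg j|.
  by rewrite normr_gt0 subr_eq0; apply: contra_neq ij => /sginj.
have -> : S^-1 / 2 + S^-1 / 2 = S^-1 by rewrite -mulrDl -mulr2n -[_ *+ 2]mulr_natr mulfK// pnatr_eq0.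
rewrite -[leRHS]invrK lef_pV2 ?posrE ?invr_gt0//.
rewrite /S (bigD1 (i, j))//= addrCA lerDl addr_ge0 ?ler01// sumr_ge0//.
Qed.

Lemma line_component_disc (R : realType) (d : nat) (F : implicit_eq R) p0 (z : C2 R) :
  line_in_disc d F p0 -> ev (web_disc d F) z.1 z.2 != 0 -> z.1 != p0.
Proof.
move=> [S ->]; apply: contra_neq => zp.
by rewrite /ev mevalM mevalB mevalXU mevalC /= (tnth_nth 0) /= zp subrr mul0r.
Qed.

(** * Curvature near the line p = p0 *)

Section LegendreCurvature.
Context (R : realType).
Notation C := R[i].
Variables (d : nat) (A B : bipoly R).
Hypotheses (hA : A \is ishomog1 d mdeg) (hB : B \is ishomog1 d mdeg).
Hypothesis no_common_zero : forall u v, eval2 A u v = 0 -> eval2 B u v = 0 -> u = 0 /\ v = 0.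
Variables (x0 x1 y0 y1 : C).
Hypotheses (det1 : x0 * y1 - x1 * y0 = 1) (B_inf : eval2 B x1 y1 = 0).
Let a := line_poly x0 x1 y0 y1 A.
Let b := line_poly x0 x1 y0 y1 B.
Let c := eval2 A x1 y1.
Let c0 : c != 0 := lead_coef_neq0 no_common_zero det1 B_inf.

(* (X, Y) is then proportional to (x0 + x1 s, y0 + y1 s), for a root s of the
   polynomial a + p b. *)
Lemma branch_of_direction p X Y : (X, Y) != (0, 0) ->
  eval2 A X Y + p * eval2 B X Y = 0 ->
  X * y1 - Y * x1 != 0 /\ (a + p *: b).[(x0 * Y - y0 * X) / (X * y1 - Y * x1)] = 0.
Proof.
move=> XY0 E; have [s sP] := splits_exists hA hB no_common_zero det1 B_inf p.
have [XE YE] := coords det1 X Y.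
set al := X * y1 - Y * x1 in XE YE *; set ga := x0 * Y - y0 * X in XE YE *.
move/eqP: E; rewrite (form_factor hA hB det1 B_inf X Y sP) mulf_eq0 (negbTE c0) /=.
move=> /prodf_eq0[r _ /eqP Er].
have gaE : ga = s r * al.
  apply/eqP; rewrite -subr_eq0 -[X in _ == X]Er; apply/eqP; rewrite /ga /al; ring.
have al0 : al != 0.
  apply/eqP => al0; move: XY0; rewrite XE YE gaE al0 !(mulr0, addr0).
  by rewrite eqxx.
by split=> //; rewrite gaE mulfK//; exact: splits_root sP.
Qed.

Lemma splits_of_roots p (s : 'I_d -> C) : injective s ->
  (forall r, (a + p *: b).[s r] = 0) -> splits a b c p s.
Proof.
move=> sinj sroot; have [sz lc] := size_pencil hA hB no_common_zero det1 B_inf p.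
rewrite /splits (@all_roots_prod_XsubC _ (a + p *: b) [seq s r | r <- enum 'I_d]).
- by rewrite lc big_map enumT.
- by rewrite sz size_map size_enum_ord.
- by apply/allP => _ /mapP[r _ ->]; apply/rootP; exact: sroot.
- by rewrite uniq_rootsE map_inj_uniq ?enum_uniq.
Qed.

Section Superposition.
Variables (U : set (C2 R)) (w : 'I_d -> C2 R -> C2 R).
Hypothesis hw : superposition (Leg A B) U w.

(** On the vector (w.2, - w.1), tangent to the i-th leaf, X is dq and Y is p dq - q dp: the
    direction of the point with x = dq / dp and y = p x - q. *)
Let X i (x : C2 R) : C^o := - (w i x).1.
Let Y i (x : C2 R) : C^o := x.1 * - (w i x).1 - x.2 * (w i x).2.
Let al i x : C^o := X i x * y1 - Y i x * x1.
Definition branch_of i x : C^o := (x0 * Y i x - y0 * X i x) / al i x.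
Definition factor_of i x : C^o := al i x / x.2.

Let XY_neq0 i x : U x -> x.2 != 0 -> (X i x, Y i x) != (0, 0).
Proof.
move=> Ux x2; have [_ w0 _ _] := hw; apply/eqP => -[/eqP X0 /eqP Y0].
case/negP: (w0 i x Ux); move: Y0.
rewrite /X in X0; rewrite /Y (eqP X0) mulr0 add0r oppr_eq0 mulf_eq0 (negbTE x2) /=.
move: X0; rewrite oppr_eq0 => /eqP w1 /eqP w2; apply/eqP.
by case: (w i x) w1 w2 => w1' w2' /= -> ->.
Qed.

Let XY_root i x : U x -> eval2 A (X i x) (Y i x) + x.1 * eval2 B (X i x) (Y i x) = 0.
Proof.
move=> Ux; have [_ _ _ [g [_ _ gP]]] := hw.
have := gP x ((w i x).2, - (w i x).1) Ux; rewrite sym_formE//= => ->.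
apply/eqP; rewrite mulf_eq0; apply/orP; right; apply/prodf_eq0; exists i => //.
by apply/eqP; ring.
Qed.

(** The 1-forms of any superposition are in the normal form [branch_form], so the curvature is
    computed for all choices of them at once. *)
Lemma branch_ofP i x : U x -> x.2 != 0 ->
  [/\ factor_of i x != 0, w i x = branch_form x0 x1 y0 y1 (factor_of i) (branch_of i) x
    & (a + x.1 *: b).[branch_of i x] = 0].
Proof.
move=> Ux x2; have [al0 sroot] := branch_of_direction (XY_neq0 i Ux x2) (XY_root i Ux).
have [XE YE] := coords det1 (X i x) (Y i x).
split=> //; first by rewrite mulf_neq0 ?invr_eq0.
rewrite /branch_form /factor_of /branch_of -/(al i x) in al0 XE YE *.
have EX : al i x * (x0 + x1 * ((x0 * Y i x - y0 * X i x) / al i x)) = X i x.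
  by rewrite [RHS]XE; field.
have EY : al i x * (y0 + y1 * ((x0 * Y i x - y0 * X i x) / al i x)) = Y i x.
  by rewrite [RHS]YE; field.
rewrite [LHS]surjective_pairing; congr pair.
  by rewrite mulfVK// EX /X opprK.
rewrite mulrBr; set u := _ / x.2.
have -> : u * (x.1 * (x0 + x1 * ((x0 * Y i x - y0 * X i x) / al i x))) = x.1 * X i x / x.2.
  by rewrite -[in RHS]EX /u; ring.
have -> : u * (y0 + y1 * ((x0 * Y i x - y0 * X i x) / al i x)) = Y i x / x.2.
  by rewrite -[in RHS]EY /u; ring.
by rewrite /X /Y; field.
Qed.

Lemma branch_of_differentiable i x : U x -> x.2 != 0 ->
  differentiable (branch_of i) x /\ differentiable (factor_of i) x.
Proof.
move=> Ux x2; have [al0 _] := branch_of_direction (XY_neq0 i Ux x2) (XY_root i Ux).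
have [hol _ _ _] := hw; have dw := hol i x Ux.
have W1 := differentiable_has_grad (differentiable_fst dw).
have W2 := differentiable_has_grad (differentiable_snd dw).
have XP : has_grad (X i) x _ _ := has_gradN W1.
have YP : has_grad (Y i) x _ _ :=
  has_gradD (has_gradM (has_grad_fst x) XP) (has_gradN (has_gradM (has_grad_snd x) W2)).
have alP : has_grad (al i) x _ _ :=
  has_gradD (has_gradM XP (has_grad_cst y1 x)) (has_gradN (has_gradM YP (has_grad_cst x1 x))).
split; last exact: (has_gradM alP (has_gradV (has_grad_snd x) x2)).1.
exact: (has_gradM (has_gradD (has_gradM (has_grad_cst x0 x) YP)
  (has_gradN (has_gradM (has_grad_cst y0 x) XP))) (has_gradV alP al0)).1.
Qed.

Lemma branch_of_inj x : U x -> x.2 != 0 -> injective (branch_of^~ x).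
Proof.
move=> Ux x2 i j E; apply/eqP; apply: contraT => ij.
have [_ _ wd _] := hw; have := wd i j x Ux ij.
have [_ -> _] := branch_ofP i Ux x2; have [_ -> _] := branch_ofP j Ux x2.
by rewrite wedge_branch_form// [branch_of i x]E subrr mulr0 eqxx.
Qed.

End Superposition.
Let bf := branch_form x0 x1 y0 y1.

(** The factor f1 f2 f3 q is symmetric in the three leaves, which is why one function h serves for
    the three normalizing equations. *)
Lemma delta_branch_form (f1 f2 f3 s1 s2 s3 : C2 R -> C^o) x :
  (wedge (bf f2 s2 x) (bf f3 s3 x) : C) *: bf f1 s1 x =
  bf (fun y => f1 y * f2 y * f3 y * y.2 * (s3 y - s2 y)) s1 x.
Proof.
rewrite wedge_branch_form// /bf /branch_form.
by congr pair; rewrite /= /GRing.scale /=; ring.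
Qed.

(** Two of the three normalizing equations already determine eta_rst - dh / h in terms of the
    branches, so no freedom is left in the value of the curvature. *)
Lemma curvature_branches z k : curvature_at d (Leg A B) z k -> z.2 != 0 ->
  exists2 s : 'I_d -> C2 R -> C^o, branches a b c s z &
    exists2 u, has_grad (web_sum a b x0 x1 y0 y1 s) z u 0 & k = u / z.2.
Proof.
move=> [U [w [eta [[oU Uz] hw hn ->]]]] z2.
pose s := branch_of w; pose f := factor_of w.
have nearU x : U x -> x.2 != 0 -> \forall y \near x, U y /\ y.2 != 0.
  move=> Ux x2; have h1 : \forall y \near x, U y by exact: open_nbhs_nbhs.
  have h2 : \forall y \near x, y.2 != 0.
    by apply: cvgr_neq0 (has_grad_continuous (has_grad_snd x)) _.
  by apply: filterS2 h1 h2.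
have wE i x : U x -> x.2 != 0 -> w i x = bf (f i) (s i) x.
  by move=> Ux x2; have [_ -> _] := branch_ofP hw i Ux x2.
have f0 i x : U x -> x.2 != 0 -> f i x != 0.
  by move=> Ux x2; have [-> _ _] := branch_ofP hw i Ux x2.
have df i x : U x -> x.2 != 0 -> differentiable (s i) x /\ differentiable (f i) x.
  exact: (branch_of_differentiable hw).
have sbr x : U x -> x.2 != 0 -> branches a b c s x.
  move=> Ux x2; apply: filterS (nearU x Ux x2) => y [Uy y2].
  have sinj := branch_of_inj hw Uy y2.
  split=> //; last by move=> r; have [/differentiable_continuous] := df r y Uy y2.
  apply: splits_of_roots => // r.
  by have [_ _] := branch_ofP hw r Uy y2.
exists s; first exact: sbr.
have hg := branches_web_sum x0 x1 y0 y1 c0 (sbr z Uz z2).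
eexists; first exact: hg.
clear hg.
have deta (r i j : 'I_d) : (r < i)%N -> (i < j)%N -> differentiable (eta r i j) z.
  by move=> ri ij; have [+ _ _ _] := hn r i j ri ij; exact.
rewrite (ext_d_sum _ _).2; last first.
  move=> r _; apply: (ext_d_sum _ _).1 => i ri; apply: (ext_d_sum _ _).1 => j ij; exact: deta.
rewrite mulr_suml; apply: eq_bigr => r _.
rewrite (ext_d_sum _ _).2; last first.
  move=> i ri; apply: (ext_d_sum _ _).1 => j ij; exact: deta.
rewrite mulr_suml; apply: eq_bigr => i ri.
rewrite (ext_d_sum _ _).2; last first.
  by move=> j ij; exact: deta.
rewrite mulr_suml; apply: eq_bigr => j ij.
pose h y : C^o := f r y * f i y * f j y * y.2.
pose v l := velocity a b (s l).
have [[e1 e1P] [e2 e2P]] := branches_eta_grad x0 x1 y0 y1 c0 (sbr z Uz z2) ri ij.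
rewrite (has_grad_derive e2P).1.
apply: (@ext_d_normalized _ _ h (fun y => 'D_((1, 0) : C2 R) h y)
  (fun y => 'D_((0, 1) : C2 R) h y) _ _ z e2 z2 _ _ _ (ex_intro _ e1 e1P) e2P).
- exact/differentiable_fst/deta.
- exact/differentiable_snd/deta.
apply: filterS (nearU z Uz z2) => y [Uy y2].
have hP : has_grad h y ('D_((1, 0) : C2 R) h y) ('D_((0, 1) : C2 R) h y).
  apply: differentiable_has_grad.
  apply: differentiableM; last exact: (has_grad_snd y).1.
  apply: differentiableM; last by case: (df j y Uy y2).
  by apply: differentiableM; [case: (df r y Uy y2) | case: (df i y Uy y2)].
have h0 : h y != 0.
  exact: mulf_neq0 (mulf_neq0 (mulf_neq0 (f0 r y Uy y2) (f0 i y Uy y2)) (f0 j y Uy y2)) y2.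
have sg l := branches_grad c0 (sbr y Uy y2) l.
have sinj := branch_of_inj hw Uy y2.
have ne (l l' : 'I_d) : (l < l')%N -> s l y - s l' y != 0 /\ s l' y - s l y != 0.
  move=> ll'; have sl : s l y != s l' y.
    by apply/eqP => /sinj lE; rewrite lE ltnn in ll'.
  by split; rewrite subr_eq0// eq_sym.
have [n1 n1'] := ne _ _ ri; have [n2 n2'] := ne _ _ ij.
have [n3 n3'] := ne _ _ (ltn_trans ri ij).
have [_ N1 N2 _] := hn r i j ri ij.
have E1 : \forall x \near y, (wedge (w i x) (w j x) : C) *: w r x =
    bf (fun x => h x * (s j x - s i x)) (s r) x.
  apply: filterS (nearU y Uy y2) => x [Ux x2].
  by rewrite !wE// delta_branch_form.
have E2 : \forall x \near y, (wedge (w j x) (w r x) : C) *: w i x =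
    bf (fun x => h x * (s r x - s j x)) (s i) x.
  apply: filterS (nearU y Uy y2) => x [Ux x2].
  rewrite !wE// delta_branch_form /bf /branch_form /h.
  by congr pair; ring.
have /(normalized_branch (eta r i j y) (sg r) (sg i) (sg j) hP h0 n2' E1) S1 := N1 y Uy.
have /(normalized_branch (eta r i j y) (sg i) (sg j) (sg r) hP h0 n3 E2) S2 := N2 y Uy.
by have [] := eta_system_unique det1 n1 n3' n2 S1 S2; split.
Qed.

(* The product of the distances from t to the roots of a + p' b is
   |p' - p| |b(t)| / |c| when t is a root of a + p b. *)
Lemma near_root (z : C2 R) (t e : C) : (a + z.1 *: b).[t] = 0 -> 0 < e ->
  \forall x \near z, exists2 y, (a + x.1 *: b).[y] = 0 & `|t - y| < e.
Proof.
move=> t0 e0; have r0 : 0 < `|c| * e ^+ d.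
  by rewrite mulr_gt0 ?normr_gt0// exprn_gt0.
have hc : (fun x : C2 R => (x.1 - z.1) * b.[t] : C^o) x @[x --> z] --> (0 : C^o).
  have := has_grad_continuous (has_gradM (has_gradD (has_grad_fst z)
    (has_grad_cst (- z.1) z)) (has_grad_cst b.[t] z)).
  by rewrite /prop_for /continuous_at subrr mul0r.
have hr : \forall x \near z, `|((x.1 - z.1) * b.[t] : C^o)| < `|c| * e ^+ d.
  exact: (@cvgr0_norm_lt _ _ _ (nbhs z) _ _ hc _ r0).
apply: filterS hr => x xr.
have [s sP] := splits_exists hA hB no_common_zero det1 B_inf x.1.
have [/existsP[j je]|/existsPn none] := boolP [exists j, `|t - s j| < e].
  by exists (s j) => //; exact: splits_root sP.
move: xr; have -> : (x.1 - z.1) * b.[t] = (a + x.1 *: b).[t].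
  by rewrite -[RHS]subr0 -t0 !hornerD !hornerZ; ring.
rewrite sP hornerZ horner_prod normrM normr_prod ltr_pM2l ?normr_gt0//.
move=> /lt_geF/negP[]; have -> : e ^+ d = \prod_(r < d) e by rewrite prodr_const card_ord.
apply: ler_prod => r _; rewrite ltW//= hornerXsubC.
by have := none r; rewrite -real_leNgt// ?normr_real// gtr0_real.
Qed.

(** The discs of radius e around the sg r are disjoint and, near z, each contains a root, which
    [xget] selects; these are all the roots. For the continuity at x, [near_root] finds a root close
    to s r x, hence in the same disc, hence the selected one. *)
Lemma local_branches z (sg : 'I_d -> C) : splits a b c z.1 sg -> injective sg ->
  exists s : 'I_d -> C2 R -> C^o, branches a b c s z.
Proof.
move=> sgP sginj; have [e e0 eP] := separation sginj.
pose P (r : 'I_d) (x : C2 R) : set C := [set y | (a + x.1 *: b).[y] = 0 /\ `|sg r - y| < e].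
pose s r x : C^o := xget (0 : C) (P r x).
have close r j y : `|sg r - y| < e -> `|sg j - y| < e -> r = j.
  move=> ry jy; apply/eqP; apply: contraT => rj.
  suff : `|sg r - sg j| < `|sg r - sg j| by rewrite ltxx.
  apply: lt_le_trans (eP r j rj); rewrite -[sg r - sg j](subrKA y).
  rewrite -[y - _]opprB; apply: le_lt_trans (ler_normB _ _) _; exact: ltrD.
have sP : \forall x \near z, forall r, P r x (s r x).
  refine (@filter_forall _ _ (fun r => [set x | P r x (s r x)]) (nbhs z) _ _) => r.
  have := near_root (splits_root r sgP) e0; apply: filterS => x [y y1' y2].
  by apply: (@xgetPex _ (0 : C) (P r x)); exists y.
have splitsP x : (forall r, P r x (s r x)) -> injective (s^~ x) /\ splits a b c x.1 (s^~ x).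
  move=> sx; have sinj : injective (s^~ x).
    move=> i j ij; apply: (close i j (s i x)); first exact: (sx i).2.
    by rewrite [s i x]ij; exact: (sx j).2.
  split=> //; apply: (splits_of_roots) => // r.
  exact: (sx r).1.
exists s; apply: filterS (nbhs_interior sP) => x sPx.
have sx := nbhs_singleton sPx; have [sinj sspl] := splitsP x sx.
split=> // r; apply/cvgrPdist_lt => k k0.
have [root_x near_x] := sx r.
have h0 : 0 < e - `|sg r - s r x| by rewrite subr_gt0.
have [h hE] : exists h, h = e - `|sg r - s r x| by exists (e - `|sg r - s r x|).
rewrite -hE in h0.
(* m is below both k and h, where h is the distance from s r x to the boundary of the disc; it plays
   the part of their minimum. *)
pose m := k * h / (k + h).
have kh0 : 0 < k + h by exact: addr_gt0.
have m0 : 0 < m by rewrite divr_gt0// mulr_gt0.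
have mk : m < k by rewrite ltr_pdivrMr// [k * (k + h)]mulrDr ltrDr mulr_gt0.
have mh : m < h by rewrite ltr_pdivrMr// [h * (k + h)]mulrDr [k * h]mulrC ltrDl mulr_gt0.
apply: filterS2 sPx (near_root root_x m0) => x' sx' [y yroot ym].
have yr : `|sg r - y| < e.
  rewrite -[sg r - y](subrKA (s r x)); apply: le_lt_trans (ler_normD _ _) _.
  by rewrite -ltrBrDl -hE; exact: lt_trans ym mh.
have [sinj' sspl'] := splitsP x' sx'.
have [j yj] : exists j, y = s j x'.
  move/eqP: yroot; rewrite sspl' hornerZ horner_prod mulf_eq0 (negbTE c0) /=.
  move=> /prodf_eq0[j _]; rewrite hornerXsubC subr_eq0 => /eqP ->.
  by exists j.
have rj : r = j by apply: close yr _; rewrite yj; exact: (sx' j).2.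
by rewrite rj -yj -rj; exact: lt_trans ym mk.
Qed.

(** The normal forms with factor 1 define the web, and [eta_system] provides the forms eta_rst. *)
Lemma curvature_exists (s : 'I_d -> C2 R -> C^o) z : branches a b c s z -> z.2 != 0 ->
  exists k, curvature_at d (Leg A B) z k.
Proof.
move=> sz z2.
pose S : set (C2 R) := [set x | [/\ splits a b c x.1 (s^~ x), injective (s^~ x)
    & forall r, {for x, continuous (s r)}] /\ x.2 != 0].
have nearS : nbhs z S.
  have h2 : \forall y \near z, y.2 != 0.
    by apply: cvgr_neq0 (has_grad_continuous (has_grad_snd z)) _.
  by apply: filterS2 sz h2.
have sbr x : S^° x -> branches a b c s x by apply: filterS => y [].
have x2 x : S^° x -> x.2 != 0 by move/nbhs_singleton => [].
have near2 x : S^° x -> \forall y \near x, y.2 != 0 by apply: filterS => y [].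
pose one : C2 R -> C^o := fun=> 1.
pose w r := branch_form x0 x1 y0 y1 one (s r).
pose v r := velocity a b (s r).
pose e1 r i k x : C^o := eta_coef_p x.1 x0 x1 y0 y1 (s r x) (s i x) (s k x) (v r x) (v i x) (v k x).
pose e2 r i k x : C^o := eta_coef_q x.1 x0 x1 y0 y1 (s r x) (s i x) (s k x) (v r x) (v i x) (v k x).
(* With factor 1 the common factor h is q, so eta = e1 dp + (e2 + 2) / q dq + dq / q: hence the
   3. *)
pose eta r i k x : C2 R := (e1 r i k x, (e2 r i k x + 3) * (x.2)^-1).
have sinj x : S^° x -> injective (s^~ x) by move/nbhs_singleton => [[]].
eexists; exists S^°, w, eta; split; last by reflexivity.
- by split; [exact: open_interior | exact: nearS].
- split.
  + move=> r x Sx; have sP := branches_grad c0 (sbr x Sx) r.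
    have f1 := has_grad_cst 1 x; have XP := has_grad_X x0 x1 sP.
    have YP := has_grad_X y0 y1 sP.
    apply: differentiable_pair.
      exact: (has_gradN (has_gradM (has_gradM f1 (has_grad_snd x)) XP)).1.
    exact: (has_gradM f1 (has_gradD (has_gradM (has_grad_fst x) XP) (has_gradN YP))).1.
  + by move=> r x Sx; apply: branch_form_neq0 => //; [exact: oner_neq0 | exact: x2].
  + move=> r i x Sx ri; rewrite wedge_branch_form// /one !mul1r mulf_neq0 ?x2//.
    by rewrite subr_eq0 eq_sym; apply: contra_neq ri; exact: sinj.
  + exists (fun=> c : C^o); split=> [x _|//|x t Sx]; first exact: differentiable_cst.
    have [[sx _ _] _] := nbhs_singleton Sx.
    rewrite sym_formE// (form_factor hA hB det1 B_inf _ _ sx); congr (_ * _).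
    by apply: eq_bigr => r _; rewrite /w /branch_form /one /=; ring.
- move=> r i k ri ik.
  have N x : S^° x ->
      let nrm l1 l2 l3 := let al y := (wedge (w l2 y) (w l3 y) : C) *: w l1 y in
        ext_d al x = wedge (eta r i k x) (al x) in
      [/\ nrm r i k, nrm i k r & nrm k r i].
    move=> Sx nrm; have sg l := branches_grad c0 (sbr x Sx) l.
    have ne (l l' : 'I_d) : (l < l')%N -> s l x - s l' x != 0 /\ s l' x - s l x != 0.
      move=> ll'; have sl : s l x != s l' x.
        by apply/eqP => /(sinj x Sx) lE; rewrite lE ltnn in ll'.
      by split; rewrite subr_eq0// eq_sym.
    have [n1 n1'] := ne _ _ ri; have [n2 n2'] := ne _ _ ik.
    have [n3 n3'] := ne _ _ (ltn_trans ri ik).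
    have [S1 S2 S3] := @eta_system _ x.1 _ _ _ _ det1 _ _ _ (v r x) (v i x) (v k x) n1 n3' n2.
    pose h y : C^o := one y * one y * one y * y.2.
    have hP : has_grad h x 0 1.
      by apply: has_grad_ext (has_grad_snd x) => y; rewrite /h /one !mul1r.
    have h0 : h x != 0 by rewrite /h /one !mul1r x2.
    have hx : h x = x.2 by rewrite /h /one !mul1r.
    have xne := x2 x Sx.
    have wE l1 l2 l3 : \forall y \near x, (wedge (w l2 y) (w l3 y) : C) *: w l1 y =
      branch_form x0 x1 y0 y1 (fun y => h y * (s l3 y - s l2 y)) (s l1) y.
      by apply: filterS (near2 x Sx) => y _; exact: delta_branch_form.
    have E2 e l : (x.2 * ((e + 3) / x.2 - 1 / x.2) - 2) * l = e * l :> C.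
      by congr (_ * _); move: x.2 xne => q q0; field.
    rewrite /nrm; split.
    - apply/(normalized_branch (eta r i k x) (sg r) (sg i) (sg k) hP h0 n2' (wE r i k)).
      by rewrite -[RHS]S1 hx /eta /= mul0r subr0 E2.
    - apply/(normalized_branch (eta r i k x) (sg i) (sg k) (sg r) hP h0 n3 (wE i k r)).
      by rewrite -[RHS]S2 hx /eta /= mul0r subr0 E2.
    - apply/(normalized_branch (eta r i k x) (sg k) (sg r) (sg i) hP h0 n1' (wE k r i)).
      by rewrite -[RHS]S3 hx /eta /= mul0r subr0 E2.
  split.
  + move=> x Sx; have [[u1 e1P] [u2 e2P]] := branches_eta_grad x0 x1 y0 y1 c0 (sbr x Sx) ri ik.
    apply: differentiable_pair; first exact: e1P.1.
    exact: (has_gradM (has_gradD e2P (has_grad_cst 3 x)) (has_gradV (has_grad_snd x) (x2 x Sx))).1.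
  + by move=> x Sx; have [] := N x Sx.
  + by move=> x Sx; have [] := N x Sx.
  + by move=> x Sx; have [] := N x Sx.
Qed.

(** The quotient rule for 6 beta = N / G, multiplied by G^2 so that the relation keeps a meaning at
    the zeros of G. *)
Lemma curvature_value (N G : {poly C}) z k :
  curvature_at d (Leg A B) z k -> z.2 != 0 ->
  (\forall x \near z, forall s : 'I_d -> C, splits a b c x.1 s ->
     G.[x.1] * web_trace a b x0 x1 y0 y1 x.1 s = N.[x.1]) ->
  6 * (k * z.2) * G.[z.1] ^+ 2 = N^`().[z.1] * G.[z.1] - N.[z.1] * G^`().[z.1].
Proof.
move=> kz z2 NG.
have [s sz [u uP ->]] := curvature_branches kz z2.
rewrite mulfVK//.
have E : \forall x \near z, 6 * web_sum a b x0 x1 y0 y1 s x * G.[x.1] = N.[x.1].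
  apply: filterS2 sz NG => x [sx sinj _] /(_ _ sx) <-.
  by rewrite mulrC -(sum_eta_coef x0 x1 y0 y1 c0 sx sinj).
have P1 := has_grad_near E (has_gradM (has_gradM (has_grad_cst 6 z) uP)
  (has_grad_horner G (has_grad_fst z))).
have [D1 _] := has_grad_derive P1.
have [D2 _] := has_grad_derive (has_grad_horner N (has_grad_fst z)).
move: D1; rewrite D2 -(nbhs_singleton E) mul0r add0r !mul1r => ->.
ring.
Qed.

Variables (p0 : C) (N D : {poly C}).
Hypothesis D0 : D.[p0] != 0.
Hypothesis polar : forall (p : C) (s : 'I_d -> C), p != p0 -> splits a b c p s ->
  D.[p] != 0 ->
  injective s /\ (p - p0) * web_trace a b x0 x1 y0 y1 p s = N.[p] / D.[p].

Let near_neq0 (f : C2 R -> C^o) z u v : has_grad f z u v -> f z != 0 ->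
  \forall x \near z, f x != 0.
Proof. by move=> fP f0; apply: cvgr_neq0 (has_grad_continuous fP) f0. Qed.

Let near_D (z : C2 R) : D.[z.1] != 0 -> \forall x \near z, D.[x.1] != 0.
Proof. by move=> Dz; apply: near_neq0 (has_grad_horner D (has_grad_fst z)) Dz. Qed.

Let near_p0 (z : C2 R) : z.1 != p0 -> \forall x \near z, x.1 != p0.
Proof.
move=> zp; have zp' : z.1 - p0 != 0 by rewrite subr_eq0.
have := near_neq0 (has_gradD (has_grad_fst z) (has_grad_cst (- p0) z)) zp'.
by apply: filterS => x /=; rewrite subr_eq0.
Qed.

Let near_q (z : C2 R) : z.2 != 0 -> \forall x \near z, x.2 != 0.
Proof. by move=> z2; apply: near_neq0 (has_grad_snd z) z2. Qed.

(** With G = (X - p0) D, let phi be the difference of the two sides in [curvature_value]. It is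
    continuous up to the line, where it equals N(p0) D(p0), and it vanishes off the line, hence also
    on it. *)
Lemma holomorphic_polar : (1 < d)%N ->
  curvature_holomorphic_on d (Leg A B) [set z : C2 R | z.1 = p0] -> N.[p0] = 0.
Proof.
move=> d_gt1 [E [finE holE]].
(* The points (p0, n + 1) are infinitely many, so one of them lies outside the finite set E. *)
have [q0 q00 Eq0] : exists2 q0 : C, q0 != 0 & ~ E (p0, q0).
  apply: contrapT => none.
  pose f (n : nat) : C2 R := (p0, n.+1%:R).
  have finj : injective f by move=> m n [] /eqP; rewrite eqr_nat => /eqP [].
  apply: infinite_nat; have <- : f @^-1` E = setT.
    apply/seteqP; split=> // n _; apply: contrapT => nE; apply: none.
    by exists n.+1%:R => //; rewrite pnatr_eq0.
  by apply: finite_preimage finE => m n _ _; exact: finj.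
have [U [k [[oU Uz] holk kP]]] := holE (p0, q0) erefl Eq0.
set z0 : C2 R := (p0, q0) in Uz.
pose G := ('X - p0%:P) * D.
pose phi (x : C2 R) : C^o := 6 * (k x * x.2) * G.[x.1] ^+ 2 - (N^`().[x.1] * G.[x.1] - N.[x.1] * G^`().[x.1]).
have phi0 : phi z0 = N.[p0] * D.[p0].
  rewrite /phi /G /= derivM derivXsubC mul1r hornerD !hornerM !hornerXsubC subrr.
  by rewrite !(mul0r, mulr0, addr0, sub0r, opprK) expr0n mulr0 add0r.
suff : phi z0 = 0 by move/eqP; rewrite phi0 mulf_eq0 (negbTE D0) orbF => /eqP.
apply/eqP; apply: contraT => phi_neq0.
have [u uP] : exists u, has_grad phi z0 u.1 u.2.
  have kd := differentiable_has_grad (holk z0 Uz).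
  have Gd := has_grad_horner G (has_grad_fst z0).
  eexists (_, _) => /=; rewrite /phi.
  apply: (has_gradD (has_gradM (has_gradM (has_grad_cst 6 z0) (has_gradM kd (has_grad_snd z0)))
    (has_gradM Gd Gd)) (has_gradN (has_gradD
    (has_gradM (has_grad_horner N^`() (has_grad_fst z0)) Gd)
    (has_gradN (has_gradM (has_grad_horner N (has_grad_fst z0))
       (has_grad_horner G^`() (has_grad_fst z0))))))).
(* Near z0 and off the line, the roots are simple, the discriminant is nonzero and phi vanishes; so
   phi != 0 would confine a whole neighborhood to the line. *)
have on_line : \forall x \near z0, x.1 = p0.
  have nU : \forall x \near z0, U x by exact: open_nbhs_nbhs.
  near=> x; have Ux : U x by near: x.
  have x2 : x.2 != 0 by near: x; exact: near_q.
  have phix : phi x != 0 by near: x; exact: near_neq0 uP phi_neq0.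
  have Dx : D.[x.1] != 0 by near: x; exact: near_D.
  apply/eqP; apply: contraT => xp.
  have [s sP] := splits_exists hA hB no_common_zero det1 B_inf x.1.
  have [sinj _] := polar xp sP Dx.
  have disc : ev (web_disc d (Leg A B)) x.1 x.2 != 0.
    rewrite web_discE.
    exact: (legendre_disc_neq0 hA hB det1 B_inf no_common_zero d_gt1 x2 sP sinj).
  case/negP: phix; rewrite /phi subr_eq0; apply/eqP.
  apply: (curvature_value (kP x Ux disc) x2).
  apply: filterS2 (near_p0 xp) (near_D Dx) => y yp Dy t tP.
  have [_ E'] := polar yp tP Dy.
  rewrite /G hornerM hornerXsubC mulrAC E' mulfVK//.
have /nbhs_normP[e /= e0 eP] := on_line.
have := eP (p0 + e / 2, q0); rewrite /ball_ /= => /(_ _)/wrap[].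
  apply: norm_pair => /=; last by rewrite subrr normr0.
  rewrite opprD addrA subrr sub0r normrN gtr0_norm ?divr_gt0//.
  by rewrite ltr_pdivrMr// ltr_pMr// ltr1n.
move=> /eqP; rewrite -subr_eq0 addrC addKr mulf_eq0 (gt_eqF e0) /=.
by rewrite invr_eq0 pnatr_eq0.
Unshelve. all: by end_near. Qed.

(** If N = M (X - p0), then 6 beta = M / D and K = (M / D)' / (6 q), which is singular on the line
    only at q = 0. As the line is a component of the discriminant, points off the discriminant
    satisfy p != p0, where the formula for K is available. *)
Lemma polar_holomorphic : line_in_disc d (Leg A B) p0 -> N.[p0] = 0 ->
  curvature_holomorphic_on d (Leg A B) [set z : C2 R | z.1 = p0].
Proof.
move=> hD N0; have /factor_theorem[M ME] : root N p0 by apply/rootP.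
exists [set (p0, 0) : C2 R]; split; first exact: finite_set1.
move=> z0 zp nE; have z02 : z0.2 != 0.
  by apply/eqP => z0_0; apply: nE; case: z0 zp z0_0 => p q /= -> ->.
pose S : set (C2 R) := [set x | x.2 != 0 /\ D.[x.1] != 0].
pose k (x : C2 R) : C^o :=
  (M^`().[x.1] * D.[x.1] - M.[x.1] * D^`().[x.1]) * (6 * x.2 * (D.[x.1] * D.[x.1]))^-1.
have nS x : S x -> nbhs x S.
  by move=> [x2 Dx]; apply: filterS2 (near_q x2) (near_D Dx) => y y2 Dy.
have six : (6 : C) != 0 by rewrite pnatr_eq0.
exists S, k; split.
- split; first by rewrite openE => x Sx; exact: nS.
  by split=> //; rewrite zp.
- move=> x [x2 Dx]; have h h' := has_grad_horner h' (has_grad_fst x).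
  have ne : 6 * x.2 * (D.[x.1] * D.[x.1]) != 0 by rewrite !mulf_neq0.
  exact: (has_gradM (has_gradD (has_gradM (h M^`()) (h D))
    (has_gradN (has_gradM (h M) (h D^`())))) (has_gradV (has_gradM (has_gradM
    (has_grad_cst 6 x) (has_grad_snd x)) (has_gradM (h D) (h D))) ne)).1.
move=> x [x2 Dx] disc; have xp := line_component_disc hD disc.
have [s sP] := splits_exists hA hB no_common_zero det1 B_inf x.1.
have [sinj _] := polar xp sP Dx.
(* A curvature value exists at x, and [curvature_value] forces it to be k x. *)
have [t tP] := local_branches sP sinj.
have [k' k'P] := curvature_exists tP x2.
suff -> : k x = k' by [].
have := @curvature_value M D x k' k'P x2.
move=> /(_ _)/wrap[|E]; last first.
  rewrite /k -E; move: x.2 x2 D.[x.1] Dx => q q0 D' D'0; field.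
  by rewrite D'0 q0.
apply: filterS2 (near_p0 xp) (near_D Dx) => y yp Dy r rP.
have [_ E] := polar yp rP Dy; apply: (mulfI (x := y.1 - p0)); first by rewrite subr_eq0.
by rewrite mulrCA E ME hornerM hornerXsubC mulrCA mulfV// mulr1 mulrC.
Qed.

End LegendreCurvature.

Theorem theorem3p1 (R : realType) (d : nat) (hd : (3 <= d)%N)
  (A B : bipoly R)
  (hA : A \is ishomog1 d mdeg) (hB : B \is ishomog1 d mdeg)
  (hAB : mcoprime A B)
  (p0 : R[i]) (hD : line_in_disc d (Leg A B) p0)
  (n : nat) (a b : 'I_n -> R[i]) (hab : enumerates_fiber A B p0 a b)
  (nu : 'I_n -> nat)
  (hnu : forall i, nu i = ramification_index A B (a i) (b i))
  (P : 'I_n -> bipoly R)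
  (hP : forall i,
     P i * (mpolyC 2 (b i) * var R ord_max - mpolyC 2 (a i) * var R ord0)
             ^+ nu i
     = A * mpolyC 2 (ev B (b i) (a i)) - mpolyC 2 (ev A (b i) (a i)) * B)
  (Q : 'I_n -> bipoly R)
  (hQ : forall i, Q i = Qpoly A B (P i) (nu i)) :
  curvature_holomorphic_on d (Leg A B) [set z : C2 R | z.1 = p0] <->
  \sum_(i < n)
     (1 - (nu i)%:R^-1) *
     ((p0 * b i - a i) * ev (Q i) (b i) (a i)
      / (ev (P i) (b i) (a i) * ev B (b i) (a i))) = 0.
Proof.
have ncz := coprime_no_common_zero hA hB hAB.
have [x0 [x1 [y0 [y1 [det1 B_inf]]]]] := chart_exists hB (ltn_trans (isT : 0 < 2)%N hd).
have [ab0 ab_inj ab_all] := hab.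
have ab_neq0 i : (a i, b i) != (0, 0) := (ab0 i).1.
have ab_fiber i : eval2 A (b i) (a i) = - p0 * eval2 B (b i) (a i).
  by have [_] := ab0 i; rewrite /in_fiber /same_point mulr1 mulNr !evE => <-; rewrite opprK.
have {}ab_all a' b' : (a', b') != (0, 0) -> eval2 A b' a' = - p0 * eval2 B b' a' ->
    exists i, a' * b i = a i * b'.
  move=> ne E; apply: ab_all => //.
  by rewrite /in_fiber /same_point mulr1 !evE E mulNr opprK.
(* The two coordinates of [P1_chart] are separated, as [fiber_factorization] takes them. *)
have nuE i : nu i = mup 0
   (pull (if b i != 0 then (b i)%:P else 'X)
         (if b i != 0 then (a i)%:P + 'X else (a i)%:P) (- A) *
      (eval2 B (b i) (a i))%:P -
    (eval2 (- A) (b i) (a i))%:P *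
    pull (if b i != 0 then (b i)%:P else 'X)
         (if b i != 0 then (a i)%:P + 'X else (a i)%:P) B).
  by rewrite hnu /ramification_index /P1_chart; case: ifP.
have [fact [sum_nu nu_gt0]] :=
  fiber_factorization hA hB ncz det1 B_inf ab_neq0 ab_fiber ab_inj ab_all nuE.
have sg_inj := fiber_param_inj hB ncz det1 B_inf ab_neq0 ab_fiber ab_inj.
have [N [D [D0 ND polar]]] := web_trace_polar_part x0 x1 y0 y1
  (lead_coef_neq0 ncz det1 B_inf) sg_inj nu_gt0 fact sum_nu (coprime_line_poly ncz det1).
(* N / D at p0 is the residue of 6 beta, so both implications reduce to N(p0) = 0. *)
have -> : \sum_(i < n) (1 - (nu i)%:R^-1) *
     ((p0 * b i - a i) * ev (Q i) (b i) (a i)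
      / (ev (P i) (b i) (a i) * ev B (b i) (a i))) = - (N.[p0] / D.[p0]).
  rewrite ND opprK -(target_sum hA hB ncz det1 B_inf ab_neq0 ab_fiber ab_inj ab_all nuE hP).
  apply: eq_bigr => i _; congr (_ * (_ * _ / _)).
  rewrite hQ /Qpoly /ev; set h := tnth _.
  rewrite [LHS]mevalD; congr (_ + _).
    by rewrite [LHS]mevalM [X in X * _]mevalM [X in _ * X * _]mevalB mevalC.
  by rewrite [LHS]mevalM [X in _ * X]mevalB mevalC !mevalM.
have d2 : (1 < d)%N by exact: ltn_trans hd.
split.
  move=> /(holomorphic_polar hA hB ncz det1 B_inf D0 polar d2) ->.
  by rewrite mul0r oppr0.
move/eqP; rewrite oppr_eq0 mulf_eq0 invr_eq0 (negbTE D0) orbF => /eqP N0.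
exact: (polar_holomorphic hA hB ncz det1 B_inf D0 polar hD N0).
Qed.
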